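(* Let $\alpha>0$ and let $h$ be as in the context. The following are equivalent: (i) there exists a function $u_*\in D(m)$ such that, with $\gamma(t)=(1+t)^{1/\alpha}$ and $c_*(t,x)=\gamma(t)^2u_*(\gamma(t)x)$, we have $c_*(t,\cdot)\in D(m)$ for all $t\ge0$, $c_*$ is a solution of the fragmentation equation with initial condition $u_*$ (i.e. $c_*$ is a self-similar solution), and every solution $c$ of the fragmentation equation with initial condition $c_0\in D(m)$ satisfies $$\lim_{t\to\infty}\int_0^\infty |c(t,x)-c_*(t,x)|\,x\,dx=0;$$ (ii) $\displaystyle\int_0^1 \log z\, h(z)\,z\,dz>-\infty.$
   Context: Fix $\alpha>0$ and a Borel function $h\colon(0,1)\to[0,\infty)$ with $\int_0^1 h(r)\,r\,dr=1$. Let $m(dx)=x\,dx$ on $(0,\infty)$, $L^1=L^1((0,\infty),m)$ with norm $\|f\|=\int_0^\infty|f(x)|x\,dx$, and $D(m)=\{f\in L^1: f\ge0,\ \|f\|=1\}$. The fragmentation equation is $$\partial_t c(t,x)=\int_x^\infty \frac1y h\Big(\frac xy\Big) y^\alpha c(t,y)\,dy-x^\alpha c(t,x),\quad t,x>0,\qquad c(0,x)=c_0(x).$$ For $c_0\in D(m)$, ''the solution'' $c$ means the mass-conserving solution with $c(t,\cdot)\in D(m)$ given by the stochastic semigroup on $L^1$; equivalently, $c(t,\cdot)$ is the density with respect to $m$ of $Y(t)$, where $\{Y(t)\}$ is the pure jump Markov process on $(0,\infty)$ which, in state $x$, waits an exponential time with mean $x^{-\alpha}$ and then jumps to $\theta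 x$, with $\theta\in(0,1)$ independent having distribution $P(\theta\le r)=\int_0^r h(z)z\,dz$, and $Y(0)$ has density $c_0$ with respect to $m$. *)

(* Defs.v *)
From HB Require Import structures.
From mathcomp Require Import all_boot all_order all_algebra.
From mathcomp Require Import all_classical all_reals all_analysis.
Set Implicit Arguments. Unset Strict Implicit. Unset Printing Implicit Defensive.
Import Order.TTheory GRing.Theory Num.Theory.
Import numFieldNormedType.Exports.
Local Open Scope classical_set_scope.
Local Open Scope ring_scope.
Local Open Scope ereal_scope.

Definition pos_half (R : realType) : set R := `]0%R, +oo[%classic.
Definition unit_open (R : realType) : set R := `]0%R, 1%R[%classic.

Definition Dm (R : realType) (f : R -> R) : Prop :=
  [/\ measurable_fun (@pos_half R) f,
      (forall x : R, (0 < x)%R -> (0 <= f x)%R) &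
      \int[@lebesgue_measure R]_(x in @pos_half R) (f x * x)%:E = 1].

(* pn alpha h n t x B = P_x(Y(t) in B and exactly n jumps occurred in [0,t]),
   for the pure jump process with jump rate x^alpha in state x, jumping to
   theta x where theta has density r |-> h r * r on (0,1). Defined by
   conditioning on the first jump time s (density x^alpha e^{-x^alpha s}). *)
Fixpoint pn (R : realType) (alpha : R) (h : R -> R) (n : nat)
    (t x : R) (B : set R) : \bar R :=
  match n with
  | O => (expR (- (x `^ alpha) * t) * \1_B x)%:E
  | S k => \int[@lebesgue_measure R]_(s in `[0%R, t]%classic)
             ((x `^ alpha * expR (- (x `^ alpha) * s))%:E *
              \int[@lebesgue_measure R]_(r in @unit_open R)
                 ((h r * r)%:E * pn alpha h k (t - s) (r * x) B))
  end.

(* Transition probability P_x(Y(t) in B) of the (non-explosive) jump process. *)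
Definition trans (R : realType) (alpha : R) (h : R -> R)
    (t x : R) (B : set R) : \bar R :=
  \sum_(0 <= n <oo) pn alpha h n t x B.

(* c is "the solution" of the fragmentation equation with initial condition c0:
   for every t >= 0, c(t,.) is in D(m) and is the density w.r.t. m(dx) = x dx
   of the law of Y(t), where Y(0) has density c0 w.r.t. m. *)
Definition is_solution (R : realType) (alpha : R) (h : R -> R)
    (c0 : R -> R) (c : R -> R -> R) : Prop :=
  forall t : R, (0 <= t)%R ->
    Dm (c t) /\
    forall B : set R, measurable B -> B `<=` @pos_half R ->
      \int[@lebesgue_measure R]_(x in B) (c t x * x)%:E =
      \int[@lebesgue_measure R]_(x in @pos_half R)
         ((c0 x * x)%:E * trans alpha h t x B).

Definition gamma_ss (R : realType) (alpha t : R) : R := (1 + t) `^ (alpha^-1).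
Definition self_sim (R : realType) (alpha : R) (u : R -> R) : R -> R -> R :=
  fun t x => (gamma_ss alpha t ^+ 2 * u (gamma_ss alpha t * x))%R.

Definition dist_m (R : realType) (c d : R -> R -> R) (t : R) : \bar R :=
  \int[@lebesgue_measure R]_(x in @pos_half R) (`|c t x - d t x| * x)%:E.

(* Main.v *)
Require Import Defs.
From HB Require Import structures.
From mathcomp Require Import all_boot all_order all_algebra.
From mathcomp Require Import all_classical all_reals all_analysis.
From mathcomp Require Import measurable_realfun ring lra.
Import Order.TTheory GRing.Theory Num.Theory.
Import numFieldNormedType.Exports.
Set Implicit Arguments. Unset Strict Implicit. Unset Printing Implicit Defensive.
Local Open Scope classical_set_scope.
Local Open Scope ring_scope.
Local Open Scope ereal_scope.

(** Write [w_B(t, x)] for the transition probability of the jump process, [theta] for the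
    jump factor and [Q w(x) = E w(theta x)].

    Necessity.  If [u dm] is the law of a self-similar solution, then scaling bounds by
    [u dm(a < x <= a gamma(t))] the probability of jumping over the level [a] before
    time [t].  Integrating over [a] against [da / a] gives, on the right, at most
    [log gamma(t)] and, on the left, a positive multiple of [E (- log theta)].

    Existence.  The perpetuity [I = E_0 + theta_1^alpha E_1 + (theta_1 theta_2)^alpha E_2 + ..]
    with independent standard exponential [E_i] has a density [k], and
    [us x = k (x^alpha) / (c x^2)] has finite mass under [m] exactly when the log-moment is
    finite.  That dilating [us] solves the equation follows by pairing the forward
    equation, satisfied by the dilations, with the backward equation of [w_B].

    Convergence.  Uniformizing the process at the rate [x^alpha], the law at time [t] is a
    Poisson mixture of the laws of a chain, and one more jump shifts the weights;
    hence [|w_B - Q w_B|(t, x)] is of order [(x^alpha t)^(-1/2)], uniformly in [B].  A version of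
    the Choquet-Deny theorem for asymptotically [Q]-harmonic sequences (the martingale
    increments of [w] have vanishing variance, and [theta] has a density) then shows that
    [w_B(t, x) - w_B(t, y)] tends to zero uniformly in [B], so any two solutions merge
    in [L^1(m)]. *)

(** Origin of the profile, heuristically: let a fragment come down from infinite size, starting at
    time [-1]. The logarithms of its sizes form a stationary renewal set, so sizes near [x] occur
    with intensity [dx / x] divided by [E (- log theta)]. Read backwards from [x], the waiting times
    are [x^-alpha] times the terms of the perpetuity: [x] is left at age [x^-alpha I], with
    [I = E_0 + theta^alpha I'], and was entered at age [x^-alpha theta^alpha I']. The chance of
    being at [x] at time [t] is thus proportional to [P(theta^alpha I' <= z) - P(I <= z)] at
    [z = (1 + t) x^alpha]. This difference is [k], and as [E_0] is exponential it is also the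
    density of [I]. No path space is built: transition probabilities are handled through their
    series and its backward equation. Total mass enters as the inequality that a set and its
    complement have probabilities adding to at most [1]; lower bounds for both sets then become
    two-sided estimates. The pairing of forward and backward equations leaves a common term to
    cancel. This is legitimate because the self-similar law has a finite expected number of jumps in
    bounded time. *)

Notation leb := (@lebesgue_measure _).

(** * Measurability, Tonelli and affine changes of variables on the line *)

Lemma measurable_invr (R : realType) : measurable_fun [set: R] (@GRing.inv R).
Proof.
have -> : (@GRing.inv R) = (fun x : R => if (0 < x)%R then expR (- ln x)
    else if (0 < - x)%R then (- expR (- ln (- x)))%R else 0%R).
  apply/funext => x; case: ltrP => [x0|x0].
    by rewrite expRN lnK.
  case: ltrP => [x1|x1]; first by rewrite expRN lnK// invrN opprK.
  have /eqP -> : (x == 0)%R by rewrite eq_le x0 -oppr_le0 x1.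
  by rewrite invr0.
apply: measurable_fun_ifT; first exact: measurable_fun_ltr.
  apply: measurableT_comp; first exact: measurable_expR.
  by apply: measurableT_comp => //; exact: measurable_ln.
apply: measurable_fun_ifT; first exact: measurable_fun_ltr.
  apply: measurableT_comp => //; apply: measurableT_comp => //.
  apply: measurableT_comp => //; apply: measurableT_comp => //.
by [].
Qed.

(** Rules are selected by the syntactic head of the function; the headless pattern, tried late, is
    for [if ... then ... else]. The first rule applies a measurable function of the context to a
    measurable argument. *)
Ltac meas1 :=
  match goal with
  | H : measurable_fun _ ?W |- measurable_fun _ (fun x => ?W (@?g x)) =>
      apply: (measurableT_comp (f := W) H (g := g))
  | |- measurable_fun _ (fun x => x) => exact: measurable_id
  | |- measurable_fun _ (fun _ => ?c) => exact: measurable_cst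
  | |- measurable_fun _ (fun x => x.1) => exact: measurable_fst
  | |- measurable_fun _ (fun x => x.2) => exact: measurable_snd
  | |- measurable_fun _ (fun x => (@?f x, @?g x)) =>
      apply/measurable_fun_pair
  | |- measurable_fun _ (fun x => (@?f x).1) =>
      apply: (measurableT_comp (f := fst) measurable_fst (g := f))
  | |- measurable_fun _ (fun x => (@?f x).2) =>
      apply: (measurableT_comp (f := snd) measurable_snd (g := f))
  | |- measurable_fun _ (fun x => (@?f x)%:E) => apply/measurable_EFinP
  | |- measurable_fun _ (fun x => mule (@?f x) (@?g x)) =>
      apply: (emeasurable_funM (f := f) (g := g))
  | |- measurable_fun _ (fun x => GRing.mul (@?f x) (@?g x)) =>
      apply: (measurable_funM (f := f) (g := g))
  | |- measurable_fun _ (fun x => GRing.add (@?f x) (GRing.opp (@?g x))) =>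
      apply: (measurable_funB (f := f) (g := g))
  | |- measurable_fun _ (fun x => GRing.add (@?f x) (@?g x)) =>
      first [ apply: (measurable_funD (f := f) (g := g))
            | apply: (emeasurable_funD (f := f) (g := g)) ]
  | |- measurable_fun _ (fun x => GRing.opp (@?f x)) =>
      apply: (measurable_funN (f := f))
  | |- measurable_fun _ (fun x => expR (@?f x)) =>
      apply: (measurableT_comp (@measurable_expR _) (g := f))
  | |- measurable_fun _ (fun x => ln (@?f x)) =>
      apply: (measurableT_comp (@measurable_ln _) (g := f))
  | |- measurable_fun _ (fun x => powR (@?f x) ?a) =>
      apply: (measurableT_comp (f := fun u => powR u a) (@measurable_powR _ a) (g := f))
  | |- measurable_fun _ (fun x => GRing.exp (@?f x) ?n) =>
      apply: (measurable_funX (f := f))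
  | |- measurable_fun _ (fun x => \1_ _ (@?f x)) =>
      apply: (measurableT_comp (measurable_indic _) (g := f))
  | |- measurable_fun _ (fun x => Order.le (@?f x) (@?g x)) =>
      apply: (measurable_fun_ler (f := f) (g := g))
  | |- measurable_fun _ (fun x => Order.lt (@?f x) (@?g x)) =>
      apply: (measurable_fun_ltr (f := f) (g := g))
  | |- measurable_fun _ (fun x => andb (@?f x) (@?g x)) =>
      apply: (measurable_and (f := f) (g := g))
  | |- measurable_fun _ (fun x => GRing.inv (@?f x)) =>
      apply: (measurableT_comp (@measurable_invr _) (g := f))
  | |- measurable_fun _ (Order.le ?a) =>
      apply: (measurable_fun_ler (f := fun=> a) (g := fun x => x))
  | |- measurable_fun _ (Order.lt ?a) =>
      apply: (measurable_fun_ltr (f := fun=> a) (g := fun x => x))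
  | |- measurable_fun _ (GRing.mul ?a) =>
      apply: (measurable_funM (f := fun=> a) (g := fun x => x))
  | |- measurable_fun _ (GRing.add ?a) =>
      apply: (measurable_funD (f := fun=> a) (g := fun x => x))
  | |- measurable_fun _ (GRing.opp) => apply: (measurable_funN (f := fun x => x))
  | |- measurable_fun _ GRing.inv => exact: measurable_invr
  | |- measurable_fun _ expR => exact: measurable_expR
  | |- measurable_fun _ (@ln _) => exact: measurable_ln
  | |- measurable_fun _ (powR ?a) => exact: measurable_powRr
  | |- measurable_fun _ _ => apply: measurable_fun_ifT
  | |- measurable _ => exact: measurableT
  end.
Ltac meas := repeat (first [ match goal with
  | H : measurable_fun ?D ?f |- measurable_fun ?D ?f => exact: H end
  | assumption | meas1]).


Lemma ge0_tonelli (R : realType) (f : R -> R -> \bar R) :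
  measurable_fun setT (fun p : R * R => f p.1 p.2) ->
  (forall x y, 0 <= f x y) ->
  \int[leb]_x \int[leb]_y f x y = \int[leb]_y \int[leb]_x f x y.
Proof.
move=> mf f0.
exact: (@fubini_tonelli _ _ _ _ _ leb leb _ mf (fun p => f0 p.1 p.2)).
Qed.

Lemma measurable_parametric_integral d (T : measurableType d) (R : realType)
    (f : T -> R -> \bar R) :
  measurable_fun setT (fun p : T * R => f p.1 p.2) ->
  (forall x y, 0 <= f x y) ->
  measurable_fun setT (fun x => \int[leb]_y f x y).
Proof.
move=> mf f0.
exact: (@measurable_fun_fubini_tonelli_F _ _ _ _ _ leb _ mf (fun p => f0 p.1 p.2)).
Qed.

(** Lebesgue measure equals [|a|] times its image under the affine map, since both agree on the
    intervals []u, v]]; for negative [a] the preimage is closed on the left instead. *)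
Lemma ge0_integral_affine (R : realType) (a b : R) (f : R -> \bar R) :
  a != 0%R -> measurable_fun setT f -> (forall x, 0 <= f x) ->
  `|a|%:E * \int[leb]_x f (a * x + b)%R = \int[leb]_x f x.
Proof.
move=> a0 mf f0.
pose phi (x : measurableTypeR R) : measurableTypeR R := (a * x + b)%R.
have mphi : measurable_fun setT phi.
  by apply: measurable_funD => //; exact: measurable_funM.
pose m2 := mscale (NngNum (normr_ge0 a)) (pushforward (@lebesgue_measure R) phi).
have m2E A : measurable A -> lebesgue_measure A = m2 mphi A.
  move=> mA; apply: lebesgue_measure_unique => // _ [[u v]] _ <-.
  transitivity (`|a|%:E * leb (phi @^-1` `]u, v]%classic)); last by [].
  rewrite lebesgue_measure_itv/= lte_fin.
  have [a_gt0|a_lt0|] := ltgtP 0%R a; last by move/eqP; rewrite eq_sym (negbTE a0).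
    have -> : phi @^-1` `]u, v]%classic = `]((u - b) / a)%R, ((v - b) / a)%R]%classic.
      apply/seteqP; split => x /=; rewrite !in_itv/= /phi ltr_pdivrMr//
        ler_pdivlMr// ltrBlDr lerBrDr (mulrC x); exact.
    rewrite lebesgue_measure_itv/= lte_fin ltr_pM2r ?invr_gt0// ltrD2r.
    case: ifPn => _; last by rewrite mule0.
    by rewrite -!EFinB -EFinM gtr0_norm//; congr (_%:E); field.
  have -> : phi @^-1` `]u, v]%classic = `[((v - b) / a)%R, ((u - b) / a)%R[%classic.
    apply/seteqP; split => x /=; rewrite !in_itv/= /phi ltr_ndivlMr//
      ler_ndivrMr// ltrBlDr lerBrDr (mulrC x) andbC; exact.
  rewrite lebesgue_measure_itv/= lte_fin ltr_nM2r ?invr_lt0// ltrD2r.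
  case: ifPn => _; last by rewrite mule0.
  by rewrite -!EFinB -EFinM ltr0_norm//; congr (_%:E); field.
transitivity (\int[m2 mphi]_x f x); last first.
  by apply: eq_measure_integral => A mA _; exact: (esym (m2E A mA)).
rewrite ge0_integral_mscale//=; congr (_ * _).
by rewrite ge0_integral_pushforward.
Qed.

Lemma ge0_integral_shift (R : realType) (b : R) (f : R -> \bar R) :
  measurable_fun setT f -> (forall x, 0 <= f x) ->
  \int[leb]_x f (x - b)%R = \int[leb]_x f x.
Proof.
move=> mf f0; rewrite -[RHS](@ge0_integral_affine _ 1%R (- b)%R)//.
by rewrite normr1 mul1e; apply: eq_integral => x _; rewrite mul1r.
Qed.

Lemma ge0_integral_reflect (R : realType) (b : R) (f : R -> \bar R) :
  measurable_fun setT f -> (forall x, 0 <= f x) ->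
  \int[leb]_x f (b - x)%R = \int[leb]_x f x.
Proof.
move=> mf f0; rewrite -[RHS](@ge0_integral_affine _ (-1)%R b)//.
by rewrite normrN1 mul1e; apply: eq_integral => x _; rewrite mulN1r addrC.
Qed.

(** Locked, so that convolutions are manipulated by their algebra alone and unification does not
    unfold the integral. *)
HB.lock Definition convol (R : realType) (a b : R -> \bar R) (t : R) : \bar R :=
  \int[leb]_s (a s * b (t - s)%R).

Lemma convolE (R : realType) (a b : R -> \bar R) (t : R) :
  convol a b t = \int[leb]_s (a s * b (t - s)%R).
Proof. by rewrite unlock. Qed.

(** * Algebra of convolutions of nonnegative functions *)

Section convolution.
Variable R : realType.
Implicit Types a b c : R -> \bar R.

Lemma convol_ge0 a b t : (forall x, 0 <= a x) -> (forall x, 0 <= b x) ->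
  0 <= convol a b t.
Proof.
by move=> a0 b0; rewrite convolE; apply: integral_ge0 => x _; exact: mule_ge0.
Qed.

Lemma measurable_convol_param d (T : measurableType d) (a b : T -> R -> \bar R) :
  measurable_fun setT (fun p : T * R => a p.1 p.2) ->
  measurable_fun setT (fun p : T * R => b p.1 p.2) ->
  (forall x s, 0 <= a x s) -> (forall x s, 0 <= b x s) ->
  measurable_fun setT (fun p : T * R => convol (a p.1) (b p.1) p.2).
Proof.
move=> ma mb a0 b0; under eq_fun do rewrite convolE.
apply: (@measurable_parametric_integral _ _ _
  (fun (p : T * R) s => a p.1 s * b p.1 (p.2 - s)%R)); last first.
  by move=> x y; exact: mule_ge0.
apply: emeasurable_funM.
  by apply: (measurableT_comp ma (g := fun p : (T * R) * R => (p.1.1, p.2))); meas.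
by apply: (measurableT_comp mb (g := fun p : (T * R) * R => (p.1.1, p.1.2 - p.2)%R)); meas.
Qed.

Lemma measurable_convol a b : measurable_fun setT a -> measurable_fun setT b ->
  (forall x, 0 <= a x) -> (forall x, 0 <= b x) -> measurable_fun setT (convol a b).
Proof.
move=> ma mb a0 b0; rewrite (_ : convol a b = fun t => \int[leb]_s (a s * b (t - s)%R)); last first.
  by apply/funext => t; rewrite convolE.
apply: (@measurable_parametric_integral _ R R (fun t s => a s * b (t - s)%R)).
  by meas.
by move=> x y; exact: mule_ge0.
Qed.

Lemma convolC a b : measurable_fun setT a -> measurable_fun setT b ->
  (forall x, 0 <= a x) -> (forall x, 0 <= b x) -> convol a b = convol b a.
Proof.
move=> ma mb a0 b0; apply/funext => t; rewrite !convolE.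
rewrite -(ge0_integral_reflect t (f := fun s => a s * b (t - s)%R)).
- by apply: eq_integral => x _; rewrite subKr muleC.
- by meas.
- by move=> x; exact: mule_ge0.
Qed.

Lemma convolA a b c : measurable_fun setT a -> measurable_fun setT b ->
  measurable_fun setT c ->
  (forall x, 0 <= a x) -> (forall x, 0 <= b x) -> (forall x, 0 <= c x) ->
  convol (convol a b) c = convol a (convol b c).
Proof.
move=> ma mb mc a0 b0 c0; apply/funext => t; rewrite !convolE.
transitivity (\int[leb]_s \int[leb]_u (a u * b (s - u)%R * c (t - s)%R)).
  apply: eq_integral => s _; rewrite convolE ge0_integralZr//; first by meas.
  by move=> x _; exact: mule_ge0.
rewrite (ge0_tonelli (f := fun s u => a u * b (s - u)%R * c (t - s)%R)).
- apply: eq_integral => u _.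
  under eq_integral do rewrite -muleA.
  rewrite ge0_integralZl//; last 2 first.
  + by meas.
  + by move=> x _; exact: mule_ge0.
  congr (_ * _); rewrite convolE.
  rewrite -[RHS](ge0_integral_shift u (f := fun s => b s * c (t - u - s)%R)).
  + by apply: eq_integral => s _; congr (_ * c _); ring.
  + by meas.
  + by move=> x; exact: mule_ge0.
- by meas.
- by move=> x y; rewrite !mule_ge0.
Qed.

Lemma convolDr a b c : measurable_fun setT a -> measurable_fun setT b ->
  measurable_fun setT c ->
  (forall x, 0 <= a x) -> (forall x, 0 <= b x) -> (forall x, 0 <= c x) ->
  convol a (fun t => b t + c t) = (fun t => convol a b t + convol a c t).
Proof.
move=> ma mb mc a0 b0 c0; apply/funext => t; rewrite !convolE.
rewrite -ge0_integralD//.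
- by apply: eq_integral => s _; rewrite ge0_muleDr.
- by move=> x _; exact: mule_ge0.
- by meas.
- by move=> x _; exact: mule_ge0.
- by meas.
Qed.

Lemma convolDl a b c : measurable_fun setT a -> measurable_fun setT b ->
  measurable_fun setT c ->
  (forall x, 0 <= a x) -> (forall x, 0 <= b x) -> (forall x, 0 <= c x) ->
  convol (fun t => a t + b t) c = (fun t => convol a c t + convol b c t).
Proof.
move=> ma mb mc a0 b0 c0; rewrite convolC//.
- by rewrite convolDr// (convolC ma)// (convolC mb).
- by meas.
- by move=> x; exact: adde_ge0.
Qed.

Lemma convolZr k a b : measurable_fun setT a -> measurable_fun setT b -> 0 <= k ->
  (forall x, 0 <= a x) -> (forall x, 0 <= b x) ->
  convol a (fun t => k * b t) = (fun t => k * convol a b t).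
Proof.
move=> ma mb k0 a0 b0; apply/funext => t; rewrite !convolE.
rewrite -ge0_integralZl//.
- by apply: eq_integral => s _; rewrite muleCA.
- by meas.
- by move=> x _; exact: mule_ge0.
Qed.

Lemma convolZl k a b : measurable_fun setT a -> measurable_fun setT b -> 0 <= k ->
  (forall x, 0 <= a x) -> (forall x, 0 <= b x) ->
  convol (fun t => k * a t) b = (fun t => k * convol a b t).
Proof.
move=> ma mb k0 a0 b0; rewrite convolC//.
- by rewrite convolZr// (convolC ma).
- by meas.
- by move=> x; exact: mule_ge0.
Qed.

Lemma le_convol a b c : measurable_fun setT a -> measurable_fun setT b ->
  measurable_fun setT c ->
  (forall x, 0 <= a x) -> (forall x, 0 <= b x) -> (forall x, b x <= c x) ->
  forall t, convol a b t <= convol a c t.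
Proof.
move=> ma mb mc a0 b0 bc t; rewrite !convolE; apply: ge0_le_integral => //.
- by move=> x _; exact: mule_ge0.
- by meas.
- by meas.
- by move=> s _; exact: lee_wpmul2l.
Qed.

End convolution.

(** * Exponential kernels and the resolvent identity *)

Lemma integral_derivative (R : realType) (F f : R -> R) (a b : R) : (a <= b)%R ->
  (forall x, (a <= x <= b)%R -> is_derive x 1%R F (f x)) ->
  (forall x, (a <= x <= b)%R -> {for x, continuous f}) ->
  \int[leb]_(x in `[a, b]) (f x)%:E = (F b - F a)%:E.
Proof.
rewrite le_eqVlt => /predU1P[<- _ _|ab dF cf].
  by rewrite set_itv1 integral_set1 subrr.
rewrite (@continuous_FTC2 _ f F)//.
- apply: continuous_in_subspaceT => x; rewrite inE/= in_itv/= => xab.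
  exact: cf.
- have cF x : (a <= x <= b)%R -> {for x, continuous F}.
    move=> /dF h; apply: differentiable_continuous; apply/derivable1_diffP.
    by case: h.
  split.
  + by move=> x; rewrite in_itv/= => /andP[/ltW ? /ltW ?]; case: (dF x) => //; apply/andP.
  + by apply: cvg_at_right_filter; apply: cF; rewrite lexx ltW.
  + by apply: cvg_at_left_filter; apply: cF; rewrite lexx ltW.
- move=> x; rewrite in_itv/= => /andP[/ltW ax /ltW xb].
  by rewrite derive1E; case: (dF x) => //; apply/andP.
Qed.

(** Survival function of an exponential time of rate [l]. [Ex 0] is the Heaviside function: it
    stands for the constant [1] at nonnegative times, and convolution with it takes primitives. *)
Definition Ex (R : realType) (l t : R) : \bar R :=
  if (0 <= t)%R then (expR (- l * t))%:E else 0.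

Lemma Ex_ge0 (R : realType) (l t : R) : 0 <= Ex l t.
Proof. by rewrite /Ex; case: ifP => // _; rewrite lee_fin expR_ge0. Qed.

Lemma Ex_fin_num (R : realType) (l t : R) : Ex l t \is a fin_num.
Proof. by rewrite /Ex; case: ifP. Qed.

Lemma measurable_Ex2 (R : realType) :
  measurable_fun setT (fun p : R * R => Ex p.1 p.2).
Proof. by rewrite /Ex; meas. Qed.

Lemma measurable_Ex (R : realType) (l : R) : measurable_fun setT (Ex l).
Proof. by rewrite /Ex; meas. Qed.

Lemma convol_itv (R : realType) (a b : R -> \bar R) (t : R) :
  (forall s, (s < 0)%R -> a s = 0) -> (forall s, (s < 0)%R -> b s = 0) ->
  convol a b t = \int[leb]_(s in `[0%R, t]) (a s * b (t - s)%R).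
Proof.
move=> a0 b0; rewrite convolE [RHS]integral_mkcond; apply: eq_integral => s _.
rewrite patchE; case: ifPn => //; rewrite notin_setE/= in_itv/= => /negP.
rewrite negb_and -!ltNge => /orP[s0|ts]; first by rewrite a0// mul0e.
by rewrite b0 ?mule0// subr_lt0.
Qed.

Lemma Ex_lt0 (R : realType) (l s : R) : (s < 0)%R -> Ex l s = 0.
Proof. by move=> s0; rewrite /Ex leNgt s0. Qed.

Lemma convol_lt0 (R : realType) (a b : R -> \bar R) (t : R) :
  (forall s, (s < 0)%R -> a s = 0) -> (forall s, (s < 0)%R -> b s = 0) ->
  (t < 0)%R -> convol a b t = 0.
Proof.
by move=> a0 b0 t0; rewrite convol_itv// set_itv_ge ?integral_set0// bnd_simp -ltNge.
Qed.

Lemma integral_expR (R : realType) (a t : R) : (0 <= t)%R ->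
  \int[leb]_(s in `[0%R, t]) (a * expR (- a * s))%:E = (1 - expR (- a * t))%:E.
Proof.
move=> t0; pose F (s : R) := (- expR (- a * s))%R.
have dF (x : R) : is_derive x 1%R F (a * expR (- a * x))%R.
  apply: is_derive_eq.
  by rewrite /GRing.scale/= mulr1 mulrN mulNr opprK mulrC.
have cF : continuous (fun x : R => a * expR (- a * x))%R.
  move=> x; apply: cvgM; first exact: cvg_cst.
  apply: (cvg_comp (fun x : R => - a * x)%R expR); last exact: continuous_expR.
  by apply: cvgM; [exact: cvg_cst|exact: cvg_id].
rewrite (integral_derivative t0 (fun x _ => dF x) (fun x _ => cF x)).
by rewrite /F mulr0 expR0 opprK addrC.
Qed.

(** The integrand [e^(-m s) e^(-l (t - s))] equals [e^(-l t) e^(-(m - l) s)], whose integral is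
    elementary. All comparisons between kernels of different rates reduce to this. *)
Lemma resolvent (R : realType) (l m t : R) : (0 <= l <= m)%R ->
  Ex l t = Ex m t + (m - l)%:E * convol (Ex m) (Ex l) t.
Proof.
move=> /andP[l0 lm]; have [t0|t0] := leP 0%R t; last first.
  by rewrite !Ex_lt0// (convol_lt0 _ _ t0) ?mule0 ?add0e//; exact: Ex_lt0.
rewrite convol_itv; [|exact: Ex_lt0|exact: Ex_lt0].
rewrite -ge0_integralZl//; last 3 first.
- apply: (measurable_funS (E := setT)) => //; rewrite /Ex; meas.
- by move=> x _; rewrite mule_ge0 ?Ex_ge0.
- by rewrite lee_fin subr_ge0.
transitivity (Ex m t + (expR (- l * t))%:E *
    \int[leb]_(s in `[0%R, t]) ((m - l) * expR (- (m - l) * s))%:E); last first.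
  congr (_ + _); rewrite -ge0_integralZl//; last 2 first.
  - by meas.
  - by move=> x _; rewrite lee_fin mulr_ge0 ?expR_ge0// subr_ge0.
  apply: eq_integral => s; rewrite inE/= in_itv/= => /andP[s0 st].
  rewrite /Ex s0 subr_ge0 st -!EFinM mulrCA -!expRD; congr (_ * expR _)%:E.
  by ring.
rewrite integral_expR// /Ex t0 -EFinM -EFinD mulrBr mulr1 -expRD; congr (_%:E).
have -> : (- l * t + - (m - l) * t = - m * t)%R by ring.
by ring.
Qed.

Lemma Ex0E (R : realType) (t : R) : (0 <= t)%R -> Ex 0%R t = 1.
Proof. by move=> t0; rewrite /Ex t0 oppr0 mul0r expR0. Qed.

(** The resolvent identity with smaller rate [0]: by time [t] the first jump has either not occurred
    or occurred, so the constant [1] solves the renewal equation of rate [l]. *)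
Lemma total_Ex (R : realType) (t : R) : (0 <= t)%R ->
  forall l, (0 <= l)%R -> Ex l t + l%:E * convol (Ex l) (Ex 0%R) t = 1.
Proof.
move=> t0 l l0; have := @resolvent _ 0%R l t; rewrite lexx l0 subr0 => <-//.
by rewrite /Ex t0 oppr0 mul0r expR0.
Qed.

(** * The jump operator on nonnegative functions *)

Definition Qe (R : realType) (q : R -> R) (f : R -> \bar R) (x : R) : \bar R :=
  \int[leb]_r ((q r)%:E * f (r * x)%R).

(** The density of [theta] is extended by zero, so that expectations are integrals over the line
    while identities have to be checked on [(0, 1)] only. *)
Definition jump_density (R : realType) (q : R -> R) : Prop :=
  [/\ measurable_fun setT q, (forall r, 0 <= q r)%R,
      (forall r, ~~ (0 < r < 1)%R -> q r = 0%R) &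
      \int[leb]_r (q r)%:E = 1].

Section jump_operator.
Variables (R : realType) (q : R -> R).
Hypothesis hq : jump_density q.
Implicit Types (f g : R -> \bar R) (x : R).
Let mq : measurable_fun setT q. Proof. by case: hq. Qed.
Let q0 : forall r, (0 <= q r)%R. Proof. by case: hq. Qed.
Let q1 : \int[leb]_r (q r)%:E = 1. Proof. by case: hq. Qed.
Let qE0 r : 0 <= (q r)%:E. Proof. by rewrite lee_fin. Qed.

Lemma Qe_ge0 f x : (forall y, 0 <= f y) -> 0 <= Qe q f x.
Proof. by move=> f0; apply: integral_ge0 => r _; rewrite mule_ge0. Qed.

Lemma Qe_cst c x : 0 <= c -> Qe q (fun=> c) x = c.
Proof.
by move=> c0; rewrite /Qe ge0_integralZr// ?q1 ?mul1e//; apply/measurable_EFinP.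
Qed.

Lemma measurable_Qe_param d (T : measurableType d) (f : T * R -> \bar R) :
  measurable_fun setT f -> (forall p, 0 <= f p) ->
  measurable_fun setT (fun p : T * R => Qe q (fun y => f (p.1, y)) p.2).
Proof.
move=> mf f0; apply: (@measurable_parametric_integral _ _ _
  (fun (p : T * R) r => (q r)%:E * f (p.1, r * p.2)%R)); last first.
  by move=> x y; rewrite mule_ge0.
by meas.
Qed.

Lemma QeD f g x : measurable_fun setT f -> measurable_fun setT g ->
  (forall y, 0 <= f y) -> (forall y, 0 <= g y) ->
  Qe q (fun y => f y + g y) x = Qe q f x + Qe q g x.
Proof.
move=> mf mg f0 g0; rewrite /Qe -ge0_integralD//.
- by apply: eq_integral => r _; rewrite ge0_muleDr.
- by move=> r _; rewrite mule_ge0.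
- by meas.
- by move=> r _; rewrite mule_ge0.
- by meas.
Qed.

Lemma le_Qe f g x : measurable_fun setT f -> measurable_fun setT g ->
  (forall y, 0 <= f y) -> (forall y, 0 <= g y) ->
  (forall r, (0 < r < 1)%R -> f (r * x)%R <= g (r * x)%R) ->
  Qe q f x <= Qe q g x.
Proof.
move=> mf mg f0 g0 fg; apply: ge0_le_integral => //.
- by move=> r _; rewrite mule_ge0.
- by meas.
- by meas.
- move=> r _; case: hq => _ _ qs _.
  have [r01|r01] := boolP (0 < r < 1)%R; last by rewrite qs ?mul0e.
  by rewrite lee_wpmul2l// fg.
Qed.

Lemma eq_Qe f g x : (forall r, (0 < r < 1)%R -> f (r * x)%R = g (r * x)%R) ->
  Qe q f x = Qe q g x.
Proof.
move=> fg; apply: eq_integral => r _; case: hq => _ _ qs _.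
have [r01|r01] := boolP (0 < r < 1)%R; last by rewrite qs ?mul0e.
by rewrite fg.
Qed.

Lemma Qe_nneseries (f : nat -> R -> \bar R) x :
  (forall n, measurable_fun setT (f n)) -> (forall n y, 0 <= f n y) ->
  Qe q (fun y => \sum_(n <oo) f n y) x = \sum_(n <oo) Qe q (f n) x.
Proof.
move=> mf f0; rewrite /Qe.
under eq_integral do rewrite -nneseriesZl//.
rewrite integral_nneseries//.
- by move=> n; have mfn := mf n; meas.
- by move=> n r _; rewrite mule_ge0.
Qed.

End jump_operator.

Lemma convol_nneseries (R : realType) (a : R -> \bar R) (b : nat -> R -> \bar R) t :
  measurable_fun setT a -> (forall n, measurable_fun setT (b n)) ->
  (forall s, a s \is a fin_num) ->
  (forall s, 0 <= a s) -> (forall n s, 0 <= b n s) ->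
  convol a (fun s => \sum_(n <oo) b n s) t = \sum_(n <oo) convol a (b n) t.
Proof.
move=> ma mb fa a0 b0; rewrite convolE; under eq_eseriesr do rewrite convolE.
rewrite -integral_nneseries//.
- by apply: eq_integral => s _; rewrite -(fineK (fa s)) nneseriesZl.
- by move=> n; have mfn := mb n; meas.
- by move=> n r _; rewrite mule_ge0.
Qed.

Definition dens (R : realType) (h : R -> R) (r : R) : R :=
  if (0 < r < 1)%R then (h r * r)%R else 0%R.

Lemma integral_dens (R : realType) (h : R -> R) (f : R -> \bar R) :
  \int[leb]_(r in @unit_open R) ((h r * r)%:E * f r) =
  \int[leb]_r ((dens h r)%:E * f r).
Proof.
rewrite integral_mkcond; apply: eq_integral => r _.
rewrite patchE /dens.
have -> : (r \in @unit_open R) = (0 < r < 1)%R.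
  by apply/idP/idP; rewrite inE /unit_open/= in_itv.
by case: ifP => //; rewrite mul0e.
Qed.

Lemma dens_jump_density (R : realType) (h : R -> R) :
  measurable_fun (@unit_open R) h ->
  (forall r : R, (0 < r)%R -> (r < 1)%R -> (0 <= h r)%R) ->
  \int[@lebesgue_measure R]_(r in @unit_open R) (h r * r)%:E = 1 ->
  jump_density (dens h).
Proof.
move=> mh h0 h1; split.
- have -> : dens h = (fun r => h r * r)%R \_ (@unit_open R).
    apply/funext => r; rewrite patchE /dens.
    have -> : (r \in @unit_open R) = (0 < r < 1)%R.
      by apply/idP/idP; rewrite inE /unit_open/= in_itv.
    by [].
  have mU : measurable (@unit_open R) by exact: measurable_itv.
  apply/(measurable_restrictT _ mU).
  by apply: measurable_funM.
- by move=> r; rewrite /dens; case: ifP => // /andP[r0 r1]; rewrite mulr_ge0 ?h0// ltW.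
- by move=> r /negbTE r01; rewrite /dens r01.
- transitivity (\int[leb]_r ((dens h r)%:E * 1)).
    by apply: eq_integral => r _; rewrite mule1.
  rewrite -(integral_dens h (fun=> 1)) -[RHS]h1.
  by apply: eq_integral => r _; rewrite mule1.
Qed.

(* Zero at negative times, so that [convol] over the line is the convolution over [[0, t]]. *)
Definition prn (R : realType) (alpha : R) (h : R -> R) (B : set R) (n : nat)
  (t x : R) : \bar R := if (0 <= t)%R then pn alpha h n t x B else 0.

Definition tr (R : realType) (alpha : R) (h : R -> R) (B : set R)
  (t x : R) : \bar R := if (0 <= t)%R then trans alpha h t x B else 0.

(** * Laws with a given number of jumps, and the backward equation *)

Section jump_process.
Variables (R : realType) (alpha : R) (h : R -> R).
Let q := dens h.
Hypothesis hq : jump_density q.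
Implicit Types (B : set R) (t x : R).
Let lam x := (x `^ alpha)%R.
Let lam0 x : (0 <= lam x)%R. Proof. exact: powR_ge0. Qed.
Let lamE0 x : 0 <= (lam x)%:E. Proof. by rewrite lee_fin. Qed.

Lemma pn_ge0 B n t x : 0 <= pn alpha h n t x B.
Proof.
elim: n t x => [|n IH] t x /=; first by rewrite lee_fin mulr_ge0 ?expR_ge0.
apply: integral_ge0 => s _; apply: mule_ge0.
  by rewrite lee_fin mulr_ge0 ?expR_ge0// powR_ge0.
rewrite (integral_dens h (fun r => pn alpha h n (t - s)%R (r * x)%R B)).
by apply: (Qe_ge0 hq (f := fun y => pn alpha h n (t - s)%R y B)).
Qed.

Lemma prn_ge0 B n t x : 0 <= prn alpha h B n t x.
Proof. by rewrite /prn; case: ifP => // _; exact: pn_ge0. Qed.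

Lemma prn_lt0 B n t x : (t < 0)%R -> prn alpha h B n t x = 0.
Proof. by move=> t0; rewrite /prn leNgt t0. Qed.

Lemma prn0 B t x : prn alpha h B 0 t x = (\1_B x)%:E * Ex (lam x) t.
Proof.
rewrite /prn /Ex; case: ifP => _; last by rewrite mule0.
by rewrite /= mulrC EFinM.
Qed.

Let Qprn B n t x := Qe q (fun y => prn alpha h B n t y) x.

Let Qprn_ge0 B n t x : 0 <= Qprn B n t x.
Proof. by apply: (Qe_ge0 hq) => y; exact: prn_ge0. Qed.

Let Qprn_lt0 B n t x : (t < 0)%R -> Qprn B n t x = 0.
Proof.
move=> t0; rewrite /Qprn (_ : (fun _ => _) = (fun=> 0)) ?(Qe_cst hq)//.
by apply/funext => y; rewrite prn_lt0.
Qed.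

Lemma prnS B n t x :
  measurable_fun setT (fun p : R * R => prn alpha h B n p.1 p.2) ->
  prn alpha h B n.+1 t x = (lam x)%:E * convol (Ex (lam x)) (Qprn B n ^~ x) t.
Proof.
move=> mp; have [t0|t0] := ltP t 0%R.
  by rewrite prn_lt0// convol_lt0 ?mule0//; [exact: Ex_lt0|move=> s; exact: Qprn_lt0].
have mQ : measurable_fun setT (fun p : R * R => Qprn B n p.1 p.2).
  exact: (@measurable_Qe_param _ _ hq _ _
    (fun p : R * R => prn alpha h B n p.1 p.2) mp (fun p => prn_ge0 _ _ _ _)).
rewrite /prn t0/= convol_itv; [|exact: Ex_lt0|by move=> s; exact: Qprn_lt0].
rewrite -ge0_integralZl//; last 2 first.
- apply: measurable_funTS; apply: emeasurable_funM.
    exact: measurable_Ex.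
  by apply: (measurableT_comp mQ (g := fun s : R => (t - s, x)%R)); meas.
- by move=> s _; rewrite mule_ge0 ?Ex_ge0.
apply: eq_integral => s; rewrite inE/= in_itv/= => /andP[s0 st].
rewrite /Ex s0 muleA -EFinM; congr (_ * _).
rewrite (integral_dens h (fun r => pn alpha h n (t - s)%R (r * x)%R B)).
by apply: eq_integral => r _; rewrite /prn subr_ge0 st.
Qed.

Lemma measurable_prn B n : measurable B ->
  measurable_fun setT (fun p : R * R => prn alpha h B n p.1 p.2).
Proof.
move=> mB; elim: n => [|n IH].
  rewrite (_ : (fun _ => _) = fun p : R * R =>
    (\1_B p.2)%:E * Ex (p.2 `^ alpha)%R p.1); last first.
    by apply/funext => -[t x]; rewrite prn0.
  apply: emeasurable_funM; first by meas.
  by apply: (measurableT_comp (@measurable_Ex2 R)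
    (g := fun p : R * R => (p.2 `^ alpha, p.1)%R)); meas.
rewrite (_ : (fun _ => _) = fun p : R * R => (p.2 `^ alpha)%:E *
  convol (Ex (p.2 `^ alpha)) (Qprn B n ^~ p.2) p.1); last first.
  by apply/funext => -[t x]; rewrite prnS.
apply: emeasurable_funM; first by meas.
have mQ : measurable_fun setT (fun p : R * R => Qprn B n p.1 p.2).
  exact: (@measurable_Qe_param _ _ hq _ _
    (fun p : R * R => prn alpha h B n p.1 p.2) IH (fun p => prn_ge0 _ _ _ _)).
pose G (p : R * R) := convol (Ex (p.1 `^ alpha)) (Qprn B n ^~ p.1) p.2.
suff mG : measurable_fun setT G.
  by apply: (measurableT_comp mG (g := fun p : R * R => (p.2, p.1))); meas.
apply: (@measurable_convol_param R _ R (fun x s => Ex (x `^ alpha) s)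
  (fun x s => Qprn B n s x)).
- by apply: (measurableT_comp (@measurable_Ex2 R)
    (g := fun p : R * R => (p.1 `^ alpha, p.2)%R)); meas.
- by apply: (measurableT_comp mQ (g := fun p : R * R => (p.2, p.1))); meas.
- by move=> *; exact: Ex_ge0.
- by [].
Qed.

Lemma measurable_Qprn B n x : measurable B -> measurable_fun setT (Qprn B n ^~ x).
Proof.
move=> mB; have mp := measurable_prn n mB.
have mQ : measurable_fun setT (fun p : R * R => Qprn B n p.1 p.2).
  exact: (@measurable_Qe_param _ _ hq _ _
    (fun p : R * R => prn alpha h B n p.1 p.2) mp (fun p => prn_ge0 _ _ _ _)).
by apply: (measurableT_comp mQ (g := fun s : R => (s, x))); meas.
Qed.

Lemma measurable_prn2 B n t : measurable B -> measurable_fun setT (prn alpha h B n t).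
Proof.
move=> mB; have mp := measurable_prn n mB.
by apply: (measurableT_comp mp (g := fun x : R => (t, x))); meas.
Qed.

Lemma trE B t x : tr alpha h B t x = \sum_(n <oo) prn alpha h B n t x.
Proof.
rewrite /tr /prn; case: ifP => // t0.
by rewrite eseries0.
Qed.

Lemma tr_ge0 B t x : 0 <= tr alpha h B t x.
Proof. by rewrite trE; apply: nneseries_ge0 => n _ _; exact: prn_ge0. Qed.

Lemma tr_lt0 B t x : (t < 0)%R -> tr alpha h B t x = 0.
Proof. by move=> t0; rewrite /tr leNgt t0. Qed.

Lemma measurable_tr B : measurable B ->
  measurable_fun setT (fun p : R * R => tr alpha h B p.1 p.2).
Proof.
move=> mB; under eq_fun do rewrite trE.
apply: ge0_emeasurable_sum => n; first by move=> *; exact: prn_ge0.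
by move=> _; exact: measurable_prn.
Qed.

Lemma measurable_tr2 B t : measurable B -> measurable_fun setT (tr alpha h B t).
Proof.
move=> mB; have mp := measurable_tr mB.
by apply: (measurableT_comp mp (g := fun x : R => (t, x))); meas.
Qed.

Lemma measurable_Qtr B : measurable B ->
  measurable_fun setT (fun p : R * R => Qe q (tr alpha h B p.1) p.2).
Proof.
move=> mB; exact: (@measurable_Qe_param _ _ hq _ _
    (fun p : R * R => tr alpha h B p.1 p.2) (measurable_tr mB) (fun p => tr_ge0 _ _ _)).
Qed.

Lemma Qtr_ge0 B t x : 0 <= Qe q (tr alpha h B t) x.
Proof. by apply: (Qe_ge0 hq) => y; exact: tr_ge0. Qed.

Lemma Qtr_lt0 B t x : (t < 0)%R -> Qe q (tr alpha h B t) x = 0.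
Proof.
move=> t0; rewrite (_ : tr _ _ _ _ = (fun=> 0)) ?(Qe_cst hq)//.
by apply/funext => y; rewrite tr_lt0.
Qed.

(** The term [n = 0] is split off; in the shifted series the recursion [prnS] passes through the sum
    by monotone convergence. *)
Lemma backward_equation B t x : measurable B ->
  tr alpha h B t x = (\1_B x)%:E * Ex (lam x) t +
    (lam x)%:E * convol (Ex (lam x)) (fun s => Qe q (tr alpha h B s) x) t.
Proof.
move=> mB; rewrite trE nneseries_recl//; last by move=> *; exact: prn_ge0.
rewrite prn0; congr (_ + _).
rewrite -(nneseries_addn 1); last by move=> *; exact: prn_ge0.
under eq_eseriesr do rewrite addn1 (prnS _ _ (measurable_prn _ mB)).
rewrite nneseriesZl//; last first.
  by move=> n _; apply: convol_ge0 => // s; exact: Ex_ge0.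
congr (_ * _); rewrite -convol_nneseries//.
- congr (convol _ _ t); apply/funext => s; rewrite /Qprn -(Qe_nneseries hq)//.
  + by congr (Qe q _ x); apply/funext => y; rewrite trE.
  + by move=> n; exact: measurable_prn2.
  + by move=> *; exact: prn_ge0.
- exact: measurable_Ex.
- by move=> n; exact: measurable_Qprn.
- by move=> s; exact: Ex_fin_num.
- by move=> s; exact: Ex_ge0.
Qed.

End jump_process.

(** Uniformization at the level of kernels: at the larger rate [m], events of rate [m - l] are
    fictitious jumps that leave the state unchanged, hence [w] itself in the source. Inserting the
    resolvent identity for [Ex l] leaves only associativity and distributivity. *)
Lemma rate_change (R : realType) (l m : R) (c : \bar R) (g w : R -> \bar R) :
  (0 <= l <= m)%R -> 0 <= c -> measurable_fun setT g -> (forall s, 0 <= g s) ->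
  w = (fun t => c * Ex l t + l%:E * convol (Ex l) g t) ->
  w = (fun t => c * Ex m t +
        convol (Ex m) (fun s => l%:E * g s + (m - l)%:E * w s) t).
Proof.
move=> lm c0 mg g0 wE.
have /andP[l0 l_m] := lm.
have lE0 : 0 <= l%:E by rewrite lee_fin.
have mlE0 : 0 <= (m - l)%:E by rewrite lee_fin subr_ge0.
have mL := @measurable_Ex R l; have mM := @measurable_Ex R m.
have L0 := @Ex_ge0 R l; have M0 := @Ex_ge0 R m.
have mLg := measurable_convol mL mg L0 g0.
have Lg0 t := convol_ge0 t L0 g0.
have mw : measurable_fun setT w by rewrite wE; meas.
have w0 t : 0 <= w t by rewrite wE adde_ge0// mule_ge0.
have LE : Ex l = (fun t => Ex m t + (m - l)%:E * convol (Ex m) (Ex l) t).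
  by apply/funext => t; exact: resolvent.
have mML := measurable_convol mM mL M0 L0.
have ML0 t := convol_ge0 t M0 L0.
have mMLg := measurable_convol mML mg ML0 g0.
have MLg0 t := convol_ge0 t ML0 g0.
have mMg := measurable_convol mM mg M0 g0.
have Mg0 t := convol_ge0 t M0 g0.
have LgE t : convol (Ex l) g t =
    convol (Ex m) g t + (m - l)%:E * convol (convol (Ex m) (Ex l)) g t.
  rewrite {1}LE convolDl//; [|by meas|by move=> x; rewrite mule_ge0].
  by rewrite convolZl.
apply/funext => t.
rewrite convolDr//; [|by meas|by meas|by move=> x; rewrite mule_ge0
  |by move=> x; rewrite mule_ge0].
rewrite !convolZr//.
have -> : convol (Ex m) w t = c * convol (Ex m) (Ex l) t +
    l%:E * convol (convol (Ex m) (Ex l)) g t.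
  transitivity (convol (Ex m) (fun t => c * Ex l t + l%:E * convol (Ex l) g t) t).
    by rewrite -wE.
  rewrite (convolDr (b := fun t => c * Ex l t)
    (c := fun t => l%:E * convol (Ex l) g t))//; [|by meas|by meas|
    by move=> x; rewrite mule_ge0|by move=> x; rewrite mule_ge0].
  rewrite (convolZr mM mL c0)// (convolZr mM mLg lE0)//.
  by rewrite (convolA mM mL mg).
have -> : w t = c * Ex l t + l%:E * convol (Ex l) g t by rewrite wE.
rewrite LgE (resolvent t lm).
have := convol_ge0 t M0 L0; have := convol_ge0 t ML0 g0.
have := convol_ge0 t M0 g0; have := M0 t.
move: (convol (convol _ _) g t) (convol _ g t) (convol _ (Ex l) t) (Ex m t).
move=> H G D A A0 G0 H0 D0.
rewrite !ge0_muleDr ?mule_ge0// (muleCA c) (muleCA l%:E).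
by rewrite -addeA; congr (_ + _); rewrite addeCA.
Qed.

(** * Bounds on the transition probabilities *)

Section transition_bounds.
Variables (R : realType) (alpha : R) (h : R -> R).
Let q := dens h.
Hypothesis hq : jump_density q.
Implicit Types (B : set R) (t x : R).
Let lam x := (x `^ alpha)%R.
Let lam0 x : (0 <= lam x)%R. Proof. exact: powR_ge0. Qed.

Lemma uniformized_equation B m x : measurable B -> (lam x <= m)%R ->
  (fun t => tr alpha h B t x) = (fun t => (\1_B x)%:E * Ex m t +
    convol (Ex m) (fun s => (lam x)%:E * Qe q (tr alpha h B s) x +
      (m - lam x)%:E * tr alpha h B s x) t).
Proof.
move=> mB lm.
apply: (@rate_change _ (lam x) m (\1_B x)%:E (fun s => Qe q (tr alpha h B s) x)).
- by rewrite lam0.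
- by rewrite lee_fin.
- by apply: (measurableT_comp (measurable_Qtr alpha hq mB) (g := fun s : R => (s, x))); meas.
- by move=> s; exact: Qtr_ge0.
- by apply/funext => t; exact: backward_equation.
Qed.

(** Restriction to fewer than [n] jumps. These are the iterates from [0] of the backward equation,
    which gives upper bounds by induction that survive the limit. *)
Let psum B n t x := \sum_(0 <= i < n) prn alpha h B i t x.

Let psum_ge0 B n t x : 0 <= psum B n t x.
Proof. by apply: sume_ge0 => i _; exact: prn_ge0. Qed.

Let measurable_psum B n : measurable B ->
  measurable_fun setT (fun p : R * R => psum B n p.1 p.2).
Proof. by move=> mB; apply: emeasurable_sum => i; exact: measurable_prn. Qed.

Let measurable_psum2 B n t : measurable B -> measurable_fun setT (psum B n t).
Proof. by move=> mB; apply: emeasurable_sum => i; exact: measurable_prn2. Qed.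

Let measurable_Qpsum B n x : measurable B ->
  measurable_fun setT (fun s => Qe q (psum B n s) x).
Proof.
move=> mB.
have mQ : measurable_fun setT (fun p : R * R => Qe q (psum B n p.1) p.2).
  exact: (@measurable_Qe_param _ _ hq _ _
    (fun p : R * R => psum B n p.1 p.2) (measurable_psum n mB) (fun p => psum_ge0 _ _ _ _)).
by apply: (measurableT_comp mQ (g := fun s : R => (s, x))); meas.
Qed.

Let psumS B n t x : measurable B -> psum B n.+1 t x =
  (\1_B x)%:E * Ex (lam x) t +
  (lam x)%:E * convol (Ex (lam x)) (fun s => Qe q (psum B n s) x) t.
Proof.
move=> mB; elim: n => [|n IH].
  rewrite /psum big_nat1 prn0; set f := (fun s => _).
  rewrite (_ : f = (fun=> 0)); last first.
    apply/funext => s; rewrite /f (_ : (fun _ => _) = (fun=> 0)) ?(Qe_cst hq)//.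
    by apply/funext => y; rewrite big_geq.
  by rewrite convolE; under eq_integral do rewrite mule0; rewrite integral0 mule0 adde0.
rewrite /psum big_nat_recr//= -/(psum B n.+1 t x) IH (prnS hq)//; last exact: measurable_prn.
rewrite -addeA -ge0_muleDr; last 2 first.
- by apply: convol_ge0 => s; [exact: Ex_ge0|exact: Qe_ge0].
- by apply: convol_ge0 => s; [exact: Ex_ge0|apply: Qe_ge0 => // y; exact: prn_ge0].
congr (_ + _ * _); set f := (fun s => _); set g := (fun s => _).
rewrite -[_ + _]/((fun t => convol (Ex (lam x)) f t + convol (Ex (lam x)) g t) t).
rewrite -convolDr.
- congr (convol _ _ t); apply/funext => s; rewrite /f /g -QeD//.
  + by congr (Qe q _ x); apply/funext => y; rewrite big_nat_recr.
  + exact: measurable_psum2.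
  + exact: measurable_prn2.
  + by move=> y; exact: prn_ge0.
- exact: measurable_Ex.
- exact: measurable_Qpsum.
- exact: measurable_Qprn.
- by move=> s; exact: Ex_ge0.
- by move=> s; exact: Qe_ge0.
- by move=> s; apply: Qe_ge0 => // y; exact: prn_ge0.
Qed.

(** By [total_Ex] the constant [1] solves the backward equation with [1] in place of the indicator.
    The equation is monotone, so the iterates from [0] stay below. *)
Let psum_le B n t x : measurable B -> psum B n t x <= Ex 0%R t.
Proof.
move=> mB; elim: n t x => [|n IH] t x; first by rewrite /psum big_geq// Ex_ge0.
have [t0|t0] := ltP t 0%R.
  rewrite /psum big1 ?Ex_ge0// => i _; exact: prn_lt0.
rewrite psumS// (Ex0E t0) -(@total_Ex _ t t0 (lam x))//; apply: leeD.
  by rewrite gee_pMl ?Ex_fin_num ?Ex_ge0// lee_fin indicE; case: (_ \in _).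
rewrite lee_wpmul2l// ?lee_fin//; apply: le_convol.
- exact: measurable_Ex.
- exact: measurable_Qpsum.
- exact: measurable_Ex.
- by move=> s; exact: Ex_ge0.
- by move=> s; exact: Qe_ge0.
- move=> s; rewrite -(Qe_cst hq x (Ex_ge0 0%R s)); apply: le_Qe => //.
  + exact: measurable_psum2.
  + by move=> y; exact: Ex_ge0.
Qed.

Lemma tr_le B t x : measurable B -> tr alpha h B t x <= Ex 0%R t.
Proof.
move=> mB; rewrite trE; apply: lime_le.
  by apply: is_cvg_nneseries => *; exact: prn_ge0.
by apply: nearW => n; exact: psum_le.
Qed.

Lemma tr_le1 B t x : measurable B -> tr alpha h B t x <= 1.
Proof.
move=> mB; apply: le_trans (tr_le t x mB) _; rewrite /Ex; case: ifP => // _.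
by rewrite oppr0 mul0r expR0.
Qed.

Lemma prnC B n t x : measurable B ->
  prn alpha h B n t x + prn alpha h (~` B) n t x = prn alpha h setT n t x.
Proof.
move=> mB; have mB' := measurableC mB; elim: n t x => [|n IH] t x.
  rewrite !prn0 -ge0_muleDl ?lee_fin// -EFinD; congr (_%:E * _).
  by rewrite !indicE in_setT in_setC; case: (_ \in _); rewrite /= ?addr0 ?add0r.
have ? := @measurableT _ R.
rewrite !(prnS hq); try exact: measurable_prn.
rewrite -ge0_muleDr; last 2 first.
- by apply: convol_ge0 => s; [exact: Ex_ge0|apply: Qe_ge0 => // y; exact: prn_ge0].
- by apply: convol_ge0 => s; [exact: Ex_ge0|apply: Qe_ge0 => // y; exact: prn_ge0].
congr (_ * _); set f := (fun s => _); set g := (fun s => _).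
rewrite -[_ + _]/((fun t => convol (Ex (lam x)) f t + convol (Ex (lam x)) g t) t).
rewrite -convolDr.
- congr (convol _ _ t); apply/funext => s; rewrite /f /g -QeD//.
  + by congr (Qe q _ x); apply/funext => y; rewrite IH.
  + exact: measurable_prn2.
  + exact: measurable_prn2.
  + by move=> y; exact: prn_ge0.
  + by move=> y; exact: prn_ge0.
- exact: measurable_Ex.
- exact: measurable_Qprn.
- exact: measurable_Qprn.
- by move=> s; exact: Ex_ge0.
- by move=> s; apply: Qe_ge0 => // y; exact: prn_ge0.
- by move=> s; apply: Qe_ge0 => // y; exact: prn_ge0.
Qed.

(** The series for [B] and its complement add up to the series for the whole line, bounded by
    [1]. *)
Lemma tr_setC_le B t x : measurable B ->
  tr alpha h B t x + tr alpha h (~` B) t x <= 1.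
Proof.
move=> mB; rewrite !trE -nneseriesD; last 2 first.
- by move=> *; exact: prn_ge0.
- by move=> *; exact: prn_ge0.
under eq_eseriesr do rewrite prnC//.
by rewrite -trE; apply: tr_le1.
Qed.

Lemma prn_below a n t x : (0 < x <= a)%R -> prn alpha h `]a, +oo[%classic n t x = 0.
Proof.
elim: n t x => [|n IH] t x /andP[x0 xa].
  by rewrite prn0 indicE memNset ?mul0e//= in_itv/= andbT; apply/negP; rewrite -leNgt.
rewrite (prnS hq); last by apply: measurable_prn => //; exact: measurable_itv.
rewrite convolE integral0_eq ?mule0// => s _.
rewrite (_ : Qe _ _ _ = 0) ?mule0// -[RHS](Qe_cst hq x (lexx 0)).
apply: eq_Qe => // r /andP[r0 r1]; rewrite IH// mulr_gt0//= (le_trans _ xa)//.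
by rewrite ger_pMl// ltW.
Qed.

Lemma tr_below a t x : (0 < x <= a)%R -> tr alpha h `]a, +oo[%classic t x = 0.
Proof. by move=> xa; rewrite trE eseries0// => i _ _; exact: prn_below. Qed.

End transition_bounds.

(** * The measure [da / a], and densities with respect to [m] *)

Lemma integral_inv_itv (R : realType) (u v : R) : (0 < u)%R -> (u <= v)%R ->
  \int[leb]_a (if (u <= a < v)%R then a^-1 else 0)%R%:E = (ln v - ln u)%:E.
Proof.
move=> u0 uv.
have dl (x : R) : (u <= x <= v)%R -> is_derive x 1%R (@ln R) (x^-1)%R.
  by move=> /andP[ux _]; apply: is_derive1_ln; exact: lt_le_trans ux.
have cl (x : R) : (u <= x <= v)%R -> {for x, continuous (@GRing.inv R)}.
  by move=> /andP[ux _]; apply: inv_continuous; rewrite gt_eqF// (lt_le_trans u0).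
rewrite -(integral_derivative uv dl cl) -integral_itv_bndo_bndc; last first.
  by apply: measurable_funTS; apply/measurable_EFinP; exact: measurable_invr.
rewrite [RHS]integral_mkcond; apply: eq_integral => a _; rewrite patchE.
have -> : (a \in `[u, v[%classic) = (u <= a < v)%R.
  by apply/idP/idP; rewrite inE/= in_itv.
by case: ifP.
Qed.

(** Density of the dilation-invariant measure of the half-line; the cut at [0] keeps it nonnegative
    on the line. *)
Definition invp (R : realType) (a : R) : R := if (0 < a)%R then (a^-1)%R else 0%R.

Lemma invp_ge0 (R : realType) (a : R) : (0 <= invp a)%R.
Proof. by rewrite /invp; case: ifP => // /ltW; rewrite invr_ge0. Qed.

Lemma measurable_invp (R : realType) : measurable_fun setT (@invp R).
Proof. by rewrite /invp; meas. Qed.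

Lemma integral_invp (R : realType) (u v : R) : (0 < u)%R -> (u <= v)%R ->
  \int[leb]_a ((invp a)%:E * (if (u <= a < v)%R then 1 else 0)) = (ln v - ln u)%:E.
Proof.
move=> u0 uv; rewrite -(integral_inv_itv u0 uv); apply: eq_integral => a _.
case: ifP => [/andP[ua _]|]; last by rewrite mule0.
by rewrite mule1 /invp (lt_le_trans u0 ua).
Qed.

(** Lebesgue density of the measure [u dm]; through it, integrals over [pos_half] are moved to the
    whole line. *)
Definition mdens (R : realType) (u : R -> R) (x : R) : R :=
  if (0 < x)%R then (u x * x)%R else 0%R.

Lemma integral_mdens (R : realType) (u : R -> R) (f : R -> \bar R) :
  \int[leb]_(x in @pos_half R) ((u x * x)%:E * f x) =
  \int[leb]_x ((mdens u x)%:E * f x).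
Proof.
rewrite integral_mkcond; apply: eq_integral => x _.
rewrite patchE /mdens.
have -> : (x \in @pos_half R) = (0 < x)%R.
  by apply/idP/idP; rewrite inE /pos_half/= in_itv/= andbT.
by case: ifP => //; rewrite mul0e.
Qed.

Lemma integral_mdensS (R : realType) (u : R -> R) (B : set R) :
  B `<=` @pos_half R ->
  \int[leb]_(x in B) (u x * x)%:E =
  \int[leb]_x ((mdens u x)%:E * (\1_B x)%:E).
Proof.
move=> BP; rewrite integral_mkcond; apply: eq_integral => x _.
rewrite patchE indicE; case: ifPn => xB; last by rewrite mule0.
rewrite mule1 /mdens ifT//; move: xB; rewrite inE => /BP.
by rewrite /pos_half/= in_itv/= andbT.
Qed.

Lemma measurable_mdens (R : realType) (u : R -> R) : Dm u ->
  measurable_fun setT (mdens u).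
Proof.
move=> [mu _ _].
have -> : mdens u = (fun x => u x * x)%R \_ (@pos_half R).
  apply/funext => r; rewrite patchE /mdens.
  have -> : (r \in @pos_half R) = (0 < r)%R.
    by apply/idP/idP; rewrite inE /pos_half/= in_itv/= andbT.
  by [].
have mU : measurable (@pos_half R) by exact: measurable_itv.
by apply/(measurable_restrictT _ mU); apply: measurable_funM.
Qed.

Lemma mdens_ge0 (R : realType) (u : R -> R) x : Dm u -> (0 <= mdens u x)%R.
Proof.
by move=> [_ u0 _]; rewrite /mdens; case: ifP => // x0; rewrite mulr_ge0 ?u0// ltW.
Qed.

Lemma integral_mdens1 (R : realType) (u : R -> R) : Dm u ->
  \int[leb]_x (mdens u x)%:E = 1.
Proof.
move=> [_ _ u1]; transitivity (\int[leb]_x ((mdens u x)%:E * 1)).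
  by apply: eq_integral => x _; rewrite mule1.
rewrite -(integral_mdens u (fun=> 1)) -[RHS]u1.
by apply: eq_integral => x _; rewrite mule1.
Qed.

Lemma log_moment_dens (R : realType) (h : R -> R) : jump_density (dens h) ->
  \int[@lebesgue_measure R]_(z in @unit_open R) (ln z * h z * z)%:E =
  - \int[leb]_r ((dens h r)%:E * (- ln r)%:E).
Proof.
move=> hq; rewrite -integral_dens.
rewrite -integral_ge0N; last first.
  move=> r rP; case: hq => _ /(_ r) + _ _; rewrite /dens.
  move: rP; rewrite /unit_open/= in_itv/= => /[dup] r01 -> hr.
  rewrite mule_ge0// lee_fin// oppr_ge0 ln_le0//; case/andP: r01 => _ /ltW; exact.
apply: eq_integral => r _; rewrite -EFinM -EFinN; congr (_%:E).
by rewrite mulrN opprK -mulrA mulrC.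
Qed.

(** * Necessity of the log-moment *)

Section necessity.
Variables (R : realType) (alpha : R) (h : R -> R).
Let q := dens h.
Hypothesis hq : jump_density q.
Hypothesis alpha0 : (0 < alpha)%R.
Let lam x := (x `^ alpha)%R.
Let mq : measurable_fun setT q. Proof. by case: hq. Qed.
Let q0 r : (0 <= q r)%R. Proof. by case: hq. Qed.

(* the probability that the first jump from [x] crosses the level [a] *)
Let Z (a x : R) : \bar R :=
  Qe q (fun y => if (y <= a < x)%R then 1 else 0) x.

Let Z_ge0 a x : 0 <= Z a x.
Proof. by apply: (Qe_ge0 hq) => y; case: ifP. Qed.

(** From [x > a], being above [a] at time [1] requires that no jump has occurred, with probability
    [e^(-lam x)], or that the first jump landed above [a], with probability [V = 1 - Z]. After that
    jump the transition probability is bounded by [1], and it is [0] if the jump landed below, as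
    states only decrease. *)
Let tr_first_jump a x : (0 < x)%R -> (0 < a)%R ->
  tr alpha h `]a, +oo[%classic 1%R x + (1 - expR (- lam x))%:E * Z a x
  <= (\1_(`]a, +oo[%classic : set R) x)%:E.
Proof.
move=> x0 a0; have [xa|ax] := leP x a.
  rewrite tr_below ?x0// add0e /Z (_ : (fun _ => _) = (fun=> 0)); last first.
    by apply/funext => y; rewrite ltNge xa andbF.
  by rewrite (Qe_cst hq)// mule0 lee_fin.
have mB : measurable (`]a, +oo[%classic : set R) by exact: measurable_itv.
have e1 : (expR (- lam x) <= 1)%R by rewrite -expR0 ler_expR oppr_le0 powR_ge0.
rewrite (backward_equation alpha hq)// indicE mem_set/=; last by rewrite in_itv/= ax.
rewrite mul1e.
pose V := Qe q (fun y => (\1_(`]a, +oo[%classic : set R) y)%:E) x.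
have V0 : 0 <= V by apply: (Qe_ge0 hq) => y; rewrite lee_fin.
have VZ : V + Z a x = 1.
  rewrite /V /Z -(QeD hq).
  - rewrite -[RHS](Qe_cst hq x)//; apply: eq_Qe => // r _.
    rewrite indicE ax andbT; case: leP => rxa.
      by rewrite memNset ?add0e//= in_itv/= andbT; apply/negP; rewrite -leNgt.
    by rewrite mem_set ?adde0//= in_itv/= andbT.
  - by meas.
  - by meas.
  - by move=> y; rewrite lee_fin.
  - by move=> y; case: ifP.
have Vfin : V \is a fin_num.
  by rewrite ge0_fin_numE// (le_lt_trans (leeDl V (Z_ge0 a x)))// VZ ltry.
have H : (lam x)%:E * convol (Ex (lam x)) (fun s => Qe q (tr alpha h `]a, +oo[ s) x) 1%R
    <= (1 - expR (- lam x))%:E * V.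
  have l0 : 0 <= (lam x)%:E by rewrite lee_fin powR_ge0.
  apply: (@le_trans _ _ ((lam x)%:E * convol (Ex (lam x)) (fun s => V * Ex 0%R s) 1%R)).
    rewrite lee_wpmul2l//; apply: le_convol.
    - exact: measurable_Ex.
    - by apply: (measurableT_comp (measurable_Qtr alpha hq mB) (g := fun s : R => (s, x))); meas.
    - by apply: emeasurable_funM => //; exact: measurable_Ex.
    - by move=> s; exact: Ex_ge0.
    - by move=> s; exact: Qtr_ge0.
    - move=> s; have [s0|s0] := ltP s 0%R; first by rewrite Qtr_lt0// mule_ge0// Ex_ge0.
      rewrite Ex0E// mule1; apply: (le_Qe hq).
      + exact: measurable_tr2.
      + by meas.
      + by move=> y; exact: tr_ge0.
      + by move=> y; rewrite lee_fin.
      + move=> r /andP[r0 r1]; rewrite indicE; have [rxa|arx] := leP (r * x)%R a.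
          by rewrite tr_below ?lee_fin// mulr_gt0.
        by rewrite mem_set ?(tr_le1 alpha hq)//= in_itv/= arx.
  rewrite convolZr//; [|exact: measurable_Ex|exact: measurable_Ex
    |by move=> s; exact: Ex_ge0|by move=> s; exact: Ex_ge0].
  have E1 := @total_Ex _ 1%R ler01 (lam x) (powR_ge0 _ _).
  have Ez : (lam x)%:E * convol (Ex (lam x)) (Ex 0%R) 1%R = 1 - Ex (lam x) 1%R.
    by rewrite -E1 addeAC subee ?Ex_fin_num// add0e.
  by rewrite muleCA Ez {1}/Ex ler01 mulr1 -EFinB muleC.
apply: le_trans (leeD (leeD (lexx _) H) (lexx _)) _.
rewrite -addeA -ge0_muleDr// VZ mule1 {1}/Ex ler01 mulr1 -EFinD lee_fin.
by rewrite subrKC.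
Qed.

Let w := @invp R.
Let w0 a : 0 <= (w a)%:E. Proof. by rewrite lee_fin invp_ge0. Qed.
Let mw : measurable_fun setT (fun a => (w a)%:E). Proof. by meas. Qed.
Let integral_w := @integral_invp R.

Variable us : R -> R.
Hypothesis Dus : Dm us.
Hypothesis sol : is_solution alpha h us (self_sim alpha us).
Let p := mdens us.
Let mp : measurable_fun setT p. Proof. exact: measurable_mdens. Qed.
Let p0 x : (0 <= p x)%R. Proof. exact: mdens_ge0. Qed.
Let pE0 x : 0 <= (p x)%:E. Proof. by rewrite lee_fin. Qed.
Let p1 : \int[leb]_x (p x)%:E = 1. Proof. exact: integral_mdens1. Qed.
Let gam : R := (2 `^ (alpha^-1))%R.
Let gam1 : (1 < gam)%R.
Proof.
have : (1 `^ (alpha^-1) < gam)%R.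
  by apply: gt0_ltr_powR; rewrite ?invr_gt0 ?nnegrE ?ltr1n.
by rewrite powR1.
Qed.
Let gam0 : (0 < gam)%R. Proof. exact: lt_trans gam1. Qed.

Let M a := \int[leb]_x ((p x)%:E * (if (a < x)%R then 1 else 0)).

Let M_le1 a : M a <= 1.
Proof.
rewrite -p1; apply: ge0_le_integral => //.
- by move=> x _; rewrite mule_ge0//; case: ifP.
- by meas.
- by meas.
- by move=> x _; case: ifP; rewrite ?mule1 ?mule0.
Qed.

(** Self-similarity enters here: at time [1] the law is the initial one contracted by
    [gam = gamma(1)], so its mass above [a] is the initial mass above [gam a]. *)
Let M_solution a : (0 < a)%R ->
  M (gam * a)%R = \int[leb]_x ((p x)%:E * tr alpha h `]a, +oo[%classic 1%R x).
Proof.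
move=> a0; have [_ /(_ `]a, +oo[%classic)] := sol (ler01 : (0 <= 1 :> R)%R).
have BP : `]a, +oo[%classic `<=` @pos_half R.
  by move=> x; rewrite /pos_half/= !in_itv/= !andbT; exact: lt_trans.
move=> /(_ (measurable_itv _) BP).
rewrite integral_mdens integral_mdensS// => E.
transitivity (\int[leb]_x ((p x)%:E * trans alpha h 1 x `]a, +oo[)); last first.
  by apply: eq_integral => x _; rewrite /tr ler01.
rewrite -E /M -(ge0_integral_affine (a := gam) 0%R); last 3 first.
- by rewrite gt_eqF.
- by meas.
- by move=> x; rewrite mule_ge0//; case: ifP.
rewrite gtr0_norm// -ge0_integralZl//; last 3 first.
- by meas.
- by move=> x _; rewrite mule_ge0//; case: ifP.
- by rewrite lee_fin ltW.
apply: eq_integral => x _; rewrite addr0 ltr_pM2l// muleA -EFinM; congr (_%:E * _).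
  rewrite /p /mdens pmulr_rgt0//; case: ifP => _; last by rewrite mulr0.
  rewrite /self_sim /gamma_ss -[(1 + 1)%R]/(2%R) -/gam expr2; ring.
rewrite indicE; case: ltP => [ax|xa].
  by rewrite mem_set//= in_itv/= ax.
by rewrite memNset//= in_itv/= andbT; apply/negP; rewrite -leNgt.
Qed.

Let kap : \bar R := \int[leb]_x ((p x)%:E * (1 - expR (- lam x))%:E).

Let e0 x : (0 <= 1 - expR (- lam x))%R.
Proof. by rewrite subr_ge0 -expR0 ler_expR oppr_le0 powR_ge0. Qed.

Let mlam : measurable_fun setT lam. Proof. exact: measurable_powR. Qed.

(** [kap] is the probability of a jump before time [1]. Since [lam x > 0] for [x > 0], its vanishing
    would force the density to vanish almost everywhere. *)
Let kap_gt0 : 0 < kap.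
Proof.
have K0 x : 0 <= (p x)%:E * (1 - expR (- lam x))%:E.
  by rewrite mule_ge0// lee_fin.
have mK : measurable_fun setT (fun x => (p x)%:E * (1 - expR (- lam x))%:E) by meas.
rewrite lt_neqAle integral_ge0 ?andbT//; apply/negP => /eqP E.
have H' := (ae_eq_integral_abs leb measurableT mK).1.
have H : ae_eq leb setT (fun x => (p x)%:E * (1 - expR (- lam x))%:E) (cst 0).
  by apply: H'; rewrite E; apply: eq_integral => x _; rewrite gee0_abs.
have : \int[leb]_x (p x)%:E = 0.
  rewrite -[RHS](@integral0 _ _ _ leb setT).
  apply: ge0_ae_eq_integral => //.
  - by meas.
  apply: filterS H => x /(_ I) /eqP + _; rewrite mule_eq0 => /orP[/eqP//|].
  rewrite eqe subr_eq0 eq_sym /p /mdens => ex.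
  case: ifP => // x0; exfalso; move: ex; apply/negP.
  by rewrite lt_eqF// -expR0 ltr_expR oppr_lt0 powR_gt0.
by rewrite p1 => -[] /eqP; rewrite oner_eq0.
Qed.

Let mZ : measurable_fun setT (fun p : R * R => Z p.1 p.2).
Proof.
apply: (@measurable_parametric_integral _ _ _ (fun (p : R * R) r =>
  (q r)%:E * (if (r * p.2 <= p.1 < p.2)%R then 1 else 0))).
  by meas.
by move=> x y; rewrite mule_ge0// ?lee_fin//; case: ifP.
Qed.

(** Integrating [tr_first_jump] against the law bounds the mass that crosses [a] by
    [M a - M (gam a)], the mass of [(a, gam a]]. The subtraction is legitimate because [M (gam a)]
    is finite. *)
Let mass_balance a : (0 < a)%R ->
  \int[leb]_x ((p x)%:E * (1 - expR (- lam x))%:E * Z a x) <=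
  \int[leb]_x ((p x)%:E * (if (x / gam <= a < x)%R then 1 else 0)).
Proof.
move=> a0.
have mZa : measurable_fun setT (Z a).
  by apply: (measurableT_comp mZ (g := fun x : R => (a, x))); meas.
have mB : measurable (`]a, +oo[%classic : set R) by exact: measurable_itv.
have mt : measurable_fun setT (tr alpha h `]a, +oo[%classic 1%R).
  exact: measurable_tr2.
have Mfin : M (gam * a)%R \is a fin_num.
  rewrite ge0_fin_numE; first exact: le_lt_trans (M_le1 _) (ltry _).
  by apply: integral_ge0 => x _; rewrite mule_ge0//; case: ifP.
rewrite -(@leeD2lE _ (M (gam * a)%R))// {1}M_solution// /M.
rewrite -[leLHS]ge0_integralD//; last 4 first.
- by move=> x _; rewrite mule_ge0// tr_ge0.
- by meas.
- by move=> x _; rewrite !mule_ge0// lee_fin.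
- by meas.
rewrite -[leRHS]ge0_integralD//; last 4 first.
- by move=> x _; rewrite mule_ge0//; case: ifP.
- by meas.
- by move=> x _; rewrite mule_ge0//; case: ifP.
- by meas.
apply: ge0_le_integral => //.
- by move=> x _; rewrite adde_ge0// !mule_ge0 ?tr_ge0 ?lee_fin.
- by meas.
- by meas.
move=> x _; have [x0|x0] := ltP 0%R x; last first.
  by rewrite {1 2}/p /mdens ltNge x0/= !mul0e add0e adde_ge0// mule_ge0//; case: ifP.
rewrite -muleA -!ge0_muleDr//; last 4 first.
- by case: ifP.
- by case: ifP.
- exact: tr_ge0.
- by rewrite mule_ge0// lee_fin.
rewrite lee_wpmul2l//; apply: le_trans (tr_first_jump x0 a0) _.
rewrite indicE ler_pdivrMr// [(a * gam)%R]mulrC.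
have [ax|xa] := ltP a x; last by rewrite memNset ?adde_ge0//= ?in_itv/= ?andbT;
  [case: ifP|case: ifP|apply/negP; rewrite -leNgt].
by rewrite mem_set/= ?in_itv/= ?ax// andbT; case: ltP => _; rewrite ?add0e ?adde0.
Qed.

(** Under [da / a] the shell [x / gam <= a < x] has measure [ln gam] and the shell [r x <= a < x]
    has measure [- ln r], both independent of [x]. So [mass_balance] integrates to
    [kap * L <= ln gam], and [kap > 0] excludes [L = +oo]. *)
Lemma finite_log_moment : \int[leb]_r ((q r)%:E * (- ln r)%:E) < +oo.
Proof.
set L := \int[leb]_r _.
have L0 : 0 <= L.
  apply: integral_ge0 => r _; have [r01|r01] := boolP (0 < r < 1)%R.
    rewrite mule_ge0// lee_fin// oppr_ge0 ln_le0//.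
    by case/andP: r01 => _ /ltW.
  by case: hq => _ _ qs _; rewrite qs// mul0e.
have : kap * L <= (ln gam)%:E.
  have <- : \int[leb]_a ((w a)%:E * \int[leb]_x ((p x)%:E *
      (if (x / gam <= a < x)%R then 1 else 0))) = (ln gam)%:E.
    transitivity (\int[leb]_a \int[leb]_x ((w a)%:E * ((p x)%:E *
      (if (x / gam <= a < x)%R then 1 else 0)))).
      apply: eq_integral => a _; rewrite ge0_integralZl//; first by meas.
      by move=> x _; rewrite mule_ge0//; case: ifP.
    rewrite (ge0_tonelli (f := fun a x => (w a)%:E * ((p x)%:E *
      (if (x / gam <= a < x)%R then 1 else 0)))); last 2 first.
    - by apply: emeasurable_funM; meas.
    - by move=> x y; rewrite mule_ge0// mule_ge0//; case: ifP.
    transitivity (\int[leb]_x ((p x)%:E * (ln gam)%:E)); last first.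
      rewrite ge0_integralZr//; first by rewrite p1 mul1e.
      + by meas.
      + by rewrite lee_fin ln_ge0// ltW.
    apply: eq_integral => x _; under eq_integral do rewrite muleCA.
    rewrite ge0_integralZl//; last 2 first.
    - by meas.
    - by move=> a _; rewrite mule_ge0//; case: ifP.
    have [x0|x0] := ltP 0%R x; last by rewrite /p /mdens ltNge x0/= !mul0e.
    rewrite integral_w//; last 2 first.
    - by rewrite divr_gt0.
    - by rewrite ler_pdivrMr// ler_peMr// ltW.
    by rewrite ln_div ?posrE// opprB addrC subrK.
  have -> : kap * L = \int[leb]_a ((w a)%:E *
      \int[leb]_x ((p x)%:E * (1 - expR (- lam x))%:E * Z a x)).
    transitivity (\int[leb]_a \int[leb]_x ((w a)%:E *
      ((p x)%:E * (1 - expR (- lam x))%:E * Z a x))); last first.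
      apply: eq_integral => a _; rewrite ge0_integralZl//.
      + have mZa : measurable_fun setT (Z a).
          by apply: (measurableT_comp mZ (g := fun x : R => (a, x))); meas.
        by meas.
      + by move=> x _; rewrite !mule_ge0// lee_fin.
    rewrite (ge0_tonelli (f := fun a x => (w a)%:E *
      ((p x)%:E * (1 - expR (- lam x))%:E * Z a x))); last 2 first.
    - apply: emeasurable_funM; first by meas.
      by apply: emeasurable_funM => //; meas.
    - by move=> x y; rewrite !mule_ge0// lee_fin.
    rewrite -ge0_integralZr//; last 2 first.
    - by meas.
    - by move=> x _; rewrite mule_ge0// lee_fin.
    apply: eq_integral => x _; under [RHS]eq_integral do rewrite muleCA.
    have mZx : measurable_fun setT (Z ^~ x).
      by apply: (measurableT_comp mZ (g := fun a : R => (a, x))); meas.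
    rewrite [RHS]ge0_integralZl//; last 3 first.
    - by meas.
    - by move=> a _; rewrite mule_ge0.
    - by rewrite mule_ge0// lee_fin.
    have [x0|x0] := ltP 0%R x; last by rewrite /p /mdens ltNge x0/= !mul0e.
    congr (_ * _); rewrite /Z /Qe.
    transitivity (\int[leb]_a \int[leb]_r ((w a)%:E *
        ((q r)%:E * (if (r * x <= a < x)%R then 1 else 0)))); last first.
      apply: eq_integral => a _; rewrite ge0_integralZl//; first by meas.
      by move=> r _; rewrite mule_ge0// ?lee_fin//; case: ifP.
    rewrite (ge0_tonelli (f := fun a r => (w a)%:E *
        ((q r)%:E * (if (r * x <= a < x)%R then 1 else 0)))); last 2 first.
    - by apply: emeasurable_funM; meas.
    - by move=> a r; rewrite !mule_ge0// ?lee_fin//; case: ifP.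
    apply: eq_integral => r _; under [RHS]eq_integral do rewrite muleCA.
    rewrite [RHS]ge0_integralZl//; last 3 first.
    - by meas.
    - by move=> a _; rewrite mule_ge0//; case: ifP.
    - by rewrite lee_fin.
    have [/andP[r0 r1]|r01] := boolP (0 < r < 1)%R; last first.
      by case: hq => _ _ qs _; rewrite qs// !mul0e.
    rewrite integral_w//; last 2 first.
    - by rewrite mulr_gt0.
    - by rewrite ger_pMl// ltW.
    by congr (_ * _%:E); rewrite lnM ?posrE//; lra.
  apply: ge0_le_integral => //.
  - move=> a _; rewrite mule_ge0//; apply: integral_ge0 => x _.
    by rewrite !mule_ge0// lee_fin.
  - apply: emeasurable_funM => //.
    apply: (@measurable_parametric_integral _ R _ (fun a x => (p x)%:E * (1 - expR (- lam x))%:E * Z a x)).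
      by apply: emeasurable_funM => //; meas.
    by move=> a x; rewrite !mule_ge0// lee_fin.
  - apply: emeasurable_funM => //.
    apply: (@measurable_parametric_integral _ R _ (fun a x => (p x)%:E *
      (if (x / gam <= a < x)%R then 1 else 0))).
      by meas.
    by move=> a x; rewrite !mule_ge0//; case: ifP.
  - move=> a _; rewrite {1 2}/w /invp; case: ifP => a0; last by rewrite !mul0e.
    rewrite lee_wpmul2l//; last exact: mass_balance.
    by rewrite lee_fin invr_ge0 ltW.
rewrite ltey; case: eqP => // ->.
by rewrite gt0_muley// leye_eq.
Qed.

End necessity.

Lemma ereal_addIr (R : realType) (x y z : \bar R) : z \is a fin_num ->
  x + z = y + z -> x = y.
Proof. by move=> fz E; rewrite -(addeK x fz) E addeK. Qed.

Lemma integral_convol (R : realType) (a b : R -> \bar R) :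
  measurable_fun setT a -> measurable_fun setT b ->
  (forall x, 0 <= a x) -> (forall x, 0 <= b x) ->
  \int[leb]_t convol a b t = (\int[leb]_s a s) * (\int[leb]_s b s).
Proof.
move=> ma mb a0 b0; under eq_integral do rewrite convolE.
rewrite (ge0_tonelli (f := fun t s => a s * b (t - s)%R)); last 2 first.
- by meas.
- by move=> x y; rewrite mule_ge0.
rewrite -ge0_integralZr//; last by apply: integral_ge0.
apply: eq_integral => s _; rewrite ge0_integralZl//; last by meas.
by congr (_ * _); rewrite ge0_integral_shift.
Qed.

Lemma integral_Ex1 (R : realType) : \int[leb]_s Ex (1%R : R) s = 1.
Proof.
rewrite -(@integral_exponential_pdf R 1%R ltr01); apply: eq_integral => s _.
rewrite /Ex; case: ifPn => s0; first by rewrite exponential_pdfE// mul1r.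
by rewrite lt0_exponential_pdf// ltNge.
Qed.

Lemma jump_integral_gt0 (R : realType) (q : R -> R) (f : R -> \bar R) :
  jump_density q -> measurable_fun setT f -> (forall r, (0 < r < 1)%R -> 0 < f r) ->
  0 < \int[leb]_r ((q r)%:E * f r).
Proof.
move=> [mq q0 qs q1] mf f0.
have qE0 x : 0 <= (q x)%:E by rewrite lee_fin.
have K0 x : 0 <= (q x)%:E * f x.
  have [x01|x01] := boolP (0 < x < 1)%R; last by rewrite qs ?mul0e.
  by rewrite mule_ge0 ?lee_fin// ltW// f0.
have mK : measurable_fun setT (fun x => (q x)%:E * f x) by meas.
rewrite lt_neqAle integral_ge0 ?andbT//; apply/negP => /eqP E.
have H' := (ae_eq_integral_abs leb measurableT mK).1.
have H : ae_eq leb setT (fun x => (q x)%:E * f x) (cst 0).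
  by apply: H'; rewrite E; apply: eq_integral => x _; rewrite gee0_abs.
have : \int[leb]_x (q x)%:E = 0.
  rewrite -[RHS](@integral0 _ _ _ leb setT).
  apply: ge0_ae_eq_integral => //.
  - by meas.
  apply: filterS H => x /(_ I) /eqP + _; rewrite mule_eq0 => /orP[/eqP//|/eqP fx].
  have [x01|x01] := boolP (0 < x < 1)%R; last by rewrite qs.
  by move: (f0 x x01); rewrite fx ltxx.
by rewrite q1 => -[] /eqP; rewrite oner_eq0.
Qed.

(** Convolution with [Ex 0] is a primitive, and this is the substitution [v = rho u] in it: dilation
    by [rho] turns the density [k] into [k(v / rho) / rho]. *)
Lemma convol_one_dilate (R : realType) (k : R -> \bar R) (rho z : R) :
  measurable_fun setT k -> (forall u, 0 <= k u) -> (0 < rho)%R ->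
  convol k (Ex 0%R) (z / rho)%R =
  \int[leb]_v ((rho^-1)%:E * (k (v / rho)%R * Ex 0%R (z - v)%R)).
Proof.
move=> mk k0 rho0; have mone := @measurable_Ex R 0%R.
have irr : (rho^-1 != 0)%R by rewrite invr_eq0 gt_eqF.
rewrite convolE.
rewrite -(ge0_integral_affine 0%R irr (f := fun u => k u * Ex 0%R (z / rho - u)%R)); last 2 first.
- by meas.
- by move=> x; rewrite mule_ge0// Ex_ge0.
rewrite ger0_norm; last by rewrite invr_ge0 ltW.
rewrite -ge0_integralZl; last 4 first.
- exact: measurableT.
- by meas.
- by move=> x _; rewrite mule_ge0// Ex_ge0.
- by rewrite lee_fin invr_ge0 ltW.
apply: eq_integral => v _.
have -> : (rho^-1 * v + 0 = v / rho)%R by rewrite addr0 mulrC.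
suff -> : Ex 0%R (z / rho - v / rho)%R = Ex 0%R (z - v)%R by [].
rewrite -mulrBl; have [zv|zv] := ltP (z - v)%R 0%R.
  by rewrite !Ex_lt0// ltr_pdivrMr// mul0r.
by rewrite !Ex0E// divr_ge0// ltW.
Qed.

(** * The law of the perpetuity and its density *)

Section profile.
Variables (R : realType) (alpha : R) (q : R -> R).
Hypothesis hq : jump_density q.
Hypothesis alpha0 : (0 < alpha)%R.
Let mq : measurable_fun setT q. Proof. by case: hq. Qed.
Let q0 r : (0 <= q r)%R. Proof. by case: hq. Qed.
Implicit Types f g : R -> \bar R.

Let rho01 r : (0 < r < 1)%R -> (0 < r `^ alpha < 1)%R.
Proof.
move=> /andP[r0 r1]; rewrite powR_gt0//=.
have : (r `^ alpha < 1 `^ alpha)%R by apply: gt0_ltr_powR; rewrite ?nnegrE ?ltW.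
by rewrite powR1.
Qed.

(** Maps the distribution function of a variable [X] to that of [theta^alpha X], with [theta]
    independent of [X]. Writing it as [Qe] at the point [1] inherits the lemmas on the jump
    operator. *)
Let Ha f z := Qe q (fun y => f (z / y `^ alpha)%R) 1%R.

Let Ha_ge0 f z : (forall x, 0 <= f x) -> 0 <= Ha f z.
Proof. by move=> f0; exact: Qe_ge0. Qed.

Let measurable_Ha f : measurable_fun setT f -> (forall x, 0 <= f x) ->
  measurable_fun setT (Ha f).
Proof.
move=> mf f0; apply: (@measurable_parametric_integral _ R _
  (fun z r => (q r)%:E * f (z / (r * 1) `^ alpha)%R)).
  by meas.
by move=> x y; rewrite mule_ge0// lee_fin.
Qed.

Let HaD f g z : measurable_fun setT f -> measurable_fun setT g ->
  (forall x, 0 <= f x) -> (forall x, 0 <= g x) ->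
  Ha (fun x => f x + g x) z = Ha f z + Ha g z.
Proof. by move=> mf mg f0 g0; rewrite /Ha -(QeD hq)//; meas. Qed.

Let le_Ha f g z : measurable_fun setT f -> measurable_fun setT g ->
  (forall x, 0 <= f x) -> (forall x, 0 <= g x) ->
  (forall r, (0 < r < 1)%R -> f (z / r `^ alpha)%R <= g (z / r `^ alpha)%R) ->
  Ha f z <= Ha g z.
Proof.
move=> mf mg f0 g0 fg; apply: (le_Qe hq) => //; [by meas|by meas|].
by move=> r r01; rewrite mulr1; exact: fg.
Qed.

Let eq_Ha f z c : 0 <= c ->
  (forall r, (0 < r < 1)%R -> f (z / r `^ alpha)%R = c) -> Ha f z = c.
Proof.
move=> c0 fc; rewrite -[RHS](Qe_cst hq 1%R c0); apply: (eq_Qe hq) => r r01.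
by rewrite mulr1 fc.
Qed.

Let Ha_lt0 f z : (forall x, (x < 0)%R -> f x = 0) -> (z < 0)%R -> Ha f z = 0.
Proof.
move=> f0 z0; apply: eq_Ha => // r /rho01/andP[rr0 _]; apply: f0.
by rewrite ltr_pdivrMr// mul0r.
Qed.

Let one : R -> \bar R := Ex (0%R : R).
(** At rate [1] the survival function and the density of an exponential variable coincide; [E1]
    plays both roles. *)
Let E1 : R -> \bar R := Ex (1%R : R).
Let mone : measurable_fun setT one. Proof. exact: measurable_Ex. Qed.
Let mE1 : measurable_fun setT E1. Proof. exact: measurable_Ex. Qed.
Let one0 x : 0 <= one x. Proof. exact: Ex_ge0. Qed.
Let E10 x : 0 <= E1 x. Proof. exact: Ex_ge0. Qed.
Let one_lt0 x : (x < 0)%R -> one x = 0. Proof. exact: Ex_lt0. Qed.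
Let one_resolvent : one = (fun t => E1 t + convol E1 one t).
Proof.
apply/funext => t; have := @resolvent R 0%R 1%R t.
by rewrite lexx ler01 subr0 mul1e => /(_ isT).
Qed.

Let Ha_one : Ha one = one.
Proof.
apply/funext => z; have [z0|z0] := ltP z 0%R.
  by rewrite one_lt0// Ha_lt0.
rewrite [RHS]/one Ex0E//; apply: eq_Ha => // r /rho01/andP[rr0 _].
by rewrite /one Ex0E// divr_ge0// ltW.
Qed.

(* [gs n] is the density-free form of [P(I_n <= t < I_(n+1))] for the perpetuity
   [I_n = E_0 + theta_1^alpha E_1 + ...] with standard exponential [E_i];
   [Fs n] is the distribution function of [I_n]. *)
Let gs := fix gs (n : nat) : R -> \bar R :=
  if n is m.+1 then convol E1 (Ha (gs m)) else E1.

Let Fs := fix Fs (n : nat) : R -> \bar R :=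
  if n is m.+1 then convol E1 (Ha (Fs m)) else one.

Let gs_prop n : measurable_fun setT (gs n) /\ (forall x, 0 <= gs n x).
Proof.
elim: n => [|n [mg g0]]//=; split.
  by apply: measurable_convol => //; [exact: measurable_Ha|move=> x; exact: Ha_ge0].
by move=> x; apply: convol_ge0 => // y; exact: Ha_ge0.
Qed.

Let mgs n : measurable_fun setT (gs n). Proof. by case: (gs_prop n). Qed.
Let gs0 n x : 0 <= gs n x. Proof. by case: (gs_prop n). Qed.

Let Fs_prop n : measurable_fun setT (Fs n) /\ (forall x, 0 <= Fs n x).
Proof.
elim: n => [|n [mg g0]]//=; split.
  by apply: measurable_convol => //; [exact: measurable_Ha|move=> x; exact: Ha_ge0].
by move=> x; apply: convol_ge0 => // y; exact: Ha_ge0.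
Qed.

Let mFs n : measurable_fun setT (Fs n). Proof. by case: (Fs_prop n). Qed.
Let Fs0 n x : 0 <= Fs n x. Proof. by case: (Fs_prop n). Qed.

Let Ha_nd f (z z' : R) : measurable_fun setT f -> (forall x, 0 <= f x) ->
  (forall t t' : R, (t <= t')%R -> f t <= f t') -> (z <= z')%R -> Ha f z <= Ha f z'.
Proof.
move=> mf f0 fnd zz'; apply: (le_Qe hq) => //; [by meas|by meas|].
by move=> r /rho01/andP[rr0 _]; rewrite mulr1; apply: fnd; rewrite ler_pM2r ?invr_gt0.
Qed.

Let Fs_nd n (t t' : R) : (t <= t')%R -> Fs n t <= Fs n t'.
Proof.
elim: n t t' => [|n IH] t t' tt' /=.
  have [t0|t0] := ltP t 0%R; first by rewrite one_lt0.
  by rewrite /one !Ex0E// (le_trans t0).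
have mH := measurable_Ha (mFs n) (Fs0 n).
rewrite !convolE; apply: ge0_le_integral => //.
- by move=> s _; rewrite mule_ge0// Ha_ge0.
- by meas.
- by meas.
- by move=> s _; rewrite lee_wpmul2l//; apply: Ha_nd => //; rewrite lerD2r.
Qed.

Let Sn n t := \sum_(0 <= i < n) gs i t.
Let Sn0 n t : 0 <= Sn n t. Proof. by apply: sume_ge0. Qed.
Let mSn n : measurable_fun setT (Sn n). Proof. by apply: emeasurable_sum. Qed.

Let SnS n t : Sn n.+1 t = E1 t + convol E1 (Ha (Sn n)) t.
Proof.
elim: n => [|n IH].
  rewrite /Sn big_nat1 /=; set f := Ha _.
  rewrite (_ : f = (fun=> 0)); last first.
    by apply/funext => s; apply: eq_Ha => // r _; rewrite big_geq.
  by rewrite convolE; under eq_integral do rewrite mule0; rewrite integral0 adde0.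
rewrite /Sn big_nat_recr//= -/(Sn n.+1 t) IH.
have mH1 := measurable_Ha (mSn n) (Sn0 n).
have mH2 := measurable_Ha (mgs n) (gs0 n).
rewrite -addeA; congr (_ + _).
rewrite -[_ + _]/((fun t => convol E1 (Ha (Sn n)) t + convol E1 (Ha (gs n)) t) t).
rewrite -convolDr//; [|by move=> x; exact: Ha_ge0|by move=> x; exact: Ha_ge0].
congr (convol _ _ t); apply/funext => s; rewrite -HaD//.
by congr (Ha _ s); apply/funext => y; rewrite /Sn big_nat_recr.
Qed.

(** Either [I_n <= t], or [t] lies between two earlier consecutive partial sums. The induction uses
    [one = E1 + E1 * one] (convolution) and [Ha one = one]. *)
Let FsSn n t : Fs n t + Sn n t = one t.
Proof.
elim: n t => [|n IH] t; first by rewrite /Sn big_geq//= adde0.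
have mH1 := measurable_Ha (mFs n) (Fs0 n).
have mH2 := measurable_Ha (mSn n) (Sn0 n).
rewrite SnS /= addeCA one_resolvent; congr (_ + _).
rewrite -[_ + _]/((fun t => convol E1 (Ha (Fs n)) t + convol E1 (Ha (Sn n)) t) t).
rewrite -convolDr//; [|by move=> x; exact: Ha_ge0|by move=> x; exact: Ha_ge0].
rewrite -{1}Ha_one; congr (convol _ _ t); apply/funext => s; rewrite -HaD//.
by congr (Ha _ s); apply/funext => y; rewrite IH.
Qed.

(** The tail [P(t < I)] of the perpetuity. As a series of nonnegative terms it always converges, and
    the distribution function [F] is defined as its complement. *)
Let G t := \sum_(n <oo) gs n t.
Let G0 t : 0 <= G t. Proof. by apply: nneseries_ge0. Qed.
Let mG : measurable_fun setT G.
Proof. by apply: ge0_emeasurable_sum => n. Qed.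

Let GE t : G t = E1 t + convol E1 (Ha G) t.
Proof.
rewrite /G nneseries_recl//; congr (_ + _).
rewrite -(nneseries_addn 1)//.
under eq_eseriesr do rewrite addn1 /=.
rewrite -convol_nneseries//.
- congr (convol _ _ t); apply/funext => z; rewrite /Ha -(Qe_nneseries hq)//.
  by move=> n; have := mgs n => mgn; meas.
- by move=> n; exact: measurable_Ha.
- by move=> s; exact: Ex_fin_num.
- by move=> n s; exact: Ha_ge0.
Qed.

Let G_le t : G t <= one t.
Proof.
apply: lime_le; first by apply: is_cvg_nneseries.
by apply: nearW => n; rewrite -(FsSn n) leeDr.
Qed.

Let G_fin t : G t \is a fin_num.
Proof.
rewrite ge0_fin_numE// (le_lt_trans (G_le t))// -ge0_fin_numE//; exact: Ex_fin_num.
Qed.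

Let F t := one t - G t.
Let FG t : F t + G t = one t. Proof. by rewrite /F subeK. Qed.
Let F0 t : 0 <= F t. Proof. by rewrite /F sube_ge0 ?G_le ?G_fin. Qed.
Let mF : measurable_fun setT F. Proof. exact: emeasurable_funB. Qed.
Let F_le t : F t <= one t. Proof. by rewrite -(FG t) leeDl. Qed.
Let F_le1 t : F t <= 1.
Proof.
apply: le_trans (F_le t) _; have [t0|t0] := ltP t 0%R; first by rewrite one_lt0.
by rewrite /one Ex0E.
Qed.
Let F_fin t : F t \is a fin_num.
Proof. by rewrite ge0_fin_numE// (le_lt_trans (F_le1 t))// ltry. Qed.
Let F_lt0 t : (t < 0)%R -> F t = 0.
Proof. by move=> t0; apply/eqP; rewrite eq_le F0 andbT -(one_lt0 t0) F_le. Qed.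

Let F_nd (t t' : R) : (t <= t')%R -> F t <= F t'.
Proof.
move=> tt'; have [t0|t0] := ltP t 0%R; first by rewrite F_lt0.
suff GG : G t' <= G t.
  by rewrite /F /one !Ex0E ?leeB// (le_trans t0).
rewrite /G; apply: lee_lim; [exact: is_cvg_nneseries|exact: is_cvg_nneseries|].
apply: nearW => n; rewrite -/(Sn n t') -/(Sn n t).
have fF u : Fs n u \is a fin_num.
  rewrite ge0_fin_numE// (@le_lt_trans _ _ (one u))//; first by rewrite -(FsSn n) leeDl.
  by rewrite -ge0_fin_numE//; exact: Ex_fin_num.
have SE u : (0 <= u)%R -> Sn n u = 1 - Fs n u.
  by move=> u0; rewrite -(Ex0E u0) -/(one u) -(FsSn n u) addeAC subee ?add0e.
by rewrite !SE ?leeB// ?Fs_nd// (le_trans t0).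
Qed.

Let FE : F = convol E1 (Ha F).
Proof.
apply/funext => t.
have mH1 := measurable_Ha mF F0.
have mH2 := measurable_Ha mG G0.
apply: (ereal_addIr (G_fin t)).
rewrite FG GE addeCA one_resolvent; congr (_ + _).
rewrite -[_ + _]/((fun t => convol E1 (Ha F) t + convol E1 (Ha G) t) t).
rewrite -convolDr//; [|by move=> x; exact: Ha_ge0|by move=> x; exact: Ha_ge0].
rewrite -{1}Ha_one; congr (convol _ _ t); apply/funext => s; rewrite -HaD//.
by congr (Ha _ s); apply/funext => y; rewrite FG.
Qed.

Let HaF_le t : Ha F t <= one t.
Proof. by rewrite -Ha_one; apply: le_Ha. Qed.
Let mHaF := measurable_Ha mF F0.
Let HaF0 t : 0 <= Ha F t. Proof. exact: Ha_ge0. Qed.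
Let HaF_fin t : Ha F t \is a fin_num.
Proof.
by rewrite ge0_fin_numE// (le_lt_trans (HaF_le t))// -ge0_fin_numE//; exact: Ex_fin_num.
Qed.

(* the density of the limit law of the perpetuity *)
Definition profile t : \bar R := Ha F t - F t.
Let k := profile.

Let Fk t : F t + k t = Ha F t. Proof. by rewrite /k /profile addeC subeK. Qed.

(** [F] is nondecreasing and vanishes at negative times, and [theta^alpha < 1]. This is the sign of
    the profile. *)
Let F_le_Ha t : F t <= Ha F t.
Proof.
rewrite -[leLHS](Qe_cst hq 1%R (F0 t)); apply: (le_Qe hq) => //; first by meas.
move=> r /rho01/andP[rr0 rr1]; rewrite mulr1; have [t0|t0] := ltP t 0%R.
  by rewrite F_lt0.
by apply: F_nd; rewrite ler_pdivlMr// ler_piMr// ltW.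
Qed.

Lemma profile_ge0 t : 0 <= profile t.
Proof. by rewrite /profile sube_ge0 ?F_le_Ha ?F_fin. Qed.
Let k0 t : 0 <= k t. Proof. exact: profile_ge0. Qed.

Lemma profile_lt0 t : (t < 0)%R -> profile t = 0.
Proof. by move=> t0; rewrite /profile F_lt0// Ha_lt0// sube0. Qed.

Lemma measurable_profile : measurable_fun setT profile.
Proof. exact: emeasurable_funB. Qed.
Let mk : measurable_fun setT k. Proof. exact: measurable_profile. Qed.

Lemma profile_fin t : profile t \is a fin_num.
Proof. by rewrite /profile fin_numB HaF_fin F_fin. Qed.

Let one_one_fin t : convol one one t < +oo.
Proof.
have [t0|t0] := ltP t 0%R; first by rewrite convol_lt0.
rewrite convol_itv//.
rewrite (eq_integral (fun=> 1)); last first.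
  move=> s; rewrite inE/= in_itv/= => /andP[s0 st].
  by rewrite /one !Ex0E ?mule1// subr_ge0.
rewrite integral_cst//= mul1e lebesgue_measure_itv/=.
by case: ifP => // _; rewrite -EFinB ltry.
Qed.

(** That [k] is the density of [F] is obtained without differentiating: convolving
    [one = E1 + E1 * one] with [Ha F] gives [one * Ha F = F + one * F]. As [Ha F = F + k], the term
    [one * F], finite because it is at most [one * one], cancels. *)
Let FEk : F = convol one k.
Proof.
apply/funext => t.
have fF : convol one F t \is a fin_num.
  rewrite ge0_fin_numE; last exact: convol_ge0.
  apply: le_lt_trans (one_one_fin t); exact: le_convol.
apply: (ereal_addIr fF); rewrite addeC [RHS]addeC.
transitivity (convol one (Ha F) t); last first.
  rewrite (_ : Ha F = (fun t => F t + k t)); last by apply/funext => s; rewrite Fk.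
  by rewrite convolDr.
rewrite {2}one_resolvent (convolDl (b := convol E1 one))//; last 2 first.
- exact: measurable_convol.
- by move=> x; exact: convol_ge0.
rewrite -FE (convolC mE1 mone)// (convolA mone mE1 mHaF)// -FE.
by rewrite addeC.
Qed.

(* the density of [theta^alpha I] *)
Definition profile_jump z :=
  Qe q (fun y => ((y `^ alpha)^-1)%:E * profile (z / y `^ alpha)%R) 1%R.
Let Hk := profile_jump.

Let integrand_ge0 z y : 0 <= ((y `^ alpha)^-1)%:E * profile (z / y `^ alpha)%R.
Proof. by rewrite mule_ge0 ?profile_ge0// lee_fin invr_ge0 powR_ge0. Qed.

Lemma profile_jump_ge0 z : 0 <= profile_jump z.
Proof. by apply: Qe_ge0. Qed.
Let Hk0 z : 0 <= Hk z. Proof. exact: profile_jump_ge0. Qed.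

Lemma measurable_profile_jump : measurable_fun setT profile_jump.
Proof.
have mp := measurable_profile.
apply: (@measurable_parametric_integral _ R _ (fun z r => (q r)%:E *
  ((((r * 1) `^ alpha)^-1)%:E * profile (z / (r * 1) `^ alpha)%R))).
  by meas.
by move=> x y; rewrite mule_ge0// lee_fin.
Qed.
Let mHk : measurable_fun setT Hk. Proof. exact: measurable_profile_jump. Qed.

Let HaFE : Ha F = convol one Hk.
Proof.
have kin v r : 0 <= (q r)%:E * ((((r * 1) `^ alpha)^-1)%:E * k (v / (r * 1) `^ alpha)%R).
  by apply: mule_ge0; [rewrite lee_fin|exact: integrand_ge0].
apply/funext => z; rewrite (convolC mone mHk)// convolE.
transitivity (\int[leb]_v \int[leb]_r ((q r)%:E *
  ((((r * 1) `^ alpha)^-1)%:E * k (v / (r * 1) `^ alpha)%R) * one (z - v)%R)); last first.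
  apply: eq_integral => v _; rewrite ge0_integralZr//.
  by meas.
rewrite (ge0_tonelli (f := fun v r => (q r)%:E *
  ((((r * 1) `^ alpha)^-1)%:E * k (v / (r * 1) `^ alpha)%R) * one (z - v)%R)); last 2 first.
- by meas.
- by move=> x y; apply: mule_ge0.
apply: eq_integral => r _; have [r01|r01] := boolP (0 < r < 1)%R; last first.
  case: hq => _ _ qs _; rewrite qs// mul0e integral0_eq// => v _.
  by rewrite !mul0e.
have /andP[rr0 _] := rho01 r01; rewrite mulr1.
under [RHS]eq_integral do rewrite -!muleA.
rewrite [RHS]ge0_integralZl//; last 3 first.
- by meas.
- by move=> v _; rewrite !mule_ge0// ?lee_fin ?invr_ge0 ?powR_ge0.
- by rewrite lee_fin.
congr (_ * _).
by rewrite {1}FEk (convolC mone mk)// (convol_one_dilate _ mk).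
Qed.

(** The identity in law [I = E_0 + theta^alpha I'] for densities. It follows from [Ha F = F + k] and
    [F = E1 * Ha F] by cancelling [F]. *)
Lemma profileE : profile = convol E1 profile_jump.
Proof.
apply/funext => t; apply: (ereal_addIr (F_fin t)); rewrite addeC Fk HaFE.
rewrite {1}one_resolvent (convolDl (b := convol E1 one))//; last 2 first.
- exact: measurable_convol.
- by move=> x; exact: convol_ge0.
by rewrite (convolA mE1 mone mHk)// -HaFE -FE.
Qed.

Let FkE z : F z = \int[leb]_u (k u * (if (u <= z)%R then 1 else 0)).
Proof.
rewrite {1}FEk (convolC mone mk)// convolE; apply: eq_integral => u _; congr (_ * _).
by rewrite /one; case: leP => uz; [rewrite Ex0E// subr_ge0|rewrite Ex_lt0// subr_lt0].
Qed.

(** The definition [k = Ha F - F] with [F] written as the integral of [k]. In this form the mass of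
    the profile under [dx / x] becomes a log-moment. *)
Lemma profile_increment z : profile z = \int[leb]_r ((q r)%:E *
  \int[leb]_u (profile u * (if (z < u <= z / r `^ alpha)%R then 1 else 0))).
Proof.
have mp := measurable_profile.
apply: (ereal_addIr (F_fin z)); rewrite addeC Fk.
have -> : F z = Qe q (fun=> F z) 1%R by rewrite (Qe_cst hq).
rewrite /Qe addeC -ge0_integralD//; last 4 first.
- by move=> r _; rewrite mule_ge0 ?lee_fin.
- by meas.
- move=> r _; rewrite mule_ge0 ?lee_fin// integral_ge0// => u _.
  by rewrite mule_ge0 ?profile_ge0//; case: ifP.
- apply: emeasurable_funM; first by meas.
  apply: (@measurable_parametric_integral _ R _ (fun r u => profile u *
    (if (z < u <= z / r `^ alpha)%R then 1 else 0))); first by meas.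
  by move=> r u; rewrite mule_ge0 ?profile_ge0//; case: ifP.
apply: eq_integral => r _; have [r01|r01] := boolP (0 < r < 1)%R; last first.
  by case: hq => _ _ qs _; rewrite qs// !mul0e adde0.
have /andP[rr0 rr1] := rho01 r01; rewrite mulr1 -ge0_muleDr//; last first.
  by apply: integral_ge0 => u _; rewrite mule_ge0 ?profile_ge0//; case: ifP.
congr (_ * _); have [z0|z0] := ltP z 0%R.
  rewrite !F_lt0//; last by rewrite ltr_pdivrMr// mul0r.
  rewrite add0e integral0_eq// => u _; case: ifP; last by rewrite mule0.
  move=> /andP[zu uz]; have := lt_le_trans zu uz; rewrite ltr_pdivlMr// => ?.
  by exfalso; nra.
rewrite !FkE -ge0_integralD//; last 4 first.
- by move=> u _; rewrite mule_ge0//; case: ifP.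
- by meas.
- by move=> u _; rewrite mule_ge0//; case: ifP.
- by meas.
apply: eq_integral => u _; rewrite -ge0_muleDr; [|by case: ifP|by case: ifP].
congr (_ * _); have zz : (z <= z / r `^ alpha)%R by rewrite ler_pdivlMr// ler_piMr// ltW.
case: leP => [uz|zu] /=; last by case: ifP; rewrite ?add0e.
by rewrite (le_trans uz zz) adde0.
Qed.

Lemma integral_profile_le1 : \int[leb]_u profile u <= 1.
Proof.
have kc (u : R) : (k u * (if (u <= n%:R)%R then 1 else 0)) @[n --> \oo] --> k u.
  apply: cvg_near_cst; near=> n; rewrite ifT ?mule1//.
  by near: n; exact: nbhs_infty_ger.
have -> : \int[leb]_u profile u =
    limn (fun n => \int[leb]_u (k u * (if (u <= n%:R)%R then 1 else 0))).
  rewrite -monotone_convergence//.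
  - by apply: eq_integral => u _; apply/esym/cvg_lim => //; exact: kc.
  - by move=> n; meas.
  - by move=> n u _; rewrite mule_ge0//; case: ifP.
  - move=> u _ m n mn; rewrite lee_wpmul2l//; case: ifP => // um.
      by rewrite ifT// (le_trans um)// ler_nat.
    by case: ifP.
apply: lime_le.
  apply: ereal_nondecreasing_is_cvgn => m n mn; apply: ge0_le_integral => //.
  - by move=> u _; rewrite mule_ge0//; case: ifP.
  - by meas.
  - by meas.
  - move=> u _; rewrite lee_wpmul2l//; case: ifP => // um.
      by rewrite ifT// (le_trans um)// ler_nat.
    by case: ifP.
by apply: nearW => n; rewrite -FkE F_le1.
Unshelve. all: by end_near. Qed.

(** The contraction factor for means: [E I = 1 + kappa E I] suggests the bound [1 / (1 - kappa)]
    used below. *)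
Let kappa := Qe q (fun y => (y `^ alpha)%:E) 1%R.

Let kappa0 : 0 <= kappa.
Proof. by apply: (Qe_ge0 hq) => y; rewrite lee_fin powR_ge0. Qed.

Let kappa_lt1 : kappa < 1.
Proof.
pose f (r : R) : \bar R := (if (0 < r < 1)%R then 1 - r `^ alpha else 0)%R%:E.
have mf : measurable_fun setT f by rewrite /f; meas.
have f0 r : 0 <= f r.
  by rewrite /f lee_fin; case: ifP => // /rho01/andP[_ /ltW]; rewrite subr_ge0.
have fpos : 0 < \int[leb]_r ((q r)%:E * f r).
  apply: jump_integral_gt0 => // r r01; rewrite /f r01 lte_fin subr_gt0.
  by case/andP: (rho01 r01).
have E : kappa + \int[leb]_r ((q r)%:E * f r) = 1.
  rewrite /kappa /Qe -ge0_integralD//; last 4 first.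
  - by move=> r _; rewrite mule_ge0 ?lee_fin// powR_ge0.
  - by meas.
  - by move=> r _; apply: mule_ge0 => //; rewrite lee_fin.
  - by meas.
  case: (hq) => _ _ qs <-; apply: eq_integral => r _.
  have [r01|r01] := boolP (0 < r < 1)%R; last by rewrite qs// !mul0e adde0.
  by rewrite mulr1 /f r01 -!EFinM -EFinD; congr (_%:E); ring.
have fk : kappa \is a fin_num.
  by rewrite ge0_fin_numE// (le_lt_trans (leeDl _ (ltW fpos)))// E ltry.
by rewrite -E lteDl.
Qed.

Let kappa_fin : kappa \is a fin_num.
Proof. by rewrite ge0_fin_numE// (lt_trans kappa_lt1)// ltry. Qed.

Let integral_Ha f : measurable_fun setT f -> (forall x, 0 <= f x) ->
  \int[leb]_z Ha f z = kappa * \int[leb]_z f z.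
Proof.
move=> mf f0; rewrite /Ha /Qe.
rewrite (ge0_tonelli (f := fun z r => (q r)%:E * f (z / (r * 1) `^ alpha)%R)); last 2 first.
- by meas.
- by move=> x y; rewrite mule_ge0 ?lee_fin.
rewrite -ge0_integralZr//; last 3 first.
- by meas.
- by move=> r _; rewrite mule_ge0 ?lee_fin// powR_ge0.
- exact: integral_ge0.
apply: eq_integral => r _; have [r01|r01] := boolP (0 < r < 1)%R; last first.
  case: hq => _ _ qs _; rewrite qs// !mul0e integral0_eq// => v _.
  by rewrite mul0e.
have /andP[rr0 _] := rho01 r01; rewrite mulr1 ge0_integralZl ?lee_fin//; last by meas.
rewrite -muleA; congr (_ * _).
have irr : ((r `^ alpha)^-1 != 0)%R by rewrite invr_eq0 gt_eqF.
rewrite -(ge0_integral_affine 0%R irr mf f0) ger0_norm ?invr_ge0 ?powR_ge0//.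
rewrite muleA -EFinM divff ?gt_eqF// mul1e.
by apply: eq_integral => z _; rewrite addr0 mulrC.
Qed.

(** The integrals [a_n] satisfy [a_(n+1) = 1 + kappa a_n] and start at [0], so they stay below the
    fixed point of this recursion. *)
Let integral_Sn n : \int[leb]_t Sn n t <= ((1 - fine kappa)^-1)%:E.
Proof.
have k1 : (0 < 1 - fine kappa)%R.
  by rewrite subr_gt0 -lte_fin fineK.
elim: n => [|n IH].
  rewrite integral0_eq; first by rewrite lee_fin invr_ge0 ltW.
  by move=> t _; rewrite /Sn big_geq.
have mH := measurable_Ha (mSn n) (Sn0 n).
have H0 t := Ha_ge0 t (Sn0 n).
under eq_integral do rewrite SnS.
rewrite ge0_integralD//; [|by move=> x _; exact: convol_ge0|exact: measurable_convol].
rewrite integral_Ex1 integral_convol// integral_Ex1 mul1e integral_Ha//.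
apply: (@le_trans _ _ (1 + kappa * ((1 - fine kappa)^-1)%:E)).
  by rewrite leeD2l// lee_wpmul2l.
rewrite -(fineK kappa_fin) -EFinM -EFinD lee_fin /=.
by rewrite -[X in (X + _ <= _)%R](divff (lt0r_neq0 k1)) -mulrDl subrK mul1r.
Qed.

(** This excludes an infinite perpetuity. If [k] had no mass, [F] would vanish and the tail [G]
    would be [1] on the half-line, whereas the integral of [G], the mean of [I], is at most
    [1 / (1 - kappa)]. *)
Lemma integral_profile_gt0 : 0 < \int[leb]_u profile u.
Proof.
rewrite lt_neqAle integral_ge0 ?andbT; last by move=> *; exact: profile_ge0.
apply/negP => /eqP E.
have F_eq0 t : F t = 0.
  apply/eqP; rewrite eq_le F0 andbT E FkE; apply: ge0_le_integral => //.
  - by move=> u _; rewrite mule_ge0//; case: ifP.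
  - by meas.
  - by move=> u _; case: ifP; rewrite ?mule1 ?mule0.
have : \int[leb]_t G t <= ((1 - fine kappa)^-1)%:E.
  rewrite /G integral_nneseries//; apply: lime_le.
    by apply: is_cvg_nneseries => *; exact: integral_ge0.
  apply: nearW => n; rewrite -ge0_integral_sum//.
  exact: integral_Sn.
rewrite (_ : G = one); last by apply/funext => t; rewrite -(FG t) F_eq0 add0e.
suff -> : \int[leb]_t one t = +oo by [].
transitivity (\int[leb]_(t in (`[0%R, +oo[%classic : set R)) (cst 1) t); last first.
  by rewrite integral_cst//= mul1e lebesgue_measure_itv/= ltry.
rewrite [RHS]integral_mkcond; apply: eq_integral => t _; rewrite patchE.
have [t0|t0] := ltP t 0%R.
  by rewrite memNset ?one_lt0//= in_itv/= andbT; apply/negP; rewrite -ltNge.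
by rewrite mem_set ?/one ?Ex0E//= in_itv/= t0.
Qed.

End profile.

(* The forward (mild) equation for [P] is paired with the backward equation for [w]. *)
Lemma forward_backward_pairing (R : realType) (l : R) (P0 phi : \bar R)
    (P V g w : R -> \bar R) :
  (0 <= l)%R -> 0 <= P0 -> 0 <= phi ->
  measurable_fun setT V -> measurable_fun setT g ->
  (forall s, 0 <= V s) -> (forall s, 0 <= g s) ->
  P = (fun s => P0 * Ex l s + convol (Ex l) V s) ->
  w = (fun s => phi * Ex l s + l%:E * convol (Ex l) g s) ->
  forall t, convol P (fun s => l%:E * g s) t + phi * P t =
            P0 * w t + convol V w t.
Proof.
move=> l0 P00 phi0 mV mg V0 g0 PE wE t.
have lE0 : 0 <= l%:E by rewrite lee_fin.
have mL := @measurable_Ex R l; have L0 := @Ex_ge0 R l.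
have mLV := measurable_convol mL mV L0 V0; have LV0 s := convol_ge0 s L0 V0.
have mLg := measurable_convol mL mg L0 g0; have Lg0 s := convol_ge0 s L0 g0.
have mP0 : measurable_fun setT (fun s => P0 * Ex l s) by meas.
have mlg : measurable_fun setT (fun s => l%:E * g s) by meas.
have lg0 s : 0 <= l%:E * g s by rewrite mule_ge0.
have PL0 s : 0 <= P0 * Ex l s by rewrite mule_ge0.
have phiL0 s : 0 <= phi * Ex l s by rewrite mule_ge0.
have mphiL : measurable_fun setT (fun s => phi * Ex l s) by meas.
have mlLg : measurable_fun setT (fun s => l%:E * convol (Ex l) g s) by meas.
have lLg0 s : 0 <= l%:E * convol (Ex l) g s by rewrite mule_ge0.
have -> : convol P (fun s => l%:E * g s) t =
    P0 * (l%:E * convol (Ex l) g t) + l%:E * convol V (convol (Ex l) g) t.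
  rewrite PE (convolDl mP0 mLV mlg)// (convolZl mL mlg P00)//.
  rewrite (convolZr mL mg lE0)//; congr (_ + _).
  rewrite (convolZr mLV mg lE0)//; congr (_ * _).
  by rewrite (convolC mL mV)// (convolA mV mL mg).
have -> : convol V w t = phi * convol V (Ex l) t + l%:E * convol V (convol (Ex l) g) t.
  transitivity (convol V (fun s => phi * Ex l s + l%:E * convol (Ex l) g s) t).
    by rewrite -wE.
  rewrite (convolDr mV mphiL mlLg)// (convolZr mV mL phi0)//.
  by rewrite (convolZr mV mLg lE0).
have -> : P t = P0 * Ex l t + convol V (Ex l) t by rewrite PE (convolC mL mV).
have -> : w t = phi * Ex l t + l%:E * convol (Ex l) g t by rewrite wE.
have := convol_ge0 t L0 g0; have := convol_ge0 t V0 L0.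
have := convol_ge0 t V0 Lg0; have := L0 t.
move: (convol V (convol _ _) t) (convol V (Ex l) t) (convol _ g t) (Ex l t).
move=> X Y Z W W0 X0 Y0 Z0.
rewrite !ge0_muleDr ?mule_ge0// (muleCA phi).
by rewrite addeACA; congr (_ + _); rewrite addeC.
Qed.

(** For each fixed [r] substitute [y = r x]. The guard [0 < r] keeps the dual integrand nonnegative
    where [r^-1] is negative. *)
Lemma Qe_adjoint (R : realType) (q : R -> R) (a b : R -> \bar R) :
  jump_density q -> measurable_fun setT a -> measurable_fun setT b ->
  (forall x, 0 <= a x) -> (forall x, 0 <= b x) ->
  \int[leb]_x (a x * Qe q b x) =
  \int[leb]_y (Qe q (fun r => (r^-1)%:E * a (y / r)%R *
    (if (0 < r)%R then 1 else 0)) 1%R * b y).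
Proof.
move=> hq ma mb a0 b0; have [mq q0 qs q1] := hq.
transitivity (\int[leb]_x \int[leb]_r (a x * ((q r)%:E * b (r * x)%R))).
  apply: eq_integral => x _; rewrite ge0_integralZl//; first by meas.
  by move=> r _; rewrite mule_ge0// lee_fin.
rewrite (ge0_tonelli (f := fun x r => a x * ((q r)%:E * b (r * x)%R))); last 2 first.
- by meas.
- by move=> x y; rewrite !mule_ge0// lee_fin.
have p0 y r : 0 <= (q r)%:E * (((r * 1)^-1)%:E * a (y / (r * 1))%R *
    (if (0 < r * 1)%R then 1 else 0)).
  rewrite mulr1; case: ifP => r0; last by rewrite !mule0.
  by rewrite mule1 !mule_ge0 ?lee_fin// invr_ge0 ltW.
have mp : measurable_fun setT (fun p : R * R => (q p.2)%:E * (((p.2 * 1)^-1)%:E *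
    a (p.1 / (p.2 * 1))%R * (if (0 < p.2 * 1)%R then 1 else 0))) by meas.
transitivity (\int[leb]_y \int[leb]_r ((q r)%:E * (((r * 1)^-1)%:E *
    a (y / (r * 1))%R * (if (0 < r * 1)%R then 1 else 0)) * b y)); last first.
  apply: eq_integral => y _; rewrite ge0_integralZr//; by meas.
rewrite [RHS](ge0_tonelli (f := fun y r => (q r)%:E * (((r * 1)^-1)%:E *
    a (y / (r * 1))%R * (if (0 < r * 1)%R then 1 else 0)) * b y)); last 2 first.
- by apply: emeasurable_funM => //; meas.
- by move=> x y; apply: mule_ge0.
apply: eq_integral => r _; have [/andP[r0 r1]|r01] := boolP (0 < r < 1)%R; last first.
  by rewrite qs// !integral0_eq// => x _; rewrite !(mul0e, mule0).
under eq_integral do rewrite muleCA.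
under [RHS]eq_integral do rewrite mulr1 r0 mule1 -!muleA.
rewrite ge0_integralZl ?lee_fin//; last 2 first.
- by meas.
- by move=> x _; rewrite mule_ge0.
rewrite [RHS]ge0_integralZl ?lee_fin//; last 2 first.
- by meas.
- by move=> x _; rewrite !mule_ge0// lee_fin invr_ge0 ltW.
congr (_ * _).
have ir : (r^-1 != 0)%R by rewrite invr_eq0 gt_eqF.
rewrite -(ge0_integral_affine 0%R ir (f := fun x => a x * b (r * x)%R)); last 2 first.
- by meas.
- by move=> x; rewrite mule_ge0.
rewrite gtr0_norm ?invr_gt0// -ge0_integralZl//; last 3 first.
- by meas.
- by move=> x _; rewrite mule_ge0.
- by rewrite lee_fin invr_ge0 ltW.
apply: eq_integral => x _; rewrite addr0; congr (_ * (a _ * b _)).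
  by rewrite mulrC.
by rewrite mulrA divff ?mul1r// gt_eqF.
Qed.

Lemma powR_le_mono (R : realType) (a x y : R) : (0 < a)%R -> (0 <= x)%R -> (0 <= y)%R ->
  (x `^ a <= y `^ a)%R = (x <= y)%R.
Proof.
move=> a0 x0 y0; apply/idP/idP => [|xy]; last first.
  by apply: ge0_ler_powR => //; rewrite ?nnegrE// ltW.
apply: contraTT; rewrite -!ltNge => yx.
by apply: gt0_ltr_powR; rewrite ?nnegrE.
Qed.

Lemma powR_lt_mono (R : realType) (a x y : R) : (0 < a)%R -> (0 <= x)%R -> (0 <= y)%R ->
  (x `^ a < y `^ a)%R = (x < y)%R.
Proof. by move=> *; rewrite !ltNge powR_le_mono. Qed.

(** * The self-similar solution *)

Section self_similar_solution.
Variables (R : realType) (alpha : R) (h : R -> R).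
Let q := dens h.
Hypothesis hq : jump_density q.
Hypothesis alpha0 : (0 < alpha)%R.
Variables (k Hk : R -> \bar R).
Hypothesis mk : measurable_fun setT k.
Hypothesis k0 : forall t, 0 <= k t.
Hypothesis kfin : forall t, k t \is a fin_num.
Hypothesis k_lt0 : forall t, (t < 0)%R -> k t = 0.
Hypothesis HkE : forall z, Hk z =
  Qe q (fun y => ((y `^ alpha)^-1)%:E * k (z / y `^ alpha)%R) 1%R.
Hypothesis mHk : measurable_fun setT Hk.
Hypothesis Hk0 : forall t, 0 <= Hk t.
Hypothesis kE : k = convol (Ex 1%R) Hk.
Hypothesis kinc : forall z, k z = \int[leb]_r ((q r)%:E *
  \int[leb]_u (k u * (if (z < u <= z / r `^ alpha)%R then 1 else 0))).
Hypothesis k_gt0 : 0 < \int[leb]_u k u.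
Hypothesis k_lty : \int[leb]_u k u < +oo.
Hypothesis L_lty : \int[leb]_r ((q r)%:E * (- ln r)%:E) < +oo.
Let mq : measurable_fun setT q. Proof. by case: hq. Qed.
Let q0 r : (0 <= q r)%R. Proof. by case: hq. Qed.
Let qE0 r : 0 <= (q r)%:E. Proof. by rewrite lee_fin. Qed.
Let w := @invp R.
Let w0 a : 0 <= (w a)%:E. Proof. by rewrite lee_fin invp_ge0. Qed.
Let mw : measurable_fun setT w. Proof. exact: measurable_invp. Qed.

Let Hk_lt0 z : (z < 0)%R -> Hk z = 0.
Proof.
move=> z0; rewrite HkE -[RHS](Qe_cst hq 1%R (lexx 0)); apply: (eq_Qe hq) => r /andP[r0 _].
by rewrite mulr1 k_lt0 ?mule0// ltr_pdivrMr ?powR_gt0// mul0r.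
Qed.

Let k_le0 u : (u <= 0)%R -> k u = 0.
Proof.
rewrite le_eqVlt => /predU1P[->|]; last exact: k_lt0.
rewrite kE convol_itv; [|exact: Ex_lt0|exact: Hk_lt0].
by rewrite set_itv1 integral_set1.
Qed.

(** With [u = b^alpha] the condition on [x] becomes [r b <= x < b]. *)
Let integral_w_shell u r : (0 < u)%R -> (0 < r < 1)%R ->
  \int[leb]_x ((w x)%:E * (if (x `^ alpha < u <= x `^ alpha / r `^ alpha)%R then 1 else 0))
  = (- ln r)%:E.
Proof.
move=> u0 /andP[r0 r1]; pose b : R := (u `^ (alpha^-1))%R.
have b0 : (0 < b)%R by rewrite powR_gt0.
have ub : u = (b `^ alpha)%R by rewrite /b -powRrM mulVf ?gt_eqF// powRr1// ltW.
transitivity (\int[leb]_x ((w x)%:E * (if (r * b <= x < b)%R then 1 else 0))).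
  apply: eq_integral => x _; rewrite /w /invp; case: ifPn => x0; last by rewrite !mul0e.
  have [[x0' b0'] r0'] := (ltW x0, ltW b0, ltW r0).
  congr (_ * _); rewrite ub powR_lt_mono// ler_pdivlMr ?powR_gt0//.
  by rewrite -powRM// powR_le_mono ?mulr_ge0// andbC (mulrC b).
rewrite integral_invp ?mulr_gt0//; last by rewrite ger_pMl// ltW.
by congr (_%:E); rewrite lnM ?posrE//; lra.
Qed.

Let c0 := \int[leb]_x ((w x)%:E * k (x `^ alpha)%R).
Let L := \int[leb]_r ((q r)%:E * (- ln r)%:E).

Let ind0 (b : bool) : 0 <= (if b then 1 else 0 : \bar R).
Proof. by case: b. Qed.

(** Insert [kinc] and exchange integrals: for fixed [r] and [u] the admissible [x] form a shell of
    logarithmic length [- ln r], whatever [u] is, so the integrals factorize. Here the log-moment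
    condition turns into finite mass. *)
Let c0E : c0 = (\int[leb]_u k u) * L.
Proof.
pose A (x r u : R) : \bar R := k u * (if (x `^ alpha < u <= x `^ alpha / r `^ alpha)%R then 1 else 0).
have A0 x r u : 0 <= A x r u by rewrite mule_ge0.
have mA : measurable_fun setT (fun p : (R * R) * R => A p.1.1 p.1.2 p.2).
  by rewrite /A; meas.
have mI : measurable_fun setT (fun p : R * R => \int[leb]_u A p.1 p.2 u).
  exact: (@measurable_parametric_integral _ _ _ (fun (p : R * R) u => A p.1 p.2 u)).
have I0 x r : 0 <= \int[leb]_u A x r u by apply: integral_ge0.
transitivity (\int[leb]_x \int[leb]_r ((w x)%:E * ((q r)%:E * \int[leb]_u A x r u))).
  apply: eq_integral => x _; rewrite kinc ge0_integralZl//.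
  - apply: emeasurable_funM; first by meas.
    by apply: (measurableT_comp mI (g := fun r : R => (x, r))); meas.
  - by move=> r _; rewrite mule_ge0.
rewrite (ge0_tonelli (f := fun x r => (w x)%:E * ((q r)%:E * \int[leb]_u A x r u))); last 2 first.
- by apply: emeasurable_funM; [meas|apply: emeasurable_funM => //; meas].
- by move=> x r; rewrite !mule_ge0.
rewrite muleC -ge0_integralZr//; last 3 first.
- by meas.
- move=> r _; have [r01|r01] := boolP (0 < r < 1)%R.
    rewrite mule_ge0// lee_fin oppr_ge0 ln_le0//; by case/andP: r01 => _ /ltW.
  by case: hq => _ _ qs _; rewrite qs// mul0e.
- exact: ltW.
apply: eq_integral => r _; have [r01|r01] := boolP (0 < r < 1)%R; last first.
  case: hq => _ _ qs _; rewrite qs// !mul0e integral0_eq// => x _.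
  by rewrite mul0e mule0.
have mIr : measurable_fun setT (fun x => \int[leb]_u A x r u).
  by apply: (measurableT_comp mI (g := fun x : R => (x, r))); meas.
under eq_integral do rewrite muleCA.
rewrite ge0_integralZl//; last 2 first.
- by meas.
- by move=> x _; rewrite mule_ge0.
rewrite -muleA; congr (_ * _).
transitivity (\int[leb]_x \int[leb]_u ((w x)%:E * A x r u)).
  apply: eq_integral => x _; rewrite ge0_integralZl//.
  by apply: (measurableT_comp mA (g := fun u : R => ((x, r), u))); meas.
rewrite (ge0_tonelli (f := fun x u => (w x)%:E * A x r u)); last 2 first.
- apply: emeasurable_funM; first by meas.
  by apply: (measurableT_comp mA (g := fun p : R * R => ((p.1, r), p.2))); meas.
- by move=> x u; rewrite mule_ge0.
rewrite muleC -ge0_integralZr//; last first.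
  by rewrite lee_fin oppr_ge0 ln_le0//; case/andP: r01 => _ /ltW.
apply: eq_integral => u _; rewrite /A; under eq_integral do rewrite muleCA.
rewrite ge0_integralZl//; last 2 first.
- by meas.
- by move=> x _; rewrite mule_ge0.
have [u0|u0] := ltP 0%R u; last by rewrite k_le0// !mul0e.
by rewrite integral_w_shell.
Qed.

Let c0_gt0 : 0 < c0.
Proof.
rewrite c0E mule_gt0//.
apply: (jump_integral_gt0 hq); first by meas.
by move=> r /andP[r0 r1]; rewrite lte_fin oppr_gt0 ln_lt0// r0.
Qed.

Let c0_fin : c0 \is a fin_num.
Proof.
rewrite ge0_fin_numE ?(ltW c0_gt0)// c0E; apply: lte_mul_pinfty => //.
- exact: ltW.
- by rewrite ge0_fin_numE// ltW.
Qed.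

Let c := fine c0.
Let c_gt0 : (0 < c)%R. Proof. by rewrite -lte_fin fineK. Qed.
Let ic0 : 0 <= (c^-1)%:E. Proof. by rewrite lee_fin invr_ge0 ltW. Qed.

Definition us_profile (x : R) : R := (fine (k (x `^ alpha)%R) / (c * x ^+ 2))%R.
Let us := us_profile.

(* the density of the law of the self-similar solution at time [s] *)
Let Pd (s x : R) : \bar R := (w x)%:E * ((c^-1)%:E * k ((1 + s) * x `^ alpha)%R).

Let Pd_ge0 s x : 0 <= Pd s x. Proof. by rewrite !mule_ge0. Qed.

(** As [gamma(t)^alpha = 1 + t], dilation by [gamma(t)] multiplies [x^alpha] by [1 + t]; the factor
    [gamma(t)^2] cancels against the dilated [x^-2]. *)
Let mdens_self_sim t x : (0 <= t)%R -> (mdens (self_sim alpha us t) x)%:E = Pd t x.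
Proof.
move=> t0; rewrite /Pd /mdens /w /invp; case: ifP => x0; last by rewrite mul0e.
have t1 : (0 < 1 + t)%R by rewrite ltr_wpDr.
have g0 : (0 < gamma_ss alpha t)%R by rewrite powR_gt0.
have gx : ((gamma_ss alpha t * x) `^ alpha = (1 + t) * x `^ alpha)%R.
  rewrite powRM ?ltW//; congr (_ * _)%R.
  by rewrite /gamma_ss -powRrM mulVf ?gt_eqF// powRr1// ltW.
rewrite /self_sim /us /us_profile gx -[in RHS](fineK (kfin _)) -!EFinM; congr (_%:E).
by field; rewrite !gt_eqF.
Qed.

Let mdens_us x : (mdens us x)%:E = Pd 0%R x.
Proof.
rewrite -(mdens_self_sim x (lexx 0%R)); congr ((mdens _ x)%:E); apply/funext => y.
by rewrite /self_sim /gamma_ss addr0 powR1 expr1n !mul1r.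
Qed.

Lemma Dm_us_profile : Dm us_profile.
Proof.
split.
- apply: measurable_funTS; rewrite /us_profile.
  have mfk : measurable_fun setT (fun x => fine (k (x `^ alpha)%R)).
    apply: (measurableT_comp (@fine_measurable _ _ measurableT)).
    by meas.
  by meas.
- move=> x x0; rewrite /us_profile divr_ge0 ?fine_ge0//.
  by rewrite mulr_ge0 ?exprn_ge0 ?(ltW c_gt0) ?(ltW x0).
- transitivity (\int[leb]_x ((mdens us x)%:E * 1)).
    rewrite -(integral_mdens us (fun=> 1)); apply: eq_integral => x _; by rewrite mule1.
  transitivity ((c^-1)%:E * c0); last first.
    by rewrite -(fineK c0_fin) -EFinM mulVf// gt_eqF.
  rewrite /c0 -ge0_integralZl//; last 2 first.
  + by meas.
  + by move=> x _; rewrite mule_ge0.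
  apply: eq_integral => x _; rewrite mule1 mdens_us /Pd addr0 mul1r.
  by rewrite muleCA.
Qed.

Lemma Dm_self_sim (u : R -> R) t : Dm u -> (0 <= t)%R -> Dm (self_sim alpha u t).
Proof.
move=> Du t0; have [mu u0 _] := Du.
have t1 : (0 < 1 + t)%R by rewrite ltr_wpDr.
have g0 : (0 < gamma_ss alpha t)%R by rewrite powR_gt0.
have md := measurable_mdens Du.
have mdE x : (mdens (self_sim alpha u t) x = gamma_ss alpha t * mdens u (gamma_ss alpha t * x))%R.
  rewrite /mdens pmulr_rgt0//; case: ifP => _; last by rewrite mulr0.
  by rewrite /self_sim; ring.
split.
- rewrite /self_sim; apply: measurable_funM => //.
  apply: (measurable_comp _ _ mu).
  + exact: measurable_itv.
  + move=> _ [x /= + <-]; rewrite /pos_half/= !in_itv/= !andbT => x0.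
    by rewrite mulr_gt0.
  + by apply: measurable_funTS; meas.
- by move=> x x0; rewrite /self_sim mulr_ge0 ?exprn_ge0 ?(ltW g0)// u0// mulr_gt0.
- transitivity (\int[leb]_x ((mdens (self_sim alpha u t) x)%:E * 1)).
    rewrite -(integral_mdens _ (fun=> 1)); apply: eq_integral => x _; by rewrite mule1.
  rewrite -[RHS](integral_mdens1 Du).
  rewrite -(ge0_integral_affine (a := gamma_ss alpha t) 0%R
    (f := fun x => (mdens u x)%:E)); last 3 first.
  + by rewrite gt_eqF.
  + by meas.
  + by move=> x; rewrite lee_fin mdens_ge0.
  rewrite gtr0_norm// -ge0_integralZl//; last 3 first.
  + by meas.
  + by move=> x _; rewrite lee_fin mdens_ge0.
  + by rewrite lee_fin ltW.
  by apply: eq_integral => x _; rewrite mule1 mdE addr0 EFinM.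
Qed.

Let mExp v : measurable_fun setT (Ex (v : R)). Proof. exact: measurable_Ex. Qed.

Let flow v s : \bar R := if (0 <= s)%R then Hk ((1 + s) * v)%R else 0.

(** The mild forward equation at a state of rate [v]. In [k = E1 * Hk], taken at [T = (1 + s) v],
    the integral is cut at [z = v]: below, [T - z = (v - z) + s v] splits off [e^(-v s)]; above,
    [z = v (1 + u)] gives a convolution in time. *)
Let k_flow v s : (0 < v)%R -> (0 <= s)%R ->
  k ((1 + s) * v)%R = k v * Ex v s + v%:E * convol (Ex v) (flow v) s.
Proof.
move=> v0 s0; have mE1 := mExp 1%R; set T := ((1 + s) * v)%R.
have kE' u : k u = \int[leb]_z (Hk z * Ex 1%R (u - z)%R).
  by rewrite {1}kE convolC// ?convolE// => ?; exact: Ex_ge0.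
pose f z := Hk z * Ex 1%R (T - z)%R.
have f0 z : 0 <= f z by rewrite mule_ge0// Ex_ge0.
have mf : measurable_fun setT f by rewrite /f; meas.
have -> : k T = \int[leb]_z (f z * (if (z < v)%R then 1 else 0)) +
    \int[leb]_z (f z * (if (v <= z)%R then 1 else 0)).
  rewrite kE' -ge0_integralD//; last 4 first.
  - by move=> z _; rewrite mule_ge0.
  - by meas.
  - by move=> z _; rewrite mule_ge0.
  - by meas.
  by apply: eq_integral => z _; case: ltP => _; rewrite mule1 mule0 ?adde0 ?add0e.
congr (_ + _).
  transitivity (\int[leb]_z (Hk z * Ex 1%R (v - z)%R * (if (z < v)%R then 1 else 0) * Ex v s)).
    apply: eq_integral => z _; case: ifPn => zv; last by rewrite !mule0 mul0e.
    rewrite !mule1 -muleA; congr (_ * _).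
    have vz : (0 <= v - z)%R by rewrite subr_ge0 ltW.
    have Tz : (0 <= T - z)%R by rewrite /T; nra.
    by rewrite /Ex vz Tz s0 -EFinM -expRD; congr ((expR _)%:E); rewrite /T; ring.
  rewrite ge0_integralZr//; last 3 first.
  - by meas.
  - by move=> z _; rewrite !mule_ge0// Ex_ge0.
  - exact: Ex_ge0.
  congr (_ * _); rewrite kE'.
  transitivity (\int[leb]_(z in (`]-oo, v[%classic : set R)) (Hk z * Ex 1%R (v - z)%R)).
    rewrite [RHS]integral_mkcond; apply: eq_integral => z _; rewrite patchE.
    have -> : (z \in (`]-oo, v[%classic : set R)) = (z < v)%R.
      by apply/idP/idP; rewrite inE/= in_itv.
    by case: ifP => _; rewrite ?mule1 ?mule0.
  (* The null endpoint [z = v] is added because [Ex] cuts off with a weak inequality. *)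
  rewrite integral_itv_bndo_bndc; last by apply: measurable_funTS; meas.
  rewrite integral_mkcond; apply: eq_integral => z _; rewrite patchE.
  have -> : (z \in (`]-oo, v]%classic : set R)) = (z <= v)%R.
    by apply/idP/idP; rewrite inE/= in_itv.
  by case: leP => zv //; rewrite Ex_lt0 ?mule0// subr_lt0.
have vn0 : v != 0%R by rewrite gt_eqF.
have flow0 u : 0 <= flow v u by rewrite /flow; case: ifP.
have mflow : measurable_fun setT (flow v) by rewrite /flow; meas.
rewrite (convolC (mExp v) mflow)//; last by move=> u; exact: Ex_ge0.
rewrite convolE.
rewrite -(ge0_integral_affine v vn0 (f := fun z => f z * (if (v <= z)%R then 1 else 0))); last 2 first.
- by meas.
- by move=> z; rewrite mule_ge0.
rewrite gtr0_norm//; congr (_ * _); apply: eq_integral => u _.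
rewrite lerDr pmulr_rge0// /flow /f; case: ifPn => u0; last by rewrite mule0 mul0e.
rewrite mule1; congr (Hk _ * _); first by ring.
have -> : (T - (v * u + v) = v * (s - u))%R by rewrite /T; ring.
rewrite /Ex pmulr_rge0//; case: ifP => // _; congr ((expR _)%:E); ring.
Qed.

Let P x s : \bar R := if (0 <= s)%R then Pd s x else 0.
Let V x s : \bar R :=
  (w x)%:E * ((c^-1)%:E * ((x `^ alpha)%:E * flow (x `^ alpha)%R s)).

Let flow_ge0 v s : 0 <= flow v s. Proof. by rewrite /flow; case: ifP. Qed.
Let lamE0 x : 0 <= (x `^ alpha)%:E. Proof. by rewrite lee_fin powR_ge0. Qed.
Let P_ge0 x s : 0 <= P x s. Proof. by rewrite /P; case: ifP. Qed.
Let V_ge0 x s : 0 <= V x s. Proof. by rewrite !mule_ge0. Qed.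

Let mP : measurable_fun setT (fun p : R * R => P p.1 p.2).
Proof. by rewrite /P /Pd; meas. Qed.
Let mV : measurable_fun setT (fun p : R * R => V p.1 p.2).
Proof. by rewrite /V /flow; meas. Qed.
Let mVx x : measurable_fun setT (V x).
Proof. by rewrite /V /flow; meas. Qed.
Let mPx x : measurable_fun setT (P x).
Proof. by rewrite /P /Pd; meas. Qed.

Let mild x : P x = (fun s => Pd 0%R x * Ex (x `^ alpha)%R s + convol (Ex (x `^ alpha)%R) (V x) s).
Proof.
have mfl : measurable_fun setT (flow (x `^ alpha)%R) by rewrite /flow; meas.
have mfl2 : measurable_fun setT (fun s => (x `^ alpha)%:E * flow (x `^ alpha)%R s) by meas.
have mfl3 : measurable_fun setT (fun s => (c^-1)%:E * ((x `^ alpha)%:E * flow (x `^ alpha)%R s)) by meas.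
have l0 := @Ex_ge0 R (x `^ alpha)%R; have ml := mExp (x `^ alpha)%R.
have fl0 := flow_ge0 (x `^ alpha)%R.
apply/funext => s; rewrite /V (convolZr ml mfl3)//; last by move=> u; rewrite !mule_ge0.
rewrite (convolZr ml mfl2)//; last by move=> u; rewrite !mule_ge0.
rewrite (convolZr ml mfl)// /P /Pd.
have [x0|x0] := ltP 0%R x; last by rewrite /w /invp ltNge x0/= !mul0e adde0; case: ifP.
case: ifPn => s0; last first.
  have s0' : (s < 0)%R by rewrite ltNge.
  rewrite (Ex_lt0 _ s0') mule0 convol_lt0// ?mule0 ?adde0//; first exact: Ex_lt0.
  by move=> u u0; rewrite /flow leNgt u0.
have C0 := convol_ge0 s l0 fl0.
rewrite k_flow ?powR_gt0// addr0 mul1r.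
by rewrite !ge0_muleDr ?mule_ge0// !muleA.
Qed.

(** The influx into [y] is the adjoint of [Q] applied to the outflow [x^alpha P]. The factor
    [(y / r)^alpha / r] times the [r / y] coming from [w] leaves [y^alpha / y] and the [r^-alpha] in
    [Hk]. *)
Let adjoint_flux s y :
  Qe q (fun r => (r^-1)%:E * ((y / r) `^ alpha)%:E * P (y / r)%R s *
    (if (0 < r)%R then 1 else 0)) 1%R = V y s.
Proof.
have [s0|s0] := ltP s 0%R.
  rewrite /V /flow leNgt s0/= !mule0 -[RHS](Qe_cst hq 1%R (lexx 0)).
  by apply: (eq_Qe hq) => r _; rewrite /P leNgt s0/= !(mule0, mul0e).
have [y0|y0] := ltP 0%R y; last first.
  rewrite /V /w /invp ltNge y0/= mul0e -[RHS](Qe_cst hq 1%R (lexx 0)).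
  apply: (eq_Qe hq) => r /andP[r0 _]; rewrite mulr1 /P /Pd s0 /w /invp.
  by rewrite pmulr_lgt0 ?invr_gt0// ltNge y0/= !(mule0, mul0e).
rewrite /V /flow s0 HkE; set m := (y `^ alpha)%:E.
transitivity ((w y)%:E * (c^-1)%:E * m * Qe q
    (fun r => ((r `^ alpha)^-1)%:E * k ((1 + s) * y `^ alpha / r `^ alpha)%R) 1%R); last by rewrite !muleA.
rewrite /Qe -ge0_integralZl//; last 3 first.
- by meas.
- by move=> r _; rewrite !mule_ge0// lee_fin invr_ge0 powR_ge0.
- by apply: mule_ge0; [rewrite mule_ge0|exact: lamE0].
apply: eq_integral => r _; have [/andP[r0 r1]|r01] := boolP (0 < r < 1)%R; last first.
  by case: hq => _ _ qs _; rewrite qs// !mul0e mule0.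
have [r0' y0'] := (ltW r0, ltW y0).
rewrite mulr1 r0 mule1 /P /Pd s0 /w /invp divr_gt0// y0 /m.
have -> : ((y / r) `^ alpha = y `^ alpha / r `^ alpha)%R.
  by rewrite powRM ?invr_ge0// -(powR_inv1 r0') -powRrM mulN1r powRN.
rewrite mulrA -(fineK (kfin _)) -!EFinM; congr (_%:E).
by field; rewrite !gt_eqF ?powR_gt0.
Qed.

Section invariance.
Variables (B : set R) (t : R).
Hypothesis mB : measurable B.
Hypothesis t0 : (0 <= t)%R.
Let g x s := Qe q (tr alpha h B s) x.
Let u x s := tr alpha h B s x.
Let g0 x s : 0 <= g x s. Proof. exact: Qtr_ge0. Qed.
Let u0 x s : 0 <= u x s. Proof. exact: tr_ge0. Qed.
Let mg : measurable_fun setT (fun p : R * R => g p.1 p.2).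
Proof.
by apply: (measurableT_comp (measurable_Qtr alpha hq mB) (g := fun p : R * R => (p.2, p.1))); meas.
Qed.
Let mu : measurable_fun setT (fun p : R * R => u p.1 p.2).
Proof.
by apply: (measurableT_comp (measurable_tr alpha hq mB) (g := fun p : R * R => (p.2, p.1))); meas.
Qed.
Let mgx x : measurable_fun setT (g x).
Proof. by apply: (measurableT_comp mg (g := fun s : R => (x, s))); meas. Qed.
Let mtr s : measurable_fun setT (tr alpha h B s). Proof. exact: measurable_tr2. Qed.

Let X := \int[leb]_x convol (P x) (fun s => (x `^ alpha)%:E * g x s) t.
Let X' := \int[leb]_x convol (V x) (u x) t.

(** Loss and gain balance over all states: at each time [s] the operator [Q] is moved to the other
    factor by [Qe_adjoint]. *)
Let XX' : X = X'.
Proof.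
rewrite /X /X'; under eq_integral do rewrite convolE.
under [RHS]eq_integral do rewrite convolE.
rewrite (ge0_tonelli (f := fun x s => P x s * ((x `^ alpha)%:E * g x (t - s)%R))); last 2 first.
- apply: emeasurable_funM => //; apply: emeasurable_funM; first by meas.
  by apply: (measurableT_comp mg (g := fun p : R * R => (p.1, t - p.2)%R)); meas.
- by move=> x s; rewrite !mule_ge0.
rewrite [RHS](ge0_tonelli (f := fun x s => V x s * u x (t - s)%R)); last 2 first.
- apply: emeasurable_funM => //.
  by apply: (measurableT_comp mu (g := fun p : R * R => (p.1, t - p.2)%R)); meas.
- by move=> x s; rewrite !mule_ge0.
apply: eq_integral => s _.
have mPs : measurable_fun setT (fun x => P x s).
  by apply: (measurableT_comp mP (g := fun x : R => (x, s))); meas.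
transitivity (\int[leb]_x ((x `^ alpha)%:E * P x s * Qe q (tr alpha h B (t - s)) x)).
  by apply: eq_integral => x _; rewrite muleA (muleC (P x s)).
rewrite (Qe_adjoint hq); last 4 first.
- by meas.
- exact: mtr.
- by move=> x; rewrite mule_ge0.
- by move=> x; exact: tr_ge0.
apply: eq_integral => y _; congr (_ * _).
rewrite -adjoint_flux; congr (Qe q _ 1%R); apply/funext => r.
by rewrite !muleA.
Qed.

(** The left side is the total outflow from [x] up to time [t]; the substitution
    [z = (1 + s) x^alpha] turns the time integral into an integral of [k]. *)
Let flux_shell x : (0 < x)%R -> convol (P x) (fun s => (x `^ alpha)%:E * Ex 0%R s) t =
  (w x)%:E * ((c^-1)%:E *
    \int[leb]_v (k v * (if (x `^ alpha <= v <= (1 + t) * x `^ alpha)%R then 1 else 0))).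
Proof.
move=> x0; have v0 : (0 < x `^ alpha)%R by rewrite powR_gt0.
have vn0 : (x `^ alpha)%R != 0%R by rewrite gt_eqF.
rewrite convolE; set v := (x `^ alpha)%R.
rewrite -(ge0_integral_affine v vn0 (f := fun z => k z * (if (v <= z <= (1 + t) * v)%R then 1 else 0))); last 2 first.
- by meas.
- by move=> z; rewrite mule_ge0.
rewrite gtr0_norm// !muleA -ge0_integralZl//; last 3 first.
- by meas.
- by move=> z _; rewrite mule_ge0.
- by rewrite !mule_ge0// lee_fin ltW.
apply: eq_integral => s _; rewrite /P /Pd -/v.
have [s0|s0] := leP 0%R s; last first.
  by rewrite mul0e lerDr pmulr_rge0// leNgt s0/= !mule0.
rewrite lerDr pmulr_rge0// s0/= [(v * s + v)%R](_ : _ = (1 + s) * v)%R; last by ring.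
rewrite ler_pM2r// lerD2l -subr_ge0; case: leP => ts; last by rewrite Ex_lt0 ?mule0.
by rewrite Ex0E// !mule1 -(fineK (kfin _)) -!EFinM; congr (_%:E); ring.
Qed.

(** [X] is at most the total outflow, the expected number of jumps up to [t]. For fixed [v] the [x]
    with [x^alpha <= v <= (1 + t) x^alpha] form an interval of logarithmic length
    [ln (1 + t) / alpha], so Tonelli gives a multiple of the mass of [k]. *)
Let X_lty : X < +oo.
Proof.
(* The [ln 2] pays for enlarging the closed interval [[b / a, b]] to [[b / a, 2 b)], the half-open
   form measured by [integral_invp]. *)
pose K := (ln 2 + alpha^-1 * ln (1 + t))%R.
have K0 : (0 <= K)%R.
  rewrite /K addr_ge0 ?ln_ge0 ?ler1n// mulr_ge0 ?invr_ge0 ?(ltW alpha0)//.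
  by rewrite ln_ge0// lerDl.
have t1 : (0 < 1 + t)%R by rewrite ltr_wpDr.
pose I x v : \bar R := if (x `^ alpha <= v <= (1 + t) * x `^ alpha)%R then 1 else 0.
have mI : measurable_fun setT (fun p : R * R => I p.1 p.2) by rewrite /I; meas.
have mIx x : measurable_fun setT (I x) by rewrite /I; meas.
have mIv v : measurable_fun setT (I ^~ v) by rewrite /I; meas.
have I0 x v : 0 <= I x v by rewrite /I.
have Z0 x : 0 <= (w x)%:E * ((c^-1)%:E * \int[leb]_v (k v * I x v)).
  by rewrite !mule_ge0// integral_ge0// => v _; rewrite mule_ge0.
have mkI : measurable_fun setT (fun x => \int[leb]_v (k v * I x v)).
  apply: (@measurable_parametric_integral _ R _ (fun x v => k v * I x v)).
    by apply: emeasurable_funM => //; meas.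
  by move=> x v; rewrite mule_ge0.
apply: (@le_lt_trans _ _ (\int[leb]_x ((w x)%:E * ((c^-1)%:E * \int[leb]_v (k v * I x v))))).
  apply: ge0_le_integral => //.
  - by move=> x _; apply: convol_ge0 => // s; rewrite mule_ge0.
  - have mc : measurable_fun setT (fun p : R * R =>
        convol (P p.1) (fun s => (p.1 `^ alpha)%:E * g p.1 s) p.2).
      apply: (@measurable_convol_param R _ R P (fun x s => (x `^ alpha)%:E * g x s)) => //.
        by apply: emeasurable_funM => //; meas.
      by move=> x s; rewrite mule_ge0.
    by apply: (measurableT_comp mc (g := fun x : R => (x, t))); meas.
  - by meas.
  - move=> x _; have [x0|x0] := ltP 0%R x; last first.
      rewrite (_ : P x = fun=> 0); last first.
        by apply/funext => s; rewrite /P /Pd /w /invp ltNge x0/= mul0e; case: ifP.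
      by rewrite convolE integral0_eq// => s _; rewrite mul0e.
    rewrite -flux_shell//; apply: le_convol => //.
    + by have := mgx x => mg'; meas.
    + by have := mExp 0%R => m0; meas.
    + by move=> s; rewrite mule_ge0.
    + move=> s; rewrite lee_wpmul2l// /g.
      rewrite -(Qe_cst hq x (Ex_ge0 0%R s)); apply: (le_Qe hq) => //.
      * by move=> y; exact: tr_ge0.
      * by move=> y; exact: Ex_ge0.
      * by move=> r _; exact: tr_le.
under eq_integral do rewrite muleCA.
rewrite ge0_integralZl//; last 2 first.
- by meas.
- by move=> x _; rewrite mule_ge0// integral_ge0// => v _; rewrite mule_ge0.
apply: lte_mul_pinfty => //.
apply: (@le_lt_trans _ _ ((\int[leb]_v k v) * K%:E)); last first.
  by apply: lte_mul_pinfty; [exact: ltW|rewrite ge0_fin_numE// ltW|exact: ltry].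
have -> : \int[leb]_x ((w x)%:E * \int[leb]_v (k v * I x v)) =
    \int[leb]_x \int[leb]_v ((w x)%:E * (k v * I x v)).
  apply: eq_integral => x _; rewrite ge0_integralZl//; last by move=> v _; rewrite mule_ge0.
  by have := mIx x => mI'; meas.
rewrite (ge0_tonelli (f := fun x v => (w x)%:E * (k v * I x v))); last 2 first.
- by apply: emeasurable_funM; [meas|apply: emeasurable_funM => //; meas].
- by move=> x v; rewrite !mule_ge0.
rewrite -ge0_integralZr ?lee_fin//.
apply: ge0_le_integral => //.
- by move=> v _; apply: integral_ge0 => x _; rewrite !mule_ge0.
- apply: (@measurable_parametric_integral _ R _ (fun v x => (w x)%:E * (k v * I x v))).
    apply: emeasurable_funM; first by meas.
    apply: emeasurable_funM; first by meas.
    by apply: (measurableT_comp mI (g := fun p : R * R => (p.2, p.1))); meas.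
  by move=> x v; rewrite !mule_ge0.
- by apply: emeasurable_funM => //; meas.
move=> v _; under eq_integral do rewrite muleCA.
have mIv' := mIv v.
rewrite ge0_integralZl//; last 2 first.
- by meas.
- by move=> x _; rewrite mule_ge0.
have [v0|v0] := ltP 0%R v; last by rewrite k_le0// !mul0e.
rewrite lee_wpmul2l//.
pose b : R := (v `^ (alpha^-1))%R; pose a : R := ((1 + t) `^ (alpha^-1))%R.
have b0 : (0 < b)%R by rewrite powR_gt0.
have a0 : (0 < a)%R by rewrite powR_gt0.
have vb : v = (b `^ alpha)%R by rewrite /b -powRrM mulVf ?gt_eqF// powRr1// ltW.
have ta : (1 + t = a `^ alpha)%R by rewrite /a -powRrM mulVf ?gt_eqF// powRr1// ltW.
have a1 : (1 <= a)%R.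
  have : (1 `^ (alpha^-1) <= a)%R.
    by apply: ge0_ler_powR; rewrite ?invr_ge0 ?nnegrE ?(ltW alpha0) ?(ltW t1)// lerDl.
  by rewrite powR1.
have ba0 : (0 < b / a)%R by rewrite divr_gt0.
have bab : (b / a <= 2 * b)%R.
  rewrite ler_pdivrMr// mulrAC ler_peMl ?(ltW b0)// (le_trans a1)//.
  by rewrite ler_peMl ?ler1n ?(ltW a0).
have -> : K%:E = (ln (2 * b) - ln (b / a))%:E.
  congr (_%:E); rewrite /K lnM ?posrE// ln_div ?posrE//.
  have -> : ln a = (alpha^-1 * ln (1 + t))%R by rewrite /a ln_powR.
  by ring.
rewrite -(integral_invp ba0 bab); apply: ge0_le_integral => //.
- by move=> x _; rewrite mule_ge0.
- by meas.
- by meas.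
move=> x _; rewrite -/w /w /invp; case: ifPn => x0; last by rewrite !mul0e.
rewrite lee_wpmul2l ?lee_fin ?invr_ge0 ?(ltW x0)//.
rewrite /I vb ta -powRM ?(ltW a0) ?(ltW x0)// !powR_le_mono ?mulr_ge0 ?(ltW a0) ?(ltW b0) ?(ltW x0)//.
case: ifPn => [/andP[xb bx]|_]; last by case: ifP.
by rewrite ifT// ler_pdivrMr// (mulrC x) bx/= (le_lt_trans xb)// ltr_pMl// ltr1n.
Qed.

(** Integrate [forward_backward_pairing] over [x], with [w] the transition probability: the
    convolution terms integrate to [X] and [X'], equal and finite, and cancel. *)
Let invariance : \int[leb]_x (Pd 0%R x * tr alpha h B t x) =
  \int[leb]_x (Pd t x * (\1_B x)%:E).
Proof.
have X0 : 0 <= X.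
  by apply: integral_ge0 => x _; apply: convol_ge0 => // s; rewrite mule_ge0.
have X_fin : X \is a fin_num by rewrite ge0_fin_numE.
apply: (ereal_addIr X_fin).
have mtrt := mtr t.
have mPd s : measurable_fun setT (Pd s) by rewrite /Pd; meas.
have mPd0 := mPd 0%R; have mPdt := mPd t.
have mcP : measurable_fun setT (fun x => convol (P x) (fun s => (x `^ alpha)%:E * g x s) t).
  have mc : measurable_fun setT (fun p : R * R =>
      convol (P p.1) (fun s => (p.1 `^ alpha)%:E * g p.1 s) p.2).
    apply: (@measurable_convol_param R _ R P (fun x s => (x `^ alpha)%:E * g x s)) => //.
      by apply: emeasurable_funM => //; meas.
    by move=> x s; rewrite mule_ge0.
  by apply: (measurableT_comp mc (g := fun x : R => (x, t))); meas.
have mcV : measurable_fun setT (fun x => convol (V x) (u x) t).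
  have mc := @measurable_convol_param R _ R V u mV mu V_ge0 u0.
  by apply: (measurableT_comp mc (g := fun x : R => (x, t))); meas.
rewrite {1}XX' -ge0_integralD//; last 3 first.
- by move=> x _; rewrite mule_ge0// tr_ge0.
- by meas.
- by move=> x _; exact: convol_ge0.
rewrite -[RHS]ge0_integralD//; last 3 first.
- by move=> x _; rewrite mule_ge0// lee_fin.
- by meas.
- by move=> x _; apply: convol_ge0 => // s; rewrite mule_ge0.
apply: eq_integral => x _.
rewrite -(@forward_backward_pairing _ (x `^ alpha)%R (Pd 0%R x) (\1_B x)%:E
  (P x) (V x) (g x) (u x)) ?powR_ge0 ?lee_fin//.
- by rewrite addeC muleC /P t0.
- by apply/funext => s; exact: backward_equation.
Qed.

Lemma us_profile_law : B `<=` @pos_half R ->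
  \int[leb]_(x in B) (self_sim alpha us_profile t x * x)%:E =
  \int[leb]_(x in @pos_half R) ((us_profile x * x)%:E * trans alpha h t x B).
Proof.
move=> BP; rewrite integral_mdens integral_mdensS//.
transitivity (\int[leb]_x (Pd t x * (\1_B x)%:E)).
  by apply: eq_integral => x _; rewrite mdens_self_sim.
rewrite -invariance; apply: eq_integral => x _.
by rewrite mdens_us /tr t0.
Qed.

End invariance.

Lemma us_profile_solution : is_solution alpha h us_profile (self_sim alpha us_profile).
Proof.
move=> t t0; split; first exact: Dm_self_sim Dm_us_profile t0.
by move=> B mB BP; apply: us_profile_law.
Qed.

End self_similar_solution.

(** * Expectations of bounded measurable functions *)

Definition bmf (R : realType) (f : R -> R) :=
  measurable_fun setT f /\ exists M : R, forall x, (`|f x| <= M)%R.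

(** Real-valued expectation over [theta], used where differences, squares and limits of signed
    functions occur. *)
Definition EE (R : realType) (q f : R -> R) : R :=
  (\int[leb]_r (q r * f r))%R.

Section jump_expectation.
Variables (R : realType) (q : R -> R).
Hypothesis hq : jump_density q.
Let mq : measurable_fun setT q. Proof. by case: hq. Qed.
Let q0 r : (0 <= q r)%R. Proof. by case: hq. Qed.
Implicit Types f g : R -> R.

Lemma integrable_jump : leb.-integrable setT (EFin \o q).
Proof.
apply/integrableP; split; first exact/measurable_EFinP.
case: hq => _ _ _ q1; under eq_integral do rewrite /= ger0_norm//.
by rewrite q1 ltry.
Qed.

Lemma EE_integrable f : bmf f -> leb.-integrable setT (EFin \o (fun r => q r * f r)%R).
Proof.
move=> [mf [M fM]].
have iM : leb.-integrable setT (fun r => M%:E * (q r)%:E).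
  by apply: integrableZl => //; exact: integrable_jump.
apply: (le_integrable measurableT _ _ iM).
- by apply/measurable_EFinP; exact: measurable_funM.
- move=> r _ /=; rewrite lee_fin !normrM (ger0_norm (q0 r)) mulrC.
  by rewrite ler_wpM2r// (le_trans (fM r))// ler_norm.
Qed.

Lemma EEE f : bmf f -> (EE q f)%:E = \int[leb]_r ((q r)%:E * (f r)%:E).
Proof.
move=> bf; rewrite /EE /Rintegral fineK.
  by apply: eq_integral => r _; rewrite EFinM.
exact: (integrable_fin_num measurableT (EE_integrable bf)).
Qed.

Lemma EED f g : bmf f -> bmf g -> EE q (fun r => f r + g r)%R = (EE q f + EE q g)%R.
Proof.
move=> bf bg; rewrite /EE -RintegralD//; try exact: EE_integrable.
by apply: eq_Rintegral => r _; rewrite mulrDr.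
Qed.

Lemma EEZ c f : bmf f -> EE q (fun r => c * f r)%R = (c * EE q f)%R.
Proof.
move=> bf; rewrite /EE -RintegralZl//; last exact: EE_integrable.
by apply: eq_Rintegral => r _; rewrite mulrCA.
Qed.

Lemma bmfD f g : bmf f -> bmf g -> bmf (fun r => f r + g r)%R.
Proof.
move=> [mf [M fM]] [mg [N gN]]; split; first exact: measurable_funD.
by exists (M + N)%R => x; rewrite (le_trans (ler_normD _ _))// lerD.
Qed.

Lemma bmfZ c f : bmf f -> bmf (fun r => c * f r)%R.
Proof.
move=> [mf [M fM]]; split; first exact: measurable_funM.
by exists (`|c| * M)%R => x; rewrite normrM ler_wpM2l.
Qed.

Lemma bmfM f g : bmf f -> bmf g -> bmf (fun r => f r * g r)%R.
Proof.
move=> [mf [M fM]] [mg [N gN]]; split; first exact: measurable_funM.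
by exists (M * N)%R => x; rewrite normrM ler_pM.
Qed.

Lemma bmf_cst c : bmf (fun=> c : R).
Proof. by split; [exact: measurable_cst|exists `|c|%R]. Qed.

Lemma bmfN f : bmf f -> bmf (fun r => - f r)%R.
Proof.
move=> [mf [M fM]]; split; first exact: measurable_funN.
by exists M => x; rewrite normrN.
Qed.

Lemma bmf_dilate f x : bmf f -> bmf (fun r => f (r * x)%R).
Proof.
move=> [mf [M fM]]; split; last by exists M.
by meas.
Qed.

Lemma EE_cst c : EE q (fun=> c) = c.
Proof.
apply: EFin_inj; rewrite EEE; last exact: bmf_cst.
case: hq => _ _ _ q1; rewrite -[RHS]mul1e -q1 muleC.
under eq_integral do rewrite muleC.
by rewrite integralZl//; exact: integrable_jump.
Qed.

Lemma le_EE f g : bmf f -> bmf g ->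
  (forall r, (0 < r < 1)%R -> (f r <= g r)%R) -> (EE q f <= EE q g)%R.
Proof.
move=> bf bg fg; rewrite /EE le_Rintegral//; try exact: EE_integrable.
move=> r _; case: hq => _ _ qs _.
have [r01|r01] := boolP (0 < r < 1)%R; last by rewrite qs// !mul0r.
by rewrite ler_wpM2l// fg.
Qed.

Lemma eq_EE f g : (forall r, (0 < r < 1)%R -> f r = g r) -> EE q f = EE q g.
Proof.
move=> fg; apply: eq_Rintegral => r _; case: hq => _ _ qs _.
have [r01|r01] := boolP (0 < r < 1)%R; last by rewrite qs// !mul0r.
by rewrite fg.
Qed.

Lemma EE_bound f (a b : R) : bmf f -> (forall r, (0 < r < 1)%R -> (a <= f r <= b)%R) ->
  (a <= EE q f <= b)%R.
Proof.
move=> bf fab; apply/andP; split; [rewrite -(EE_cst a)|rewrite -[leRHS](EE_cst b)].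
- by apply: le_EE => //; [exact: bmf_cst|move=> r /fab/andP[]].
- by apply: le_EE => //; [exact: bmf_cst|move=> r /fab/andP[]].
Qed.

Lemma EE_norm_le f M : bmf f -> (forall r, (0 < r < 1)%R -> `|f r| <= M)%R -> (`|EE q f| <= M)%R.
Proof.
move=> bf fM; rewrite ler_norml; apply: EE_bound => // r /fM.
by rewrite ler_norml.
Qed.

Lemma EE_param (F : R -> R -> R) (M : R) :
  measurable_fun setT (fun p : R * R => F p.1 p.2) ->
  (forall x r, `|F x r| <= M)%R ->
  bmf (fun x => EE q (F x)).
Proof.
move=> mF FM.
have bF x : bmf (F x).
  split; last by exists M.
  by apply: (measurableT_comp mF (g := fun r : R => (x, r))); meas.
split; last by exists M => x; exact: EE_norm_le.
have EFx x : EE q (F x) = (fine (\int[leb]_r ((q r)%:E * (F x r + M)%:E)) - M)%R.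
  rewrite -EEE/=; last by apply: bmfD => //; exact: bmf_cst.
  by rewrite EED//; [rewrite EE_cst addrK|exact: bmf_cst].
under eq_fun do rewrite EFx.
apply: measurable_funB => //.
apply: (measurableT_comp (@fine_measurable _ _ measurableT)).
apply: (@measurable_parametric_integral _ R _ (fun x r => (q r)%:E * (F x r + M)%:E)).
  apply: emeasurable_funM; first by meas.
  by apply/measurable_EFinP; apply: measurable_funD.
move=> x r; rewrite mule_ge0 ?lee_fin//; have := FM x r.
by rewrite ler_norml => /andP[]; lra.
Qed.

(** Adding the constant [M] makes the integrand nonnegative, so Tonelli applies; the constant drops
    out afterwards. *)
Lemma EE_fubini (F : R -> R -> R) (M : R) :
  measurable_fun setT (fun p : R * R => F p.1 p.2) ->
  (forall x r, `|F x r| <= M)%R ->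
  EE q (fun s => EE q (fun r => F s r)) = EE q (fun r => EE q (fun s => F s r)).
Proof.
move=> mF FM.
have mF' : measurable_fun setT (fun p : R * R => F p.2 p.1).
  by apply: (measurableT_comp mF (g := fun p : R * R => (p.2, p.1))); meas.
have b1 x : bmf (F x).
  split; last by exists M.
  by apply: (measurableT_comp mF (g := fun r : R => (x, r))); meas.
have b2 x : bmf (F ^~ x).
  split; last by exists M.
  by apply: (measurableT_comp mF (g := fun r : R => (r, x))); meas.
pose F1 s r := (F s r + M)%R.
have F10 s r : 0 <= (F1 s r)%:E.
  by rewrite lee_fin; have := FM s r; rewrite ler_norml => /andP[]; rewrite /F1; lra.
have F1M s r : (`|F1 s r| <= M + M)%R.
  rewrite (le_trans (ler_normD _ _))// lerD// ger0_norm//.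
  by rewrite (le_trans _ (FM 0%R 0%R)).
have mF1 : measurable_fun setT (fun p : R * R => F1 p.1 p.2) by exact: measurable_funD.
have bc := bmf_cst M.
have qE0 r : 0 <= (q r)%:E by rewrite lee_fin.
have bF1 s : bmf (F1 s) by exact: bmfD.
have bF2 s : bmf (F1 ^~ s) by exact: bmfD.
have bG1 : bmf (fun s => EE q (F1 s)) by exact: (EE_param mF1 F1M).
have bG2 : bmf (fun r => EE q (F1 ^~ r)).
  apply: (@EE_param (fun r s => F1 s r) (M + M)%R) => //.
  by apply: (measurableT_comp mF1 (g := fun p : R * R => (p.2, p.1))); meas.
have bH1 : bmf (fun s => EE q (F s)) by exact: (EE_param mF FM).
have bH2 : bmf (fun r => EE q (F ^~ r)) by exact: (@EE_param (fun r s => F s r) M).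
have H1 : (fun s => EE q (F1 s)) = (fun s => EE q (F s) + M)%R.
  by apply/funext => s; rewrite /F1 EED// EE_cst.
have H2 : (fun r => EE q (F1 ^~ r)) = (fun r => EE q (F ^~ r) + M)%R.
  by apply/funext => r; rewrite /F1 (EED (b2 r) bc) EE_cst.
suff : EE q (fun s => EE q (F1 s)) = EE q (fun r => EE q (F1 ^~ r)).
  by rewrite H1 H2 !EED// => /addIr.
apply: EFin_inj; rewrite !EEE//.
transitivity (\int[leb]_s \int[leb]_r ((q s)%:E * ((q r)%:E * (F1 s r)%:E))).
  apply: eq_integral => s _; rewrite EEE// ge0_integralZl ?lee_fin//.
  - apply: emeasurable_funM; first by meas.
    by apply/measurable_EFinP; case: (bF1 s).
  - by move=> r _; rewrite mule_ge0.
rewrite (ge0_tonelli (f := fun s r => (q s)%:E * ((q r)%:E * (F1 s r)%:E))); last 2 first.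
- apply: emeasurable_funM; first by meas.
  by apply: emeasurable_funM; [meas|exact/measurable_EFinP].
- by move=> s r; rewrite !mule_ge0.
apply: eq_integral => r _; rewrite EEE//; under eq_integral do rewrite muleCA.
rewrite ge0_integralZl ?lee_fin//.
- apply: emeasurable_funM; first by meas.
  by apply/measurable_EFinP; case: (bF2 r).
- by move=> s _; rewrite mule_ge0.
Qed.

Lemma EE_cvg0 (f : nat -> R -> R) (M : R) : (forall n, measurable_fun setT (f n)) ->
  (forall n r, `|f n r| <= M)%R ->
  (forall r, (0 < r < 1)%R -> f n r @[n --> \oo] --> (0 : R)%R) ->
  EE q (f n) @[n --> \oo] --> (0 : R)%R.
Proof.
move=> mf fM fc.
have M0 : (0 <= M)%R by rewrite (le_trans _ (fM 0%N 0%R)).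
have bf n : bmf (f n) by split => //; exists M.
suff : \int[leb]_r (q r * f n r)%:E @[n --> \oo] --> (0%R : R)%:E.
  by move=> /fine_cvgP[].
have -> : (0%R : R)%:E = \int[leb]_(r in [set: R]) (cst 0) r by rewrite integral0.
apply: (@dominated_cvg _ _ R leb setT measurableT
  (fun n r => (q r * f n r)%:E) (fun=> 0) (fun r => (M * q r)%:E)).
- by move=> n; have mfn := mf n; meas.
- move=> r _; case: (hq) => _ _ qs _.
  have [r01|r01] := boolP (0 < r < 1)%R; last first.
    by rewrite qs//; under eq_fun do rewrite mul0r; exact: cvg_cst.
  apply: cvg_EFin; first exact: nearW.
  rewrite -[X in _ --> X](mulr0 (q r)).
  by apply: cvgM; [exact: cvg_cst|exact: fc].
- by [].
- under eq_fun do rewrite EFinM.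
  by apply: integrableZl => //; exact: integrable_jump.
- move=> n r _ /=; rewrite lee_fin normrM (ger0_norm (q0 r)) mulrC.
  by rewrite ler_wpM2r.
Qed.

End jump_expectation.

(** * Variance of jumps for asymptotically harmonic sequences *)

Definition QR (R : realType) (q f : R -> R) (x : R) : R := EE q (fun r => f (r * x)%R).

(** The class of error terms; the uniform bound makes it stable under [Q], by dominated
    convergence. *)
Definition vanishing (R : realType) (a : nat -> R -> R) :=
  [/\ forall n, measurable_fun setT (a n),
      exists M : R, forall n x, (`|a n x| <= M)%R &
      forall x, (0 < x)%R -> a n x @[n --> \oo] --> (0 : R)%R].

(** With [D = w1 - w0] and [e = D - (Q1 - Q0)], the difference of the squares is [2 D e - e^2]. The
    two products in the proof add up to [D e <= a0 + a1], using [|D| <= 1] and [|e| <= a0 + a1]. *)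
Lemma sqr_perturbation (R : realType) (Q0 Q1 w0 w1 a0 a1 : R) :
  (0 <= w0 <= 1)%R -> (0 <= w1 <= 1)%R ->
  (`|w0 - Q0| <= a0)%R -> (`|w1 - Q1| <= a1)%R ->
  ((w1 - w0) ^+ 2 <= (Q1 - Q0) ^+ 2 + (2 * a1 + 2 * a0))%R.
Proof.
move=> /andP[? ?] /andP[? ?]; rewrite !ler_norml => /andP[? ?] /andP[? ?].
have : (0 <= (1 - (w1 - w0)) * (a0 + a1 + ((w1 - Q1) - (w0 - Q0))))%R.
  by rewrite mulr_ge0//; lra.
have : (0 <= (1 + (w1 - w0)) * (a0 + a1 - ((w1 - Q1) - (w0 - Q0))))%R.
  by rewrite mulr_ge0//; lra.
have := sqr_ge0 ((w1 - Q1) - (w0 - Q0))%R.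
rewrite !expr2; nra.
Qed.

(* Raugi's variance argument for the Choquet-Deny theorem, for sequences of functions
   that are asymptotically harmonic. *)
Section asymptotic_choquet_deny.
Variables (R : realType) (q : R -> R).
Hypothesis hq : jump_density q.

Lemma bmf_QR f : bmf f -> bmf (QR q f).
Proof.
move=> [mf [M fM]]; apply: (EE_param hq (F := fun x r => f (r * x)%R) (M := M)) => //.
by meas.
Qed.

Lemma vanishingD a b : vanishing a -> vanishing b ->
  vanishing (fun n x => a n x + b n x : R)%R.
Proof.
move=> [ma [M aM] ca] [mb [N bN] cb]; split.
- by move=> n; exact: measurable_funD.
- by exists (M + N)%R => n x; rewrite (le_trans (ler_normD _ _))// lerD.
- move=> x x0; rewrite -[X in _ --> X](addr0 (0%R : R)).
  by apply: cvgD; [exact: ca|exact: cb].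
Qed.

Lemma vanishingZ (k : R) a : vanishing a -> vanishing (fun n x => k * a n x : R)%R.
Proof.
move=> [ma [M aM] ca]; split.
- by move=> n; exact: measurable_funM.
- by exists (`|k| * M)%R => n x; rewrite normrM ler_wpM2l.
- move=> x x0; rewrite -[X in _ --> X](mulr0 (k : R)).
  by apply: cvgM; [exact: cvg_cst|exact: ca].
Qed.

Lemma vanishingQ a : vanishing a -> vanishing (fun n => QR q (a n)).
Proof.
move=> [ma [M aM] ca].
have ba n : bmf (a n) by split => //; exists M.
split.
- by move=> n; case: (bmf_QR (ba n)).
- exists M => n x; apply: (EE_norm_le hq) => //.
  exact: bmf_dilate.
- move=> x x0; apply: (EE_cvg0 hq (M := M)).
  + by move=> n; case: (bmf_dilate x (ba n)).
  + by [].
  + by move=> r /andP[r0 _]; apply: ca; rewrite mulr_gt0.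
Qed.

Variable w : nat -> R -> R.
Hypothesis mw : forall n, measurable_fun setT (w n).
Hypothesis w01 : forall n x, (0 <= w n x <= 1)%R.
Hypothesis wharm : forall x, (0 < x)%R -> (w n x - QR q (w n) x)%R @[n --> \oo] --> (0 : R)%R.

Let bw n : bmf (w n).
Proof. by split => //; exists 1%R => x; case/andP: (w01 n x) => w0 w1; rewrite ger0_norm. Qed.

Let a n x : R := `|w n x - QR q (w n) x|%R.

Let QR01 f x : bmf f -> (forall y, 0 <= f y <= 1)%R -> (0 <= QR q f x <= 1)%R.
Proof. by move=> bf f01; apply: (EE_bound hq) => //; exact: bmf_dilate. Qed.

Let a01 n x : (0 <= a n x <= 1)%R.
Proof.
rewrite /a normr_ge0/= ler_norml; have := w01 n x; have := QR01 x (bw n) (w01 n).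
by move=> /andP[? ?] /andP[? ?]; apply/andP; split; lra.
Qed.

Let va : vanishing a.
Proof.
split.
- move=> n; apply: measurableT_comp => //; apply: measurable_funB => //.
  by case: (bmf_QR (bw n)).
- by exists 1%R => n x; case/andP: (a01 n x) => a0 a1; rewrite ger0_norm.
- by move=> x x0; apply/norm_cvg0P; exact: wharm.
Qed.

Let ba n : bmf (a n).
Proof. by case: va => ma [M aM] _; split => //; exists M. Qed.

Definition jump_variance n x := EE q (fun r => (w n (r * x) - w n x) ^+ 2)%R.
Let G := jump_variance.

Let d01 n x y : (0 <= (w n x - w n y) ^+ 2 <= 1)%R.
Proof.
rewrite sqr_ge0/=; move: (w01 n x) (w01 n y) => /andP[+ +] /andP[+ +].
move: (w n x) (w n y) => u v *; rewrite -subr_ge0.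
have -> : (1 - (u - v) ^+ 2 = (1 - (u - v)) * (1 + (u - v)))%R by ring.
by rewrite mulr_ge0//; lra.
Qed.

Let bd n x : bmf (fun r => (w n (r * x) - w n x) ^+ 2)%R.
Proof.
split; first by have := mw n => mwn; meas.
by exists 1%R => r; case/andP: (d01 n (r * x)%R x) => ? ?; rewrite ger0_norm.
Qed.

Let bG n : bmf (G n).
Proof.
apply: (EE_param hq (F := fun x r => ((w n (r * x) - w n x) ^+ 2)%R) (M := 1%R)).
  by have := mw n => mwn; meas.
by move=> x r; case/andP: (d01 n (r * x)%R x) => ? ?; rewrite ger0_norm.
Qed.

Lemma jump_variance_ge0 n x : (0 <= jump_variance n x)%R.
Proof. by have /andP[] := EE_bound hq (bd n x) (fun r _ => d01 n (r * x)%R x). Qed.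

Let bw2 n : bmf (fun y => w n y ^+ 2)%R.
Proof. by rewrite (_ : (fun y => _) = (fun y => w n y * w n y)%R)//; exact: bmfM. Qed.

(** Expand the square to [G = Q (w^2) - 2 w Q w + w^2] and replace [Q w] by [w] at a cost of [2 a],
    since [0 <= w <= 1]. *)
Let G_le n x : (G n x + w n x ^+ 2 <= QR q (fun y => w n y ^+ 2) x + 2 * a n x)%R.
Proof.
have b1 := bmf_dilate x (bw2 n); have b2 := bmf_dilate x (bw n).
have b3 := bmfZ (- 2 * w n x)%R b2; have b4 := bmf_cst (w n x ^+ 2)%R.
have -> : G n x = (QR q (fun y => w n y ^+ 2) x - 2 * w n x * QR q (w n) x + w n x ^+ 2)%R.
  transitivity (EE q (fun r => w n (r * x) ^+ 2 + (- 2 * w n x * w n (r * x) + w n x ^+ 2))%R).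
    by apply: (eq_EE hq) => r _; ring.
  rewrite (EED hq b1 (bmfD b3 b4)) (EED hq b3 b4) (EEZ hq _ b2) (EE_cst hq) /QR; ring.
have := w01 n x => /andP[w0 w1].
have : (w n x - QR q (w n) x <= a n x)%R by exact: ler_norm.
have := a01 n x => /andP[A0 _]; nra.
Qed.

(** Dilations commute: after Fubini the inner expectation averages the square of
    [w(s (r x)) - w(s x)] over [s]. By Jensen it dominates the square of [Q w(r x) - Q w(x)], which
    is close to that of [w(r x) - w(x)] up to the errors [a]. *)
Let QG_ge n x : (G n x <= QR q (G n) x + (2 * QR q (a n) x + 2 * a n x))%R.
Proof.
have mwn := mw n.
have -> : QR q (G n) x = EE q (fun r => EE q (fun s => (w n (r * (s * x)) - w n (s * x)) ^+ 2)%R).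
  rewrite /QR /G /jump_variance.
  rewrite -(EE_fubini hq (F := fun s r => ((w n (r * (s * x)) - w n (s * x)) ^+ 2)%R) (M := 1%R))//.
  - by meas.
  - by move=> s r; case/andP: (d01 n (r * (s * x))%R (s * x)%R) => ? ?; rewrite ger0_norm.
have bJ : bmf (fun r => EE q (fun s => (w n (r * (s * x)) - w n (s * x)) ^+ 2)%R).
  apply: (EE_param hq (F := fun r s => ((w n (r * (s * x)) - w n (s * x)) ^+ 2)%R) (M := 1%R)).
    by meas.
  by move=> s r; case/andP: (d01 n (s * (r * x))%R (r * x)%R) => ? ?; rewrite ger0_norm.
have bax := bmf_dilate x (ba n).
have b1 := bmfZ 2%R bax; have b2 := bmf_cst (2 * a n x)%R.
rewrite /QR -(EEZ hq 2%R bax) -[X in (_ + (_ + X))%R](EE_cst hq (2 * a n x)%R).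
rewrite -(EED hq b1 b2) -(EED hq bJ (bmfD b1 b2)).
apply: (le_EE hq); [exact: bd|by apply: bmfD => //; exact: bmfD|move=> r r01].
set m := (QR q (w n) (r * x) - QR q (w n) x)%R.
have bD : bmf (fun s => w n (s * (r * x)) - w n (s * x))%R.
  by apply: bmfD; [exact: bmf_dilate|apply: bmfN; exact: bmf_dilate].
have mE : m = EE q (fun s => w n (s * (r * x)) - w n (s * x))%R.
  rewrite /m /QR (EED hq); [|exact: bmf_dilate|by apply: bmfN; exact: bmf_dilate].
  congr (_ + _)%R; rewrite -mulN1r -(EEZ hq); last exact: bmf_dilate.
  by apply: (eq_EE hq) => s _; rewrite mulN1r.
have J : (m ^+ 2 <= EE q (fun s => (w n (r * (s * x)) - w n (s * x)) ^+ 2)%R)%R.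
  have bm := bmfZ (2 * m)%R bD; have bmc := bmf_cst (- m ^+ 2)%R.
  (* Jensen by the tangent inequality [2 m v - m^2 <= v^2], integrated. *)
  have -> : (m ^+ 2 = EE q (fun s => 2 * m * (w n (s * (r * x)) - w n (s * x)) + - m ^+ 2))%R.
    by rewrite (EED hq)// (EEZ hq)// -mE (EE_cst hq); ring.
  apply: (le_EE hq); first exact: bmfD.
    split; first by meas.
    by exists 1%R => s; case/andP: (d01 n (r * (s * x))%R (s * x)%R) => ? ?; rewrite ger0_norm.
  move=> s _; rewrite (mulrCA r s x) -subr_ge0.
  by rewrite [X in (0 <= X)%R](_ : _ = (w n (s * (r * x)) - w n (s * x) - m) ^+ 2)%R ?sqr_ge0//; ring.
apply: le_trans (lerD J (lexx _)).
have : (`|w n (r * x) - QR q (w n) (r * x)| <= a n (r * x))%R by [].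
have : (`|w n x - QR q (w n) x| <= a n x)%R by [].
by move=> h0 h1; exact: sqr_perturbation.
Qed.

(* Summing the increments of the submartingale [w^2] along [N] jumps. *)
Let variance_sum N : exists T b : nat -> R -> R,
  [/\ forall n, bmf (T n), forall n x, (0 <= T n x <= 1)%R, vanishing b &
  forall n x, (N%:R * G n x + w n x ^+ 2 <= T n x + b n x)%R].
Proof.
elim: N => [|N [T [b [bT T01 vb H]]]].
  exists (fun n x => w n x ^+ 2)%R, (fun _ _ => 0%R); split => //.
  - by move=> n x; rewrite sqr_ge0 exprn_ile1//; case/andP: (w01 n x).
  - split => //; first by exists 0%R => n x; rewrite normr0.
    by move=> x _; exact: cvg_cst.
  - by move=> n x; rewrite mul0r add0r addr0.
exists (fun n => QR q (T n)), (fun n x => QR q (b n) x +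
  (N%:R * (2 * QR q (a n) x + 2 * a n x) + 2 * a n x))%R; split.
- by move=> n; exact: bmf_QR.
- by move=> n x; exact: QR01.
- apply: vanishingD; first exact: vanishingQ.
  apply: vanishingD; last exact: vanishingZ.
  apply: vanishingZ; apply: vanishingD; apply: vanishingZ => //.
  exact: vanishingQ.
- move=> n x.
  have bb : bmf (b n) by case: vb => mb [M bM] _; split => //; exists M.
  have b1 := bmf_dilate x (bG n); have b2 := bmf_dilate x (bw2 n).
  have b3 := bmf_dilate x (bT n); have b4 := bmf_dilate x bb.
  have b5 := bmfZ N%:R b1.
  have QH : (N%:R * QR q (G n) x + QR q (fun y => w n y ^+ 2) x <=
      QR q (T n) x + QR q (b n) x)%R.
    rewrite /QR -(EEZ hq _ b1) -(EED hq b5 b2) -(EED hq b3 b4).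
    by apply: (le_EE hq); [exact: bmfD|exact: bmfD|move=> r _; exact: H].
  have NG : (N%:R * G n x <= N%:R * (QR q (G n) x + (2 * QR q (a n) x + 2 * a n x)))%R.
    by rewrite ler_wpM2l// QG_ge.
  rewrite mulrDr in NG.
  by have := G_le n x; rewrite -natr1 mulrDl mul1r; lra.
Qed.

Lemma jump_variance_cvg0 x : (0 < x)%R -> jump_variance n x @[n --> \oo] --> (0 : R)%R.
Proof.
move=> x0; apply/cvgrPdist_le => e e0.
(* The sum bound will give [(N + 1) G <= T + b <= 2] as soon as [|b| <= 1]. *)
have [N NE] : exists N : nat, (2 / e <= N.+1%:R)%R.
  exists (Num.trunc (2 / e)); apply: ltW; exact: truncnS_gt.
have [T [b [bT T01 vb H]]] := variance_sum N.+1.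
have [_ _ /(_ x x0)/cvgrPdist_le/(_ 1%R ltr01) bc] := vb.
apply: filterS bc => n; rewrite !sub0r !normrN (ger0_norm (jump_variance_ge0 n x)) => b1.
have := H n x; have /andP[_ T1] := T01 n x.
have := le_trans (ler_norm _) b1 => b1'.
have w2 := sqr_ge0 (w n x).
move=> HH; have G2 : (N.+1%:R * G n x <= 2)%R by lra.
have N0 : (0 < N.+1%:R :> R)%R by [].
rewrite -/(G n x) -(ler_pM2l N0) (le_trans G2)//.
by rewrite -ler_pdivrMr.
Qed.

End asymptotic_choquet_deny.

(** A multiplicative Steinhaus theorem. In a small ball of radius [r] at a density point [x0], the
    part [A] of [E] has measure at least [3 r / 2]. Both [A] and [rho A] lie in [J], of length at
    most [5 r / 2], while their measures add up to at least [3 r]; so they overlap. *)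
Lemma dilation_overlap (R : realType) (E : set R) : measurable E ->
  E `<=` [set x | (0 < x)%R] -> 0 < leb E ->
  exists2 rho0 : R, (1 < rho0)%R & forall rho : R, (1 <= rho <= rho0)%R ->
    0 < \int[leb]_z ((\1_E z)%:E * (\1_E (z / rho)%R)%:E).
Proof.
move=> mE Epos leb_gt0.
(* Without such a point [E] would lie in the exceptional null set of the density theorem. *)
have [x0 Ex0 dx0] : exists2 x, E x & leb (E `&` ball x r) * (leb (ball x r))^-1
    @[r --> 0^'+] --> (\1_E x)%:E.
  apply: contrapT => noex.
  have [N [mN N0 sN]] := lebesgue_density mE.
  have : leb E <= 0.
    rewrite -N0; apply: le_measure; rewrite ?inE//.
    by move=> x Ex; apply: sN => /= cx; apply: noex; exists x.
  by rewrite leNgt leb_gt0.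
have x0_gt0 : (0 < x0)%R by exact: Epos.
move: dx0; rewrite indicE mem_set//= => /fine_cvgP[ffin /cvgrPdist_lt fc].
have q4 : (0 < 4^-1 :> R)%R by rewrite invr_gt0.
near (0 : R)%R^'+ => r.
have r0 : (0 < r)%R by [].
have r_dist : (`|1 - fine (leb (E `&` ball x0 r) * (leb (ball x0 r))^-1)| < 4^-1)%R.
  by near: r; exact: (fc _ q4).
have mb : measurable (ball x0 r) by exact: measurable_ball.
pose A := E `&` ball x0 r.
have mA : measurable A by exact: measurableI.
have lball : leb (ball x0 r) = (r *+ 2)%:E by rewrite lebesgue_measure_ball// ltW.
have Afin : leb A \is a fin_num.
  rewrite ge0_fin_numE// (@le_lt_trans _ _ (leb (ball x0 r)))//.
    by apply: le_measure; rewrite ?inE//; exact: subIsetr.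
  by rewrite lball ltry.
pose a := fine (leb A).
have aE : leb A = a%:E by rewrite fineK.
have ha : (3 / 2 * r <= a)%R.
  move: r_dist; rewrite /= -/A aE lball inver mulrn_eq0/= gt_eqF// -EFinM /=.
  rewrite ltr_distlC => /andP[+ _]; rewrite ltr_pdivlMr ?mulrn_wgt0// -mulr_natr.
  by lra.
(* Chosen so that dilation moves the right end [x0 + r] by at most [r / 2]. *)
exists (1 + r / (2 * (x0 + r)))%R.
  by rewrite ltrDl divr_gt0// mulr_gt0// addr_gt0.
move=> rho /andP[rho1 rho2]; have rho_gt0 : (0 < rho)%R by exact: lt_le_trans rho1.
have rr : ((rho - 1) * (x0 + r) <= r / 2)%R.
  move: rho2; rewrite -lerBlDl ler_pdivlMr; last by rewrite mulr_gt0// addr_gt0.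
  by move=> ?; nra.
pose psi z : \bar R := (\1_A z)%:E.
have mpsi : measurable_fun setT psi by apply/measurable_EFinP; exact: measurable_indic.
have psi0 z : 0 <= psi z by rewrite lee_fin.
have I1 : \int[leb]_z psi z = a%:E by rewrite integral_indic// setIT.
have I2 : \int[leb]_z psi (z / rho)%R = (rho * a)%:E.
  have ir : (rho^-1 != 0)%R by rewrite invr_eq0 gt_eqF.
  rewrite EFinM -I1 -(ge0_integral_affine 0%R ir mpsi psi0) gtr0_norm ?invr_gt0//.
  rewrite muleA -EFinM divff ?gt_eqF// mul1e.
  by apply: eq_integral => z _; rewrite addr0 mulrC.
pose J : set R := `]x0 - r, rho * (x0 + r)[%classic%R.
have mJ : measurable J by exact: measurable_itv.
have lJ : leb J <= (5 / 2 * r)%:E.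
  rewrite lebesgue_measure_itv/=; case: ifP => _; rewrite -?EFinB lee_fin; last by lra.
  by nra.
apply: (@lt_le_trans _ _ (\int[leb]_z (psi z * psi (z / rho)%R))); last first.
  apply: ge0_le_integral => //.
  - by move=> z _; rewrite mule_ge0.
  - by meas.
  - by meas.
  - move=> z _; rewrite /psi -!EFinM lee_fin ler_pM// !indicE /A in_setI;
    by case: (_ \in E) => //=; case: (_ \in _).
have : a%:E + (rho * a)%:E <= leb J + \int[leb]_z (psi z * psi (z / rho)%R).
  rewrite -I1 -I2 -(setIT J) -integral_indic//.
  have mj : measurable_fun setT (fun z => (\1_J z)%:E : \bar R).
    by apply/measurable_EFinP; exact: measurable_indic.
  rewrite -ge0_integralD//; last by meas.
  rewrite -ge0_integralD//; last 2 first.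
  - by move=> z _; rewrite mule_ge0.
  - by meas.
  apply: ge0_le_integral => //.
  - by move=> z _; rewrite adde_ge0.
  - by meas.
  - by apply: emeasurable_funD => //; meas.
  move=> z _; rewrite /psi -!EFinM -!EFinD lee_fin !indicE.
  have AJ y : y \in A -> (x0 - r < y < x0 + r)%R /\ (0 < y)%R.
    by rewrite inE => -[/Epos/= y0]; rewrite ball_itv/= in_itv/=.
  have [zA|zA] := boolP (z \in A); have [zrA|zrA] := boolP ((z / rho)%R \in A) => /=.
  - by rewrite mulr1 lerD2r (_ : z \in J)// inE /J/= in_itv/=;
      case: (AJ _ zA) => /andP[? ?] ?; apply/andP; split => //; nra.
  - rewrite mulr0 (_ : z \in J) ?addr0// inE /J/= in_itv/=.
    by case: (AJ _ zA) => /andP[? ?] ?; apply/andP; split => //; nra.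
  - rewrite mul0r (_ : z \in J) ?addr0 ?add0r// inE /J/= in_itv/=.
    case: (AJ _ zrA); rewrite ltr_pdivlMr// ltr_pdivrMr// pmulr_lgt0 ?invr_gt0//.
    by move=> /andP[? ?] ?; apply/andP; split => //; nra.
  - by rewrite mul0r !addr0.
move=> H; rewrite ltNge; apply/negP => I_le0.
have : (a + rho * a)%:E <= (5 / 2 * r)%:E.
  by rewrite EFinD (le_trans H)// -[leRHS]adde0 leeD.
by rewrite lee_fin; nra.
Unshelve. all: by end_near. Qed.

(** * From vanishing jump variance to asymptotic constancy *)

Section asymptotic_constancy.
Variables (R : realType) (q : R -> R).
Hypothesis hq : jump_density q.
Variable w : nat -> R -> R.
Hypothesis mw : forall n, measurable_fun setT (w n).
Hypothesis w01 : forall n x, (0 <= w n x <= 1)%R.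
Hypothesis wharm : forall x, (0 < x)%R -> (w n x - QR q (w n) x)%R @[n --> \oo] --> (0 : R)%R.
Let mq : measurable_fun setT q. Proof. by case: hq. Qed.
Let q0 r : (0 <= q r)%R. Proof. by case: hq. Qed.
Let E : set R := [set r | (0 < q r)%R].

Let mE : measurable E.
Proof.
rewrite /E -[X in measurable X]setTI; have := mq measurableT.
move=> /(_ `]0%R, +oo[%classic (measurable_itv _)); congr (measurable (_ `&` _)).
by apply/seteqP; split => r /=; rewrite in_itv/= andbT.
Qed.

Let Epos : E `<=` [set x | (0 < x)%R].
Proof.
move=> r /=; rewrite /E/=; apply: contraTT => r0; case: hq => _ _ qs _.
by rewrite qs ?ltxx// negb_and r0.
Qed.

Let lebE : 0 < leb E.
Proof.
rewrite lt_neqAle measure_ge0 andbT; apply/negP => /eqP E0.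
have : \int[leb]_r (q r)%:E = 0.
  rewrite -[RHS](@integral0 _ _ _ leb setT).
  apply: ge0_ae_eq_integral => //; first by meas.
    by move=> r _; rewrite lee_fin.
  exists E; split => // r /= /not_implyP[_ /eqP]; rewrite eqe => qr.
  by rewrite /E/= lt_neqAle eq_sym qr q0.
by case: hq => _ _ _ -> [] /eqP; rewrite oner_eq0.
Qed.

(** Rewritten in the landing point [z = r x], so that jumps from two different points can be
    compared. *)
Let scaled_variance n x : (0 < x)%R ->
  \int[leb]_z ((q (z / x))%:E * ((w n z - w n x) ^+ 2)%:E) = (x * jump_variance q w n x)%:E.
Proof.
move=> x0; have mwn := mw n.
have bd : bmf (fun r => (w n (r * x) - w n x) ^+ 2)%R.
  split; first by meas.
  exists 1%R => r; rewrite ger0_norm ?sqr_ge0//.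
  move: (w01 n (r * x)%R) (w01 n x) => /andP[? ?] /andP[? ?].
  rewrite -subr_ge0 [X in (0 <= X)%R](_ : _ = (1 - (w n (r * x) - w n x)) * (1 + (w n (r * x) - w n x)))%R; last by ring.
  by rewrite mulr_ge0//; lra.
rewrite EFinM /jump_variance (EEE hq bd).
have xn0 : (x != 0)%R by rewrite gt_eqF.
rewrite -(ge0_integral_affine 0%R xn0 (f := fun z => (q (z / x))%:E * ((w n z - w n x) ^+ 2)%:E)); last 2 first.
- by meas.
- by move=> z; rewrite mule_ge0 ?lee_fin ?sqr_ge0.
rewrite gtr0_norm//; congr (_ * _); apply: eq_integral => r _.
by rewrite addr0 mulrAC divff// mul1r (mulrC x).
Qed.

(** Jumps from [x] and [y] reach common points [z], with common weight [m], and [(w x - w y)^2 <= 2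
    (w z - w x)^2 + 2 (w z - w y)^2]. Integrating over [z] bounds a positive multiple [c] of the
    left side by the jump variances at [x] and [y]. *)
Let overlap_constancy (x y : R) : (0 < x)%R -> (0 < y)%R ->
  0 < \int[leb]_z ((\1_E (z / x)%R)%:E * (\1_E (z / y)%R)%:E) ->
  (w n x - w n y)%R @[n --> \oo] --> (0 : R)%R.
Proof.
move=> x0 y0 ov.
pose m z := Num.min (q (z / x)) (q (z / y)).
have m0 z : (0 <= m z)%R by rewrite /m le_min !q0.
have mm : measurable_fun setT m by apply: measurable_minr; meas.
pose C := \int[leb]_z (m z)%:E.
have xn0 : (x^-1 != 0)%R by rewrite invr_eq0 gt_eqF.
have qx : \int[leb]_z (q (z / x))%:E = x%:E.
  case: (hq) => _ _ _ q1.
  have mqE : measurable_fun setT (fun r => (q r)%:E) by meas.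
  have qE0 r : 0 <= (q r)%:E by rewrite lee_fin.
  have := ge0_integral_affine 0%R xn0 mqE qE0; rewrite q1 gtr0_norm ?invr_gt0//.
  under eq_integral do rewrite addr0 mulrC.
  move=> /(congr1 (fun u => x%:E * u)); rewrite muleA -EFinM divff ?gt_eqF//.
  by rewrite mul1e mule1.
have C_fin : C \is a fin_num.
  rewrite ge0_fin_numE; last by apply: integral_ge0 => z _; rewrite lee_fin.
  apply: (@le_lt_trans _ _ x%:E); last exact: ltry.
  rewrite -qx; apply: ge0_le_integral => //.
  - by move=> z _; rewrite lee_fin.
  - by meas.
  - by meas.
  - by move=> z _; rewrite lee_fin /m ge_min lexx.
have C_gt0 : 0 < C.
  rewrite lt_neqAle integral_ge0 ?andbT; last by move=> z _; rewrite lee_fin.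
  apply/negP => /eqP C0.
  have mK : measurable_fun setT (fun z => (m z)%:E) by meas.
  have H' := (ae_eq_integral_abs leb measurableT mK).1.
  have H : ae_eq leb setT (fun z => (m z)%:E) (cst 0).
    by apply: H'; rewrite [RHS]C0; apply: eq_integral => z _; rewrite gee0_abs ?lee_fin.
  suff : \int[leb]_z ((\1_E (z / x)%R)%:E * (\1_E (z / y)%R)%:E) = 0.
    by move=> ov0; move: ov; rewrite ov0 ltxx.
  rewrite -[RHS](@integral0 _ _ _ leb setT); apply: ge0_ae_eq_integral => //.
  - by have := mE => mE'; meas.
  apply: filterS H => z /(_ I) /eqP; rewrite eqe => mz _ /=.
  rewrite !indicE -EFinM; congr (_%:E).
  have [zx|] := boolP ((z / x)%R \in E); last by rewrite mul0r.
  have [zy|] := boolP ((z / y)%R \in E); last by rewrite mulr0.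
  move: zx zy; rewrite !inE /E/= => zx zy.
  by exfalso; move: mz; apply/negP; rewrite gt_eqF// /m lt_min zx.
pose c := fine C.
have c0 : (0 < c)%R by rewrite -lte_fin fineK.
have key n : (c * (w n x - w n y) ^+ 2 <=
    2 * (x * jump_variance q w n x) + 2 * (y * jump_variance q w n y))%R.
  have mwn := mw n.
  rewrite -lee_fin EFinM fineK// -ge0_integralZr ?lee_fin ?sqr_ge0//; last 2 first.
  - by meas.
  - by move=> z _; rewrite lee_fin.
  rewrite EFinD !(EFinM 2) -(scaled_variance n x0) -(scaled_variance n y0).
  rewrite -!ge0_integralZl//; last 4 first.
  - by meas.
  - by move=> z _; rewrite mule_ge0 ?lee_fin ?sqr_ge0.
  - by meas.
  - by move=> z _; rewrite mule_ge0 ?lee_fin ?sqr_ge0.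
  rewrite -ge0_integralD//; last 4 first.
  - by move=> z _; rewrite !mule_ge0 ?lee_fin ?sqr_ge0.
  - by meas.
  - by move=> z _; rewrite !mule_ge0 ?lee_fin ?sqr_ge0.
  - by meas.
  apply: ge0_le_integral => //.
  - by move=> z _; rewrite mule_ge0 ?lee_fin ?sqr_ge0.
  - by meas.
  - by meas.
  move=> z _; rewrite -!EFinM -EFinD lee_fin.
  have mx : (m z <= q (z / x))%R by rewrite /m ge_min lexx.
  have my : (m z <= q (z / y))%R by rewrite /m ge_min lexx orbT.
  apply: (@le_trans _ _ (m z * (2 * (w n z - w n x) ^+ 2 + 2 * (w n z - w n y) ^+ 2))%R).
    rewrite ler_wpM2l// -subr_ge0.
    rewrite [X in (0 <= X)%R](_ : _ = (w n x + w n y - 2 * w n z) ^+ 2)%R ?sqr_ge0//; ring.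
  rewrite mulrDr; apply: lerD.
    by rewrite mulrCA ler_pM2l// ler_wpM2r ?sqr_ge0.
  by rewrite mulrCA ler_pM2l// ler_wpM2r ?sqr_ge0.
have Gx := jump_variance_cvg0 hq mw w01 wharm x0.
have Gy := jump_variance_cvg0 hq mw w01 wharm y0.
have S0 : (2 * (x * jump_variance q w n x) + 2 * (y * jump_variance q w n y))%R
    @[n --> \oo] --> (0 : R)%R.
  rewrite -[X in _ --> X](_ : 2 * (x * 0) + 2 * (y * 0) = 0)%R; last by rewrite !mulr0 addr0.
  by apply: cvgD; apply: cvgM => //; try exact: cvg_cst;
    apply: cvgM => //; exact: cvg_cst.
apply/cvgrPdist_le => e e0.
have ce : (0 < c * e ^+ 2)%R by rewrite mulr_gt0// exprn_gt0.
move/cvgrPdist_le : S0 => /(_ _ ce); apply: filterS => n.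
rewrite !sub0r !normrN => S_le.
have := le_trans (key n) (le_trans (ler_norm _) S_le).
rewrite ler_pM2l// -[leLHS]real_normK ?num_real//.
by rewrite ler_sqr// ?nnegrE// ltW.
Qed.

(** Points of ratio at most [rho0] have overlapping sets of landing points. Others are joined by a
    chain of steps of ratio [rho0], finite by Bernoulli's inequality. *)
Lemma asymptotically_constant (x y : R) : (0 < x)%R -> (0 < y)%R ->
  (w n x - w n y)%R @[n --> \oo] --> (0 : R)%R.
Proof.
have [rho0 rho1 ov] := dilation_overlap mE Epos lebE.
have rho_gt0 : (0 < rho0)%R by rewrite (lt_trans _ rho1).
have near_case (u v : R) : (0 < u)%R -> (u <= v <= rho0 * u)%R ->
    (w n u - w n v)%R @[n --> \oo] --> (0 : R)%R.
  move=> u0 /andP[uv vu]; have v0 : (0 < v)%R by exact: lt_le_trans uv.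
  apply: overlap_constancy => //.
  have vu1 : (1 <= v / u <= rho0)%R by rewrite ler_pdivlMr// mul1r uv ler_pdivrMr.
  have mE' := mE.
  have un0 : (u != 0)%R by rewrite gt_eqF.
  have := ov _ vu1.
  rewrite -(ge0_integral_affine 0%R un0 (f := fun z => (\1_E (z / u)%R)%:E * (\1_E (z / v)%R)%:E)); last 2 first.
  - by meas.
  - by move=> z; rewrite mule_ge0 ?lee_fin.
  rewrite gtr0_norm// => I0; apply: mule_gt0; first by rewrite lte_fin.
  apply: lt_le_trans I0 _; rewrite le_eqVlt; apply/orP; left; apply/eqP.
  apply: eq_integral => z _; rewrite addr0 mulrAC divff// mul1r.
  by rewrite invf_div mulrA (mulrC u).
have far_case N (u v : R) : (0 < u)%R -> (u <= v <= rho0 ^+ N * u)%R ->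
    (w n u - w n v)%R @[n --> \oo] --> (0 : R)%R.
  elim: N u v => [|N IH] u v u0 /andP[uv vu].
    have -> : v = u by apply/eqP; rewrite eq_le uv andbT; move: vu; rewrite expr0 mul1r.
    by under eq_fun do rewrite subrr; exact: cvg_cst.
  have [vru|vru] := leP v (rho0 * u)%R; first by apply: near_case; rewrite ?uv.
  have ru0 : (0 < rho0 * u)%R by rewrite mulr_gt0.
  have H1 : (w n u - w n (rho0 * u))%R @[n --> \oo] --> (0 : R)%R.
    by apply: near_case => //; rewrite lexx andbT ler_peMl// ltW.
  have H2 : (w n (rho0 * u) - w n v)%R @[n --> \oo] --> (0 : R)%R.
    by apply: IH => //; rewrite (ltW vru)/= mulrA -exprSr.
  rewrite (_ : (fun n => _) = (fun n => (w n u - w n (rho0 * u)) +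
    (w n (rho0 * u) - w n v))%R); last by apply/funext => n; rewrite addrA subrK.
  by rewrite -[X in _ --> X](addr0 (0%R : R)); exact: cvgD.
have ex_pow (u v : R) : (0 < u)%R -> exists N, (v <= rho0 ^+ N * u)%R.
  move=> u0; have d0 : (0 < rho0 - 1)%R by rewrite subr_gt0.
  pose N := (Num.trunc (`|v| / u / (rho0 - 1))).+1.
  exists N; rewrite -ler_pdivrMr//.
  have hN : (`|v| / u / (rho0 - 1) < N%:R)%R by rewrite /N; exact: truncnS_gt.
  rewrite (@le_trans _ _ (N%:R * (rho0 - 1))%R)//.
    rewrite -ler_pdivrMr//; apply: le_trans (ltW hN).
    by rewrite !ler_pM2r ?invr_gt0// ler_norm.
  elim: (N) => [|M IH]; first by rewrite mul0r expr0.
  have ge1 : (1 <= rho0 ^+ M)%R by rewrite exprn_ege1// ltW.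
  rewrite exprS -natr1; nra.
move=> x0 y0; have [xy|yx] := leP x y.
  by have [N hN] := ex_pow x y x0; apply: (far_case N); rewrite ?xy.
have [N hN] := ex_pow y x y0.
have H : (w n y - w n x)%R @[n --> \oo] --> (0 : R)%R.
  by apply: (far_case N) => //; rewrite (ltW yx).
rewrite (_ : (fun n => _) = (fun n => - (w n y - w n x))%R); last first.
  by apply/funext => n; rewrite opprB.
by rewrite -[X in _ --> X](@oppr0 R); exact: cvgN.
Qed.

End asymptotic_constancy.

(** * Poisson weights and their shift *)

Definition pois (R : realType) (s : R) (n : nat) : R := (expR (- s) * (s ^+ n / n`!%:R))%R.

Section poisson_weights.
Variables (R : realType) (s : R).
Hypothesis s0 : (0 <= s)%R.

Lemma pois_ge0 n : (0 <= pois s n)%R.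
Proof. by rewrite mulr_ge0 ?expR_ge0// divr_ge0// exprn_ge0. Qed.

Lemma poisS n : (n.+1%:R * pois s n.+1 = s * pois s n)%R.
Proof.
rewrite /pois exprS factS natrM.
have n0 : (n.+1%:R != 0 :> R)%R by rewrite pnatr_eq0.
have f0 : (n`!%:R != 0 :> R)%R by rewrite pnatr_eq0 -lt0n fact_gt0.
by rewrite invfM; move: n0; move: (n.+1%:R)%R => c c0; field; rewrite f0.
Qed.

Lemma pois_series_cvg : (\sum_(0 <= i < n) pois s i)%R @[n --> \oo] --> (1 : R)%R.
Proof.
have -> : (fun n => \sum_(0 <= i < n) pois s i)%R = (fun n => expR (- s) * series (exp_coeff s) n)%R.
  by apply/funext => n; rewrite /series/= mulr_sumr.
have -> : (1 = expR (- s) * expR s :> R)%R by rewrite -expRD addNr expR0.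
by apply: cvgM; [exact: cvg_cst|exact: is_cvg_series_exp_coeff].
Qed.

Lemma sum_pois_le1 n : (\sum_(0 <= i < n) pois s i <= 1)%R.
Proof.
have <- := cvg_lim (@Rhausdorff R) pois_series_cvg.
apply: (nondecreasing_cvgn_le (u_ := fun n => (\sum_(0 <= i < n) pois s i)%R)).
  move=> i j ij; rewrite (big_cat_nat _ ij)//= lerDl sumr_ge0// => k _.
  exact: pois_ge0.
by apply/cvg_ex; exists 1%R; exact: pois_series_cvg.
Qed.

Lemma pois_cvg0 : pois s n @[n --> \oo] --> (0 : R)%R.
Proof.
rewrite -[X in _ --> X](mulr0 (expR (- s))).
apply: cvgM; first exact: cvg_cst.
exact: (cvg_series_cvg_0 (@is_cvg_series_exp_coeff R s)).
Qed.

(** The boundary term is nonpositive once [N >= s], so the truncated variance is at most [s]. *)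
Lemma pois_variance N : (\sum_(0 <= n < N.+1) pois s n * (n%:R - s) ^+ 2 =
  s * \sum_(0 <= n < N) pois s n + s * pois s N * (s - N%:R))%R.
Proof.
elim: N => [|N IH]; first by rewrite big_nat1 big_geq//; ring.
rewrite big_nat_recr//= IH [X in (_ = _ * X + _)%R]big_nat_recr//=.
move: (poisS N) (\sum_(0 <= n < N) _)%R; rewrite -natr1.
move: (pois s N) (pois s N.+1) (N%:R : R)%R => p p' c E S.
apply/eqP; rewrite -subr_eq0.
rewrite (_ : _ - _ = (s - c - 1) * (s * p - (c + 1) * p'))%R; last by ring.
by rewrite E subrr mulr0.
Qed.

(** Summation by parts, with [p_(n-1) = (n / s) p_n] giving the differences of the weights. *)
Lemma pois_abel (k : nat -> R) N : (0 < s)%R ->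
  (\sum_(0 <= n < N.+1) pois s n * (k n - k n.+1) + pois s N * k N.+1 =
   \sum_(0 <= n < N.+1) pois s n * (1 - n%:R / s) * k n)%R.
Proof.
move=> s_gt0; elim: N => [|N IH]; first by rewrite !big_nat1 mul0r; ring.
rewrite big_nat_recr//= [RHS]big_nat_recr//= -IH.
have -> : pois s N = (N.+1%:R / s * pois s N.+1)%R.
  by rewrite mulrAC poisS mulrAC divff ?mul1r// gt_eqF.
by ring.
Qed.

(* Termwise AM-GM, [2 |1 - n/s| <= d + (1 - n/s)^2 / d], and the variance of the weights. *)
Lemma pois_shift (k : nat -> R) N (d : R) : (forall n, 0 <= k n <= 1)%R ->
  (0 < s)%R -> (0 < d)%R -> (s <= N%:R)%R ->
  (`|\sum_(0 <= n < N.+1) pois s n * (k n - k n.+1)| <=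
     pois s N + (d + (s * d)^-1) / 2)%R.
Proof.
move=> k01 s_gt0 d0 sN.
have -> : (\sum_(0 <= n < N.+1) pois s n * (k n - k n.+1) =
   \sum_(0 <= n < N.+1) pois s n * (1 - n%:R / s) * k n - pois s N * k N.+1)%R.
  by rewrite -pois_abel// addrK.
rewrite (le_trans (ler_normB _ _))// addrC lerD//.
  have /andP[k0 k1] := k01 N.+1.
  have p0 := pois_ge0 N.
  by rewrite ger0_norm; [exact: ler_piMr|exact: mulr_ge0].
have s2 : (s ^+ 2 != 0)%R by rewrite expf_neq0// gt_eqF.
have step n : (`|pois s n * (1 - n%:R / s) * k n| <=
    d / 2 * pois s n + (2 * d * s ^+ 2)^-1 * (pois s n * (n%:R - s) ^+ 2))%R.
  have /andP[k0 k1] := k01 n.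
  rewrite normrM (ger0_norm k0) (@le_trans _ _ `|pois s n * (1 - n%:R / s)|%R)//.
    by rewrite ler_piMr.
  have p0 := pois_ge0 n; rewrite normrM (ger0_norm p0).
  have -> : (d / 2 * pois s n + (2 * d * s ^+ 2)^-1 * (pois s n * (n%:R - s) ^+ 2) =
    pois s n * ((d ^+ 2 + (1 - n%:R / s) ^+ 2) / (2 * d)))%R.
    by field; rewrite !gt_eqF.
  rewrite ler_wpM2l// ler_pdivlMr ?mulr_gt0//.
  rewrite -[X in (_ <= _ + X)%R]real_normK ?num_real//.
  rewrite -subr_ge0; move: (`|_|)%R => z.
  have -> : (d ^+ 2 + z ^+ 2 - z * (2 * d) = (d - z) ^+ 2)%R by ring.
  exact: sqr_ge0.
rewrite (le_trans (ler_norm_sum _ _ _))// (le_trans (ler_sum _ (fun n _ => step n)))//.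
rewrite big_split/= -mulr_sumr -[X in (_ + X <= _)%R]mulr_sumr pois_variance [leRHS]mulrDl lerD//.
  by apply: ler_piMr; [rewrite divr_ge0 ?(ltW d0)|exact: sum_pois_le1].
have -> : ((s * d)^-1 / 2 = (2 * d * s ^+ 2)^-1 * s)%R by field; rewrite !gt_eqF.
rewrite ler_wpM2l ?invr_ge0 ?mulr_ge0 ?sqr_ge0 ?(ltW d0)//.
rewrite -[leRHS]addr0 lerD//; first by apply: ler_piMr => //; exact: sum_pois_le1.
apply: mulr_ge0_le0; last by rewrite subr_le0.
by apply: mulr_ge0 => //; exact: pois_ge0.
Qed.

End poisson_weights.

Definition poist (R : realType) (m : R) (n : nat) (t : R) : R :=
  (if (0 <= t)%R then pois (m * t) n else 0)%R.

Lemma poist_ge0 (R : realType) (m t : R) n : (0 <= m)%R -> (0 <= poist m n t)%R.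
Proof. by move=> m0; rewrite /poist; case: ifP => // t0; rewrite pois_ge0// mulr_ge0. Qed.

Lemma measurable_poist (R : realType) (m : R) n : measurable_fun setT (poist m n).
Proof. by rewrite /poist /pois; meas. Qed.

Lemma poist0E (R : realType) (m t : R) : (poist m 0 t)%:E = Ex m t.
Proof.
rewrite /poist /Ex; case: ifP => // _.
by rewrite /pois expr0 fact0 divr1 mulr1 mulNr.
Qed.

(** The exponentials multiply to [e^(-m t)], independent of [s], and the power [s^n] remains to be
    integrated. *)
Lemma convol_poist (R : realType) (m t : R) n : (0 <= m)%R ->
  m%:E * convol (Ex m) (fun s => (poist m n s)%:E) t = (poist m n.+1 t)%:E.
Proof.
move=> m0; have [t0|t0] := ltP t 0%R.
  rewrite convol_lt0 ?mule0 ?/poist ?leNgt ?t0//; first exact: Ex_lt0.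
  by move=> s s0; rewrite leNgt s0.
have mp := @measurable_poist R m n; have p0 s := @poist_ge0 R m s n m0.
rewrite convolC//; [|exact: measurable_Ex|by meas|exact: Ex_ge0].
rewrite convol_itv; [|by move=> s s0; rewrite /poist leNgt s0|exact: Ex_lt0].
pose K := (expR (- (m * t)) * m ^+ n.+1 / n`!%:R)%R.
pose F (s : R) := (K / n.+1%:R * s ^+ n.+1)%R; pose f (s : R) := (K * s ^+ n)%R.
rewrite -ge0_integralZl//; last 2 first.
- apply: measurable_funTS; apply: emeasurable_funM; first by meas.
  by apply: (measurableT_comp (@measurable_Ex R m)); meas.
- by move=> s _; rewrite mule_ge0 ?lee_fin ?Ex_ge0.
transitivity (\int[leb]_(s in `[0%R, t]) (f s)%:E).
  apply: eq_integral => s; rewrite inE/= in_itv/= => /andP[s0 st].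
  rewrite /poist /Ex s0 subr_ge0 st -!EFinM /f /pois; congr (_%:E).
  by rewrite exprMn /K exprS (_ : (- (m * t))%R = (- (m * s) + - m * (t - s))%R) ?expRD; ring.
have dF (x : R) : is_derive x 1%R F (f x).
  rewrite (_ : F = (K / n.+1%:R)%R *: (@id R) ^+ n.+1); last first.
    by apply/funext => s; rewrite /F fctE/=.
  apply: is_derive_eq; rewrite /f /GRing.scale/= mulr1 mulrA; congr (_ * _)%R.
  by rewrite -mulrA mulVf ?mulr1// pnatr_eq0.
have cf (x : R) : {for x, continuous f}.
  by apply: cvgM; [exact: cvg_cst|exact: exprn_continuous].
rewrite (integral_derivative t0 (fun x _ => dF x) (fun x _ => cf x)).
rewrite /F expr0n/= mulr0 subr0 /poist t0 /pois /K exprMn factS natrM invfM.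
by congr (_%:E); ring.
Qed.

(** * Uniformization at the rate of the starting point *)

Section uniformization.
Variables (R : realType) (alpha : R) (h : R -> R).
Let q := dens h.
Hypothesis hq : jump_density q.
Hypothesis alpha0 : (0 < alpha)%R.
Variable x0 : R.
Hypothesis x0_gt0 : (0 < x0)%R.
Let lam x := (x `^ alpha)%R.
Let m := lam x0.
Let m0 : (0 < m)%R. Proof. exact: powR_gt0. Qed.

(** Probability that an event of the rate [m] clock is a true jump. It equals [1] at [x0]; the
    minimum matters only above [x0], where it keeps the chain a probability. *)
Let rr y : R := Num.min 1%R (lam y / m)%R.

Let rr01 y : (0 <= rr y <= 1)%R.
Proof. by rewrite /rr le_min ler01 ge_min lexx divr_ge0 ?powR_ge0. Qed.

Let rrE y : (0 < y <= x0)%R -> (m * rr y = lam y)%R.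
Proof.
move=> /andP[y0 yx]; rewrite /rr min_r; first by rewrite mulrCA divff ?mulr1// gt_eqF.
by rewrite ler_pdivrMr// mul1r ge0_ler_powR// ?nnegrE ltW.
Qed.

(* the probability that the jump chain uniformized at rate [m] is in [B] after [n] steps *)
Fixpoint uchain (B : set R) (n : nat) (y : R) : R :=
  if n is k.+1 then (rr y * QR q (uchain B k) y + (1 - rr y) * uchain B k y)%R
  else \1_B y.

Let mrr : measurable_fun setT rr.
Proof. by apply: measurable_minr; rewrite /lam; meas. Qed.

Let brr : bmf rr.
Proof.
split=> //; exists 1%R => y; have /andP[? ?] := rr01 y.
by rewrite ger0_norm.
Qed.

Lemma bmf_uchain B n : measurable B -> bmf (uchain B n).
Proof.
move=> mB; elim: n => [|n IH]/=.
  by split; [exact: measurable_indic|exists 1%R => y; rewrite ger0_norm ?indicE ?lern1 ?leq_b1].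
apply: bmfD; apply: bmfM => //; first exact: bmf_QR.
by apply: (bmfD (f := fun=> 1%R)); [exact: bmf_cst|exact: bmfN].
Qed.

Lemma uchain_setC B n y : measurable B -> (uchain (~` B) n y = 1 - uchain B n y)%R.
Proof.
move=> mB; elim: n y => [|n IH] y/=.
  by rewrite !indicE in_setC; case: (_ \in _); rewrite /= ?subrr ?subr0.
have -> : QR q (uchain (~` B) n) y = (1 - QR q (uchain B n) y)%R.
  rewrite /QR -{1}(EE_cst hq 1%R) -[X in (_ - X)%R]mul1r -mulNr -(EEZ hq); last first.
    exact/bmf_dilate/bmf_uchain.
  rewrite -(EED hq); [|exact: bmf_cst|exact/bmfZ/bmf_dilate/bmf_uchain].
  by apply: (eq_EE hq) => r _; rewrite IH mulN1r.
by rewrite IH; ring.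
Qed.

Lemma uchain01 B n y : measurable B -> (0 <= uchain B n y <= 1)%R.
Proof.
move=> mB; elim: n y => [|n IH] y/=; first by rewrite indicE ler0n lern1 leq_b1.
have /andP[Q0 Q1] : (0 <= QR q (uchain B n) y <= 1)%R.
  by apply: (EE_bound hq) => //; exact/bmf_dilate/bmf_uchain.
have /andP[u0 u1] := IH y; have /andP[r0 r1] := rr01 y.
rewrite addr_ge0 ?mulr_ge0 ?subr_ge0//=.
rewrite [leRHS](_ : 1%R = rr y * 1 + (1 - rr y) * 1)%R; last by ring.
by apply: lerD; apply: ler_wpM2l => //; rewrite subr_ge0.
Qed.

Let V B N (t y : R) := (\sum_(0 <= n < N) poist m n t * uchain B n y)%R.

Let V0 B N t y : measurable B -> (0 <= V B N t y)%R.
Proof.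
move=> mB; apply: sumr_ge0 => n _; rewrite mulr_ge0 ?poist_ge0 ?(ltW m0)//.
by have /andP[] := uchain01 n y mB.
Qed.

Let bmfV B N t : measurable B -> bmf (V B N t).
Proof.
move=> mB; elim: N => [|N IH].
  rewrite (_ : V _ _ _ = fun=> 0%R); first exact: bmf_cst.
  by apply/funext => y; rewrite /V big_geq.
rewrite (_ : V _ _ _ = fun y => V B N t y + poist m N t * uchain B N y)%R.
  by apply: bmfD => //; exact/bmfZ/bmf_uchain.
by apply/funext => y; rewrite /V big_nat_recr.
Qed.

Let QRV B N t y : measurable B ->
  QR q (V B N t) y = (\sum_(0 <= n < N) poist m n t * QR q (uchain B n) y)%R.
Proof.
move=> mB; elim: N => [|N IH].
  rewrite big_geq// /QR (_ : (fun _ => _) = fun=> 0%R) ?(EE_cst hq)//.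
  by apply/funext => r; rewrite /V big_geq.
rewrite big_nat_recr//= -IH /QR -(EEZ hq); last exact/bmf_dilate/bmf_uchain.
rewrite -(EED hq); [|exact/bmf_dilate/bmfV|exact/bmfZ/bmf_dilate/bmf_uchain].
by apply: (eq_EE hq) => r _; rewrite /V big_nat_recr.
Qed.

Let mV B N y : measurable_fun setT (fun t => V B N t y).
Proof.
apply: measurable_sum => n; have mp := @measurable_poist R m n.
by meas.
Qed.

Let convolV B N t y : measurable B ->
  convol (Ex m) (fun s => (m * \sum_(0 <= n < N) poist m n s * uchain B n.+1 y)%:E) t =
  (\sum_(0 <= n < N) poist m n.+1 t * uchain B n.+1 y)%:E.
Proof.
move=> mB; have mE := @measurable_Ex R m; have E0 := @Ex_ge0 R m.
elim: N => [|N IH].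
  rewrite big_geq// convolE integral0_eq// => s _.
  by rewrite big_geq// mulr0 mule0.
have mp n := @measurable_poist R m n.
have p0 n s := @poist_ge0 R m s n (ltW m0).
have u0 n : (0 <= uchain B n y)%R by have /andP[] := uchain01 n y mB.
have -> : (fun s => (m * \sum_(0 <= n < N.+1) poist m n s * uchain B n.+1 y)%:E) =
  fun s => (m * \sum_(0 <= n < N) poist m n s * uchain B n.+1 y)%:E +
    (uchain B N.+1 y)%:E * (m%:E * (poist m N s)%:E).
  apply/funext => s; rewrite big_nat_recr// -!EFinM -EFinD/=; congr (_%:E); ring.
rewrite (convolDr (b := fun s => (m * \sum_(0 <= n < N) poist m n s * uchain B n.+1 y)%:E)
  (c := fun s => (uchain B N.+1 y)%:E * (m%:E * (poist m N s)%:E)))//; last 4 first.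
- apply/measurable_EFinP; apply: measurable_funM => //.
  by apply: measurable_sum => n; have mpn := mp n; meas.
- by have mpN := mp N; meas.
- move=> s; rewrite lee_fin mulr_ge0 ?(ltW m0)//; apply: sumr_ge0 => n _.
  by rewrite mulr_ge0.
- by move=> s; rewrite -!EFinM lee_fin !mulr_ge0// ltW.
rewrite IH (convolZr (b := fun s => m%:E * (poist m N s)%:E))//; last 3 first.
- by have mpN := mp N; meas.
- by rewrite lee_fin.
- by move=> s; rewrite -!EFinM lee_fin !mulr_ge0// ltW.
rewrite (convolZr (b := fun s => (poist m N s)%:E))//; last 3 first.
- by have mpN := mp N; meas.
- by rewrite lee_fin ltW.
- by move=> s; rewrite lee_fin.
rewrite convol_poist ?(ltW m0)// big_nat_recr//= EFinD -EFinM; congr (_ + _%:E).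
by rewrite mulrC.
Qed.

(** Induction on the number of events: the mixture inserted in the source of [uniformized_equation]
    yields the next step of [uchain], and [convol_poist] the next weight. For [y <= x0] the rate [m]
    dominates [lam y], and jumps preserve this range. *)
Let V_le_tr B N t y : measurable B -> (0 < y <= x0)%R -> (V B N t y)%:E <= tr alpha h B t y.
Proof.
move=> mB; elim: N t y => [|N IH] t y yx; first by rewrite /V big_geq// tr_ge0.
have /andP[y0 yx0] := yx.
have lm : (lam y <= m)%R by rewrite ge0_ler_powR// ?nnegrE ltW.
have -> := congr1 (@^~ t) (uniformized_equation hq mB lm).
rewrite /V big_nat_recl//= EFinD EFinM poist0E muleC leeD//.
rewrite -convolV//; apply: le_convol; [exact: measurable_Ex| | |exact: Ex_ge0| |].
- apply/measurable_EFinP; apply: measurable_funM => //.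
  by apply: measurable_sum => n; have mpn := @measurable_poist R m n; meas.
- have mQ := measurable_Qtr alpha hq mB; have mT := measurable_tr alpha hq mB.
  apply: emeasurable_funD; apply: emeasurable_funM => //.
    by apply: (measurableT_comp mQ (g := fun s : R => (s, y))); meas.
  by apply: (measurableT_comp mT (g := fun s : R => (s, y))); meas.
- move=> s; rewrite lee_fin mulr_ge0 ?(ltW m0)//; apply: sumr_ge0 => n _.
  by rewrite mulr_ge0 ?poist_ge0 ?(ltW m0)//; have /andP[] := uchain01 n.+1 y mB.
move=> s; rewrite (_ : (m * _)%R = (lam y * QR q (V B N s) y + (m - lam y) * V B N s y)%R).
  rewrite EFinD 2!EFinM leeD// lee_wpmul2l//.
  - by rewrite lee_fin powR_ge0.
  - rewrite (EEE hq); last exact/bmf_dilate/bmfV.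
    have [mq q0 qs _] := hq; have mT := measurable_tr2 alpha hq s mB.
    have [mVs _] := bmfV N s mB.
    apply: ge0_le_integral => //.
    + by move=> r _; rewrite mule_ge0 ?lee_fin ?V0.
    + by meas.
    + by meas.
    + move=> r _; rewrite -/q; have [/andP[r0 r1]|/qs->] := boolP (0 < r < 1)%R; last by rewrite !mul0e.
      apply: lee_wpmul2l; first by rewrite lee_fin.
      apply: IH; rewrite mulr_gt0//= (le_trans _ yx0)//.
      by apply: ler_piMl; exact: ltW.
  - by rewrite lee_fin subr_ge0.
  - exact: IH.
rewrite (QRV _ _ _ mB) /V -(rrE yx) !mulr_sumr -big_split/=; apply: eq_bigr => n _.
by ring.
Qed.

Let rho N t := (1 - \sum_(0 <= n < N) poist m n t)%R.

Let W B t y := fine (tr alpha h B t y).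

Let trWE B t y : measurable B -> (W B t y)%:E = tr alpha h B t y.
Proof.
move=> mB; rewrite /W fineK// ge0_fin_numE ?tr_ge0//.
by rewrite (le_lt_trans (tr_le1 alpha hq _ _ mB))// ltry.
Qed.

(** The lower bounds for [B] and its complement add up to [1 - rho N t], the transition
    probabilities to at most [1]; so neither exceeds its lower bound by more than [rho N t]. *)
Let V_close B N t y : measurable B -> (0 < y <= x0)%R ->
  (`|W B t y - V B N t y| <= rho N t)%R.
Proof.
move=> mB yx; have mB' := measurableC mB.
have := V_le_tr N t mB yx; rewrite -trWE// lee_fin => VW.
have := V_le_tr N t mB' yx; rewrite -trWE// lee_fin => VW'.
have := tr_setC_le alpha hq t y mB; rewrite -trWE// -(trWE _ _ mB') -EFinD lee_fin => WW.
have VV : (V B N t y + V (~` B) N t y = 1 - rho N t)%R.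
  rewrite /V -big_split/= /rho opprB addrC subrK; apply: eq_bigr => n _.
  by rewrite uchain_setC//; ring.
move: VW VW' WW VV; move: (W B t y) (W _ t y) (V B N t y) (V _ N t y) (rho N t).
by move=> a b c d e *; rewrite ger0_norm ?subr_ge0//; lra.
Qed.

(** At [x0] every event is a true jump, so applying [Q] shifts the chain by one step and
    [pois_shift] applies; the truncation errors vanish as [N] grows. The free [d] replaces a square
    root: [d = (x0^alpha t)^(-1/2)] balances the two terms. *)
Lemma tr_almost_harmonic B t d : measurable B -> (0 < t)%R -> (0 < d)%R ->
  (`|fine (tr alpha h B t x0) - QR q (fun y => fine (tr alpha h B t y)) x0| <=
     (d + (x0 `^ alpha * t * d)^-1) / 2)%R.
Proof.
move=> mB t0 d0; have s0 : (0 < m * t)%R by rewrite mulr_gt0.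
have ps n : poist m n t = pois (m * t) n by rewrite /poist ltW.
have bW : bmf (W B t).
  split; first exact: (measurableT_comp (@fine_measurable _ _ _) (measurable_tr2 alpha hq t mB)).
  exists 1%R => y; rewrite ger0_norm ?fine_ge0 ?tr_ge0//.
  by rewrite -lee_fin trWE// tr_le1.
have bound N : (m * t <= N%:R)%R ->
    (`|W B t x0 - QR q (W B t) x0| <=
     rho N.+1 t + rho N.+1 t + pois (m * t) N + (d + (m * t * d)^-1) / 2)%R.
  move=> sN; have xx : (0 < x0 <= x0)%R by rewrite x0_gt0/=.
  have VQ : (`|QR q (W B t) x0 - QR q (V B N.+1 t) x0| <= rho N.+1 t)%R.
    rewrite /QR -[X in (_ - X)%R]mul1r -mulNr -(EEZ hq); last exact/bmf_dilate/bmfV.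
    rewrite -(EED hq); [|exact: bmf_dilate|exact/bmfZ/bmf_dilate/bmfV].
    apply: (EE_norm_le hq).
      by apply: bmfD; [exact: bmf_dilate|exact/bmfZ/bmf_dilate/bmfV].
    move=> r /andP[r0 r1]; rewrite mulN1r V_close// mulr_gt0//=.
    by apply: ler_piMl; exact: ltW.
  have VV : (`|V B N.+1 t x0 - QR q (V B N.+1 t) x0| <=
      pois (m * t) N + (d + (m * t * d)^-1) / 2)%R.
    rewrite (QRV _ _ _ mB) /V -sumrB.
    have -> : (\sum_(0 <= i < N.+1) (poist m i t * uchain B i x0 -
        poist m i t * QR q (uchain B i) x0) =
      \sum_(0 <= i < N.+1) pois (m * t) i * (uchain B i x0 - uchain B i.+1 x0))%R.
      apply: eq_bigr => n _; rewrite -mulrBr ps /= (_ : rr x0 = 1%R) ?subrr ?mul0r ?mul1r ?addr0//.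
      by rewrite /rr divff ?gt_eqF// minxx.
    by apply: pois_shift => //; [exact: ltW|move=> n; exact: uchain01].
  have := V_close N.+1 t mB xx.
  move: VV VQ; rewrite !ler_norml => /andP[? ?] /andP[? ?] /andP[? ?].
  by apply/andP; split; lra.
have cvg : (rho N.+1 t + rho N.+1 t + pois (m * t) N + (d + (m * t * d)^-1) / 2)%R @[N --> \oo]
    --> (0 + 0 + 0 + (d + (m * t * d)^-1) / 2)%R.
  have cr : rho N.+1 t @[N --> \oo] --> (0 : R)%R.
    rewrite -[X in _ --> X](subrr (1%R : R)); apply: cvgB; first exact: cvg_cst.
    rewrite (cvg_shiftS (fun N => \sum_(0 <= n < N) poist m n t)%R).
    under eq_fun do under eq_bigr do rewrite ps.
    exact: pois_series_cvg.
  apply: cvgD; last exact: cvg_cst.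
  by apply: cvgD; [exact: cvgD|exact: pois_cvg0].
rewrite !add0r in cvg; apply: (cvgr_to_ge cvg).
near=> N; apply: bound.
by near: N; exact: nbhs_infty_ger.
Unshelve. all: by end_near.
Qed.

End uniformization.

(** * Pairing of densities with bounded functions *)

Section mdens_pairing.
Variable R : realType.
Implicit Types (u v w : R -> R).

Lemma integrable_mdensM u w : Dm u -> bmf w ->
  leb.-integrable setT (EFin \o (fun x => mdens u x * w x)%R).
Proof.
move=> Du [mw [M wM]]; have mu := measurable_mdens Du.
have iM : leb.-integrable setT (fun x => M%:E * (mdens u x)%:E).
  apply: integrableZl => //; apply/integrableP; split; first by meas.
  under eq_integral do rewrite gee0_abs ?lee_fin ?mdens_ge0//.
  by rewrite integral_mdens1// ltry.
apply: (le_integrable measurableT _ _ iM).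
- by apply/measurable_EFinP; exact: measurable_funM.
- move=> x _ /=; rewrite lee_fin !normrM mulrC ler_wpM2r//.
  exact: le_trans (wM x) (ler_norm M).
Qed.

Definition pairing u w : R := (\int[leb]_x (mdens u x * w x))%R.

Lemma pairingE u w : Dm u -> bmf w ->
  (pairing u w)%:E = \int[leb]_x ((mdens u x)%:E * (w x)%:E).
Proof.
move=> Du bw; rewrite /pairing /Rintegral fineK.
  by apply: eq_integral => x _; rewrite EFinM.
exact: (integrable_fin_num measurableT (integrable_mdensM Du bw)).
Qed.

Lemma pairing_cst u (k : R) : Dm u -> pairing u (fun=> k) = k.
Proof.
move=> Du; apply: EFin_inj; rewrite pairingE//; last exact: bmf_cst.
have i1 := integrable_mdensM Du (@bmf_cst R 1%R).
under eq_integral do rewrite -EFinM mulrC -[X in (_ * X)%R]mulr1 EFinM.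
rewrite integralZl//=.
by under eq_integral do rewrite mulr1; rewrite integral_mdens1// mule1.
Qed.

Lemma bmf_indic (B : set R) : measurable B -> bmf (\1_B : R -> R).
Proof.
move=> mB; split; first exact: measurable_indic.
by exists 1%R => y; rewrite ger0_norm ?indicE ?lern1 ?leq_b1.
Qed.

Lemma pairingB u v w : Dm u -> Dm v -> bmf w ->
  (pairing u w - pairing v w)%R = (\int[leb]_x ((mdens u x - mdens v x) * w x))%R.
Proof.
move=> Du Dv bw; rewrite /pairing -RintegralB//; try exact: integrable_mdensM.
by apply: eq_Rintegral => x _; rewrite mulrBl.
Qed.

Lemma pairing_subc u w (k : R) : Dm u -> bmf w ->
  pairing u (fun x => w x - k)%R = (pairing u w - k)%R.
Proof.
move=> Du bw; have bk := @bmf_cst R k.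
rewrite -[X in (_ - X)%R](pairing_cst k Du) /pairing -RintegralB//; try exact: integrable_mdensM.
by apply: eq_Rintegral => x _; rewrite mulrBr.
Qed.

Lemma integrable_mdensB u v w : Dm u -> Dm v -> bmf w ->
  leb.-integrable setT (EFin \o (fun x => (mdens u x - mdens v x) * w x)%R).
Proof.
move=> Du Dv bw.
have := integrableB measurableT (integrable_mdensM Du bw) (integrable_mdensM Dv bw).
by apply: eq_integrable => // x _ /=; rewrite -EFinB mulrBl.
Qed.

Lemma measurable_mdens_lt u v : Dm u -> Dm v ->
  measurable [set x | (mdens v x < mdens u x)%R].
Proof.
move=> Du Dv; rewrite -[X in measurable X]setTI.
have mt := measurable_fun_ltr (measurable_mdens Dv) (measurable_mdens Du).
exact: (mt measurableT [set true]).
Qed.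

(** Both masses are [1], so the positive and negative parts of the difference have equal integrals,
    and [B] carries the positive one. The distance thus becomes a difference of probabilities of one
    set. *)
Lemma mdens_L1_dist u v : Dm u -> Dm v ->
  let B := [set x | (mdens v x < mdens u x)%R] in
  \int[leb]_x `|mdens u x - mdens v x|%:E =
    (2 * (pairing u \1_B - pairing v \1_B))%:E.
Proof.
move=> Du Dv B.
have mB : measurable B by exact: measurable_mdens_lt.
have b1 := bmf_indic mB; have c1 := @bmf_cst R 1%R.
have E1 := pairing_cst 1%R Du; have E2 := pairing_cst 1%R Dv.
transitivity (\int[leb]_x (2 * ((mdens u x - mdens v x) * \1_B x) -
    (mdens u x - mdens v x) * 1)%:E).
  apply: eq_integral => x _; congr (_%:E); rewrite indicE mulr1.
  have [lt|le] := ltP (mdens v x) (mdens u x).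
    by rewrite mem_set// mulr1 gtr0_norm ?subr_gt0//; ring.
  rewrite memNset; last by apply/negP; rewrite -leNgt.
  by rewrite mulr0 mulr0 sub0r ler0_norm ?subr_le0.
have i2 : leb.-integrable setT (EFin \o (fun x => 2 * ((mdens u x - mdens v x) * \1_B x))%R).
  have := integrableZl measurableT 2%R (integrable_mdensB Du Dv b1).
  by apply: eq_integrable => // x _ /=; rewrite -EFinM.
have i3 := integrable_mdensB Du Dv c1.
have := RintegralB measurableT i2 i3.
rewrite -pairingB// E1 E2 subrr subr0 RintegralZl//; last exact: integrable_mdensB.
rewrite -pairingB// => <-; rewrite /Rintegral fineK//.
apply: integrable_fin_num => //.
have := integrableB measurableT i2 i3.
by apply: eq_integrable => // x _ /=; rewrite -EFinB.
Qed.

End mdens_pairing.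

(** * Merging of solutions *)

Section contraction.
Variables (R : realType) (alpha : R) (h : R -> R).
Let q := dens h.
Hypothesis hq : jump_density q.
Hypothesis alpha0 : (0 < alpha)%R.

Let W (B : set R) (t y : R) := fine (tr alpha h B t y).

Let trWE B t y : measurable B -> (W B t y)%:E = tr alpha h B t y.
Proof.
move=> mB; rewrite /W fineK// ge0_fin_numE ?tr_ge0//.
by rewrite (le_lt_trans (tr_le1 alpha hq _ _ mB))// ltry.
Qed.

Let W01 B t y : measurable B -> (0 <= W B t y <= 1)%R.
Proof. by move=> mB; rewrite fine_ge0 ?tr_ge0//= -lee_fin trWE// tr_le1. Qed.

Let mW B t : measurable B -> measurable_fun setT (W B t).
Proof.
move=> mB.
exact: (measurableT_comp (@fine_measurable _ _ _) (measurable_tr2 alpha hq t mB)).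
Qed.

Let bW B t : measurable B -> bmf (W B t).
Proof.
move=> mB; split; first exact: mW.
by exists 1%R => y; have /andP[? ?] := W01 t y mB; rewrite ger0_norm.
Qed.

(** Letting the sets depend on [n] encodes the uniformity in the set. *)
Lemma tr_asymptotically_constant (B : nat -> set R) (t : nat -> R) x y :
  (forall n, measurable (B n)) -> (forall n, 1 <= t n)%R -> t n @[n --> \oo] --> +oo%R ->
  (0 < x)%R -> (0 < y)%R ->
  (fine (tr alpha h (B n) (t n) x) - fine (tr alpha h (B n) (t n) y))%R @[n --> \oo]
    --> (0 : R)%R.
Proof.
move=> mB t1 ty; apply: (asymptotically_constant hq (w := fun n => W (B n) (t n))).
- by move=> n; exact: mW.
- by move=> n z; exact: W01.
(* Taking [d = e], the bound is at most [e] as soon as [z^alpha t n >= e^-2]. *)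
move=> z z0; apply/cvgr0Pnorm_le => e e0; near=> n.
have t0 : (0 < t n)%R by rewrite (lt_le_trans _ (t1 n)).
rewrite (le_trans (tr_almost_harmonic hq alpha0 z0 (mB n) t0 e0))//.
rewrite ler_pdivrMr// mulrDr mulr1 lerD2l -lef_pV2 ?posrE ?invr_gt0 ?mulr_gt0 ?powR_gt0//.
rewrite invrK -ler_pdivrMr// -ler_pdivrMl ?powR_gt0//.
by near: n; move/cvgryPge : ty; apply.
Unshelve. all: by end_near.
Qed.

Lemma solution_pairing u c t B : Dm u -> is_solution alpha h u c -> (0 <= t)%R ->
  measurable B -> B `<=` @pos_half R ->
  pairing (c t) \1_B = pairing u (fun x => fine (tr alpha h B t x)).
Proof.
move=> Du sol t0 mB BP; have [Dc /(_ B mB BP)] := sol t t0.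
rewrite integral_mdensS// -pairingE//; last exact: bmf_indic.
rewrite (integral_mdens u (fun x => trans alpha h t x B)) => E.
apply: EFin_inj; rewrite E pairingE//; last exact: bW.
by apply: eq_integral => x _; rewrite trWE// /tr t0.
Qed.

Lemma dist_mE (c d : R -> R -> R) t :
  dist_m c d t = \int[leb]_x `|mdens (c t) x - mdens (d t) x|%:E.
Proof.
rewrite /dist_m integral_mkcond; apply: eq_integral => x _.
rewrite patchE /mdens.
have -> : (x \in @pos_half R) = (0 < x)%R.
  by apply/idP/idP; rewrite inE /pos_half/= in_itv/= andbT.
case: ifP => [x0|_]; last by rewrite subrr normr0.
by rewrite -mulrBl normrM (gtr0_norm x0).
Qed.

Lemma solutions_merge c0 d0 c d : Dm c0 -> Dm d0 ->
  is_solution alpha h c0 c -> is_solution alpha h d0 d ->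
  dist_m c d t @[t --> +oo%R] --> 0%:E.
Proof.
move=> Dc0 Dd0 solc sold; apply/cvge_pinftyP => s sy.
(* Only finitely many [n] are altered, and every [t n] becomes an admissible time. *)
pose t n := Num.max 1%R (s n).
have t1 n : (1 <= t n)%R by rewrite /t le_max lexx.
have t0 n : (0 <= t n)%R by rewrite (le_trans _ (t1 n)).
have ty : t n @[n --> \oo] --> +oo%R.
  apply/cvgryPge => A; near=> n; rewrite /t le_max; apply/orP; right.
  by near: n; move/cvgryPge : sy; apply.
have st : \forall n \near \oo, dist_m c d (t n) = dist_m c d (s n).
  near=> n; rewrite /t max_r//.
  by near: n; move/cvgryPge : sy; apply.
apply: cvg_trans; first exact: near_eq_cvg st.
(* The set that realizes the distance at time [t n]. *)
pose B n := [set x | (mdens (d (t n)) x < mdens (c (t n)) x)%R].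
have Dct n : Dm (c (t n)) by have [] := solc _ (t0 n).
have Ddt n : Dm (d (t n)) by have [] := sold _ (t0 n).
have mB n : measurable (B n) by exact: measurable_mdens_lt.
have BP n : B n `<=` @pos_half R.
  move=> x; rewrite /B /mdens/= /pos_half/= in_itv/= andbT.
  by case: ifP => //; rewrite ltxx.
pose f x := (mdens c0 x - mdens d0 x)%R.
pose w n := W (B n) (t n).
have bw n : bmf (w n) by exact: bW.
have bw1 n : bmf (fun x => w n x - w n 1)%R.
  by apply: (bmfD (bw n)); exact: bmf_cst.
(* Subtracting the constant [w n 1] changes nothing, since [c0] and [d0] have equal mass; it makes
   the integrand tend to zero pointwise, dominated by [|f|]. *)
have distE n : dist_m c d (t n) = 2%:E * \int[leb]_x (f x * (w n x - w n 1))%:E.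
  rewrite dist_mE mdens_L1_dist// EFinM; congr (_ * _).
  rewrite (solution_pairing Dc0 solc (t0 n) (mB n) (BP n)).
  rewrite (solution_pairing Dd0 sold (t0 n) (mB n) (BP n)).
  transitivity (pairing c0 (fun x => w n x - w n 1) - pairing d0 (fun x => w n x - w n 1))%:E.
    by rewrite !pairing_subc//; congr (_%:E); rewrite -/(W _ _) -/(w n); ring.
  rewrite pairingB// /Rintegral fineK//.
  by apply: integrable_fin_num => //; exact: integrable_mdensB.
suff : \int[leb]_x (f x * (w n x - w n 1))%:E @[n --> \oo] --> \int[leb]_x (cst 0 x : \bar R).
  rewrite integral0 => /(cvgeZl (y := 2%:E) erefl); rewrite mule0; apply: cvg_trans.
  by apply: near_eq_cvg; near=> n; rewrite distE.
have mf : measurable_fun setT f.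
  by apply: measurable_funB; exact: measurable_mdens.
have intf : leb.-integrable setT (EFin \o f).
  have := integrable_mdensB Dc0 Dd0 (@bmf_cst R 1%R).
  by apply: eq_integrable => // x _ /=; rewrite mulr1.
apply: (@dominated_cvg _ _ _ leb setT measurableT _ _ (fun x => `|f x|%:E)) => //.
- by move=> n; apply/measurable_EFinP; apply: measurable_funM => //; case: (bw1 n).
- move=> x _; have [x0|x0] := ltP 0%R x; last first.
    have -> : f x = 0%R by rewrite /f /mdens ltNge x0 subrr.
    by under eq_fun do rewrite mul0r; exact: cvg_cst.
  apply: cvg_EFin; first exact: nearW.
  rewrite -[X in _ --> X](mulr0 (f x)); apply: cvgM; first exact: cvg_cst.
  exact: tr_asymptotically_constant.
- exact: (integrable_abse intf).
- move=> n x _; rewrite lee_fin normrM ler_piMr//.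
  have /andP[? ?] := W01 (t n) x (mB n); have /andP[? ?] := W01 (t n) 1%R (mB n).
  by rewrite ler_norml /w; apply/andP; split; lra.
Unshelve. all: by end_near.
Qed.

End contraction.

Unset Implicit Arguments.

Theorem theorem1p1 (R : realType) (alpha : R) (h : R -> R)
  (Halpha : (0 < alpha)%R)
  (Hmeas : measurable_fun (@unit_open R) h)
  (Hnn : forall r : R, (0 < r)%R -> (r < 1)%R -> (0 <= h r)%R)
  (Hnorm : \int[@lebesgue_measure R]_(r in @unit_open R) (h r * r)%:E = 1) :
  (exists us : R -> R,
     [/\ Dm us,
         (forall t : R, (0 <= t)%R -> Dm (self_sim alpha us t)),
         is_solution alpha h us (self_sim alpha us) &
         forall (c0 : R -> R) (c : R -> R -> R),
           Dm c0 -> is_solution alpha h c0 c ->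
           dist_m c (self_sim alpha us) t @[t --> +oo%R] --> (0%R)%:E])
  <->
  -oo < \int[@lebesgue_measure R]_(z in @unit_open R) (ln z * h z * z)%:E.
Proof.
have hq := dens_jump_density Hmeas Hnn Hnorm; rewrite (log_moment_dens hq).
split=> [[us [Dus _ sol _]]|L_lty].
  by rewrite lteNr; exact: (finite_log_moment hq Halpha Dus sol).
move: L_lty; rewrite lteNr/= => L_lty.
have k_lty : \int[leb]_u profile alpha (dens h) u < +oo.
  by rewrite (le_lt_trans (integral_profile_le1 hq Halpha))// ltry.
have Dus := Dm_us_profile hq Halpha (measurable_profile hq Halpha)
  (profile_ge0 hq Halpha) (profile_fin hq Halpha) (profile_lt0 hq Halpha)
  (fun=> erefl) (profileE hq Halpha) (profile_increment hq Halpha)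
  (integral_profile_gt0 hq Halpha) k_lty L_lty.
have sol : is_solution alpha h (us_profile alpha (profile alpha (dens h)))
    (self_sim alpha (us_profile alpha (profile alpha (dens h)))).
  exact: (us_profile_solution hq Halpha (measurable_profile hq Halpha)
    (profile_ge0 hq Halpha) (profile_fin hq Halpha) (profile_lt0 hq Halpha)
    (fun=> erefl) (measurable_profile_jump hq Halpha) (profile_jump_ge0 hq Halpha)
    (profileE hq Halpha) (profile_increment hq Halpha)
    (integral_profile_gt0 hq Halpha) k_lty L_lty).
exists (us_profile alpha (profile alpha (dens h))); split => //.
- by move=> t; exact: Dm_self_sim.
- by move=> c0 c Dc0 solc; exact: (solutions_merge hq Halpha Dc0 Dus solc sol).
Qed.
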